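(* Suppose the problem described in the context has a unique solution $u\in C^{(4,4)}([0,L]\times[0,T])$ and let $\{u_i^k: 0\le i\le M,\ 0\le k\le N\}$ be the solution of the difference scheme described in the context. Let $U_i^k=u(x_i,t_k)$ and define $\widehat e_i^k=U_i^k-\widehat u_i^k$ for $0\le i\le M$, $2\le k\le N$, and $\widehat e_i^k=U_i^k-u_i^k$ for $0\le i\le M$, $k=0,1$. Then there is a positive constant $c_5$ (independent of $\tau$ and $h$) such that $$\|\widehat e^k\|_\infty\le c_5(\tau^2+h^2),\qquad 0\le k\le N.$$
   Context: Problem: for $\alpha\in(1,2)$, $L,T>0$, ${}_C\mathrm{D}_{0,t}^\alpha u=u_{xx}+f(x,t)$ on $(0,L)\times(0,T]$, $u(x,0)=\varphi(x)$, $u_t(x,0)=\psi(x)$, $u(0,t)=u(L,t)=0$, where ${}_C\mathrm{D}_{0,t}^\alpha u=\frac{1}{\Gamma(2-\alpha)}\int_0^t u_{ss}(x,s)(t-s)^{1-\alpha}\mathrm{d}s$. $C^{(4,4)}$ means continuous partial derivatives up to order 4 in $x$ and up to order 4 in $t$. Grids: $\sigma=1-\alpha/2$; $\tau=T/N$, $t_k=k\tau$, $t_{k+\sigma}=t_k+\sigma\tau$, $t_{1-\alpha/3}=(1-\alpha/3)\tau$; $h=L/M$, $x_i=ih$; $\delta_x^2v_i=(v_{i+1}-2v_i+v_{i-1})/h^2$; $\|v\|_\infty=\max_{0\le i\le M}|v_i|$; $\psi_i=\psi(x_i)$. Time differences: $u_i^{j+\frac12}=(u_i^j+u_i^{j+1})/2$,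 $\delta_t^2u_i^0=\frac2\tau\big[\frac{u_i^1-u_i^0}{\tau}-\psi_i\big]$, $\delta_t^2u_i^j=(u_i^{j+1}-2u_i^j+u_i^{j-1})/\tau^2$ for $j\ge1$. Coefficients: for $k\ge1$, $a_1^{(k,\alpha)}=\frac32\tau^{2-\alpha}\int_0^{1/2}(s-\frac13)(k+\sigma-s)^{1-\alpha}\mathrm{d}s$; $a_l^{(k,\alpha)}=\tau^{2-\alpha}\int_0^1(s-\frac12)(k+\sigma-l+\frac32-s)^{1-\alpha}\mathrm{d}s$ ($2\le l\le k$); $b_l^{(k,\alpha)}=\tau^{2-\alpha}\int_0^1(\frac32-s)(k+\sigma-l+\frac12-s)^{1-\alpha}\mathrm{d}s$ ($1\le l\le k-1$); $b_k^{(k,\alpha)}=\tau^{2-\alpha}\int_0^{\sigma+1/2}s^{1-\alpha}\mathrm{d}s$; $c_l^{(k,\alpha)}=a_{k-l}^{(k,\alpha)}+b_{k-l}^{(k,\alpha)}$ ($0\le l\le k-1$), $c_k^{(k,\alpha)}=\frac32\tau^{2-\alpha}\int_0^{1/2}(1-s)(k+\sigma-s)^{1-\alpha}\mathrm{d}s$. Scheme (unknowns $u_i^k$, $0\le i\le M$, $0\le k\le N$): $\frac{1}{\Gamma(3-\alpha)}t_{1-\frac\alpha3}^{2-\alpha}\delta_t^2u_i^0=\delta_x^2\big[(1-\frac\alpha3)u_i^1+\frac\alpha3u_i^0\big]+f(x_i,t_{1-\frac\alpha3})$, $1\le i\le M-1$; $\frac{1}{\Gamma(2-\alpha)}\sum_{l=0}^kc_l^{(k,\alpha)}\delta_t^2u_i^{k-l}=(\frac12+\sigma)\delta_x^2u_i^{k+\frac12}+(\frac12-\sigma)\delta_x^2u_i^{k-\frac12}+f(x_i,t_{k+\sigma})$,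 $1\le i\le M-1$, $1\le k\le N-1$; $u_i^0=\varphi(x_i)$, $1\le i\le M-1$; $u_0^k=u_M^k=0$, $0\le k\le N$. For $1\le k\le N-1$: $\widehat u_i^{k+1}=(\frac32-\sigma)[(\frac12+\sigma)u_i^{k+1}+(\frac12-\sigma)u_i^k]-(\frac12-\sigma)[(\frac12+\sigma)u_i^k+(\frac12-\sigma)u_i^{k-1}]$. *)

(* Defs.v *)
From HB Require Import structures.
From mathcomp Require Import all_boot all_order all_algebra.
From mathcomp Require Import all_classical all_reals all_analysis.
Set Implicit Arguments. Unset Strict Implicit. Unset Printing Implicit Defensive.
Import Order.TTheory GRing.Theory Num.Theory.
Import numFieldNormedType.Exports.
Local Open Scope classical_set_scope.
Local Open Scope ring_scope.

Section Defs.
Variable R : realType.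

Definition integ (a b : R) (g : R -> R) : R :=
  \int[(@lebesgue_measure R)]_(s in `[a, b]) g s.

Definition Gamma (z : R) : R :=
  \int[(@lebesgue_measure R)]_(x in `]0, +oo[) (x `^ (z - 1) * expR (- x)).

(* u in C^{(4,4)}([0,L]x[0,T]) : D i j (i,j <= 4) stands for the partial
   derivative d^{i+j} u / dx^i dt^j ; these exist in the open rectangle,
   (mixed derivatives in any order agree with D) and extend continuously to
   the closed rectangle; D 0 0 = u. *)
Definition C44_derivs (L T : R) (u : R -> R -> R) (D : nat -> nat -> R -> R -> R) : Prop :=
  [/\ D 0%N 0%N = u,
      (forall i j, (i <= 4)%N -> (j <= 4)%N ->
         {within `[0, L] `*` `[0, T], continuous (fun p : R * R => D i j p.1 p.2)}),
      (forall i j, (i < 4)%N -> (j <= 4)%N -> forall x t, 0 < x < L -> 0 < t < T ->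
         is_derive x 1 (fun y => D i j y t) (D i.+1 j x t)) &
      (forall i j, (i <= 4)%N -> (j < 4)%N -> forall x t, 0 < x < L -> 0 < t < T ->
         is_derive t 1 (fun s => D i j x s) (D i j.+1 x t))].

Definition caputo (alpha : R) (D : nat -> nat -> R -> R -> R) (x t : R) : R :=
  (Gamma (2 - alpha))^-1 * integ 0 t (fun s => D 0%N 2%N x s * (t - s) `^ (1 - alpha)).

Definition is_C44_solution (alpha L T : R) (f : R -> R -> R) (phi psi : R -> R)
    (u : R -> R -> R) : Prop :=
  exists D, [/\ C44_derivs L T u D,
    (forall x t, 0 < x < L -> 0 < t <= T ->
        caputo alpha D x t = D 2%N 0%N x t + f x t),
    (forall x, 0 <= x <= L -> u x 0 = phi x),
    (forall x, 0 <= x <= L -> D 0%N 1%N x 0 = psi x) &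
    (forall t, 0 <= t <= T -> u 0 t = 0 /\ u L t = 0)].

Definition sigma (alpha : R) : R := 1 - alpha / 2.

Definition coef_a (alpha tau : R) (k l : nat) : R :=
  if l == 1%N then
    3 / 2 * tau `^ (2 - alpha) *
      integ 0 (1 / 2) (fun s => (s - 1 / 3) * (k%:R + sigma alpha - s) `^ (1 - alpha))
  else
    tau `^ (2 - alpha) *
      integ 0 1 (fun s => (s - 1 / 2) *
        (k%:R + sigma alpha - l%:R + 3 / 2 - s) `^ (1 - alpha)).

Definition coef_b (alpha tau : R) (k l : nat) : R :=
  if l == k then
    tau `^ (2 - alpha) * integ 0 (sigma alpha + 1 / 2) (fun s => s `^ (1 - alpha))
  else
    tau `^ (2 - alpha) *
      integ 0 1 (fun s => (3 / 2 - s) *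
        (k%:R + sigma alpha - l%:R + 1 / 2 - s) `^ (1 - alpha)).

Definition coef_c (alpha tau : R) (k l : nat) : R :=
  if l == k then
    3 / 2 * tau `^ (2 - alpha) *
      integ 0 (1 / 2) (fun s => (1 - s) * (k%:R + sigma alpha - s) `^ (1 - alpha))
  else coef_a alpha tau k (k - l) + coef_b alpha tau k (k - l).

Definition dx2 (h : R) (w : nat -> R) (i : nat) : R :=
  (w i.+1 - 2 * w i + w i.-1) / h ^+ 2.

Definition dt2 (tau : R) (psi : R -> R) (h : R) (v : nat -> nat -> R) (i k : nat) : R :=
  if k == 0%N then 2 / tau * ((v i 1%N - v i 0%N) / tau - psi (i%:R * h))
  else (v i k.+1 - 2 * v i k + v i k.-1) / tau ^+ 2.

Definition solves_scheme (alpha L T : R) (f : R -> R -> R) (phi psi : R -> R)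
    (N M : nat) (v : nat -> nat -> R) : Prop :=
  let tau := T / N%:R in
  let h := L / M%:R in
  let sg := sigma alpha in
  [/\ (forall i, (1 <= i <= M.-1)%N ->
         (Gamma (3 - alpha))^-1 * ((1 - alpha / 3) * tau) `^ (2 - alpha)
           * dt2 tau psi h v i 0
         = dx2 h (fun j => (1 - alpha / 3) * v j 1%N + alpha / 3 * v j 0%N) i
           + f (i%:R * h) ((1 - alpha / 3) * tau)),
      (forall i k, (1 <= i <= M.-1)%N -> (1 <= k <= N.-1)%N ->
         (Gamma (2 - alpha))^-1 *
           (\sum_(0 <= l < k.+1) coef_c alpha tau k l * dt2 tau psi h v i (k - l))
         = (1 / 2 + sg) * dx2 h (fun j => (v j k + v j k.+1) / 2) i
           + (1 / 2 - sg) * dx2 h (fun j => (v j k.-1 + v j k) / 2) i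
           + f (i%:R * h) (k%:R * tau + sg * tau)),
      (forall i, (1 <= i <= M.-1)%N -> v i 0%N = phi (i%:R * h)) &
      (forall k, (k <= N)%N -> v 0%N k = 0 /\ v M k = 0)].

(* \widehat u_i^{k}, k >= 2 (the formula for \widehat u^{k+1}, shifted) *)
Definition uhat (alpha : R) (v : nat -> nat -> R) (i k : nat) : R :=
  let sg := sigma alpha in
  (3 / 2 - sg) * ((1 / 2 + sg) * v i k + (1 / 2 - sg) * v i k.-1)
  - (1 / 2 - sg) * ((1 / 2 + sg) * v i k.-1 + (1 / 2 - sg) * v i k.-2).

Definition ehat (alpha L T : R) (N M : nat) (u : R -> R -> R) (v : nat -> nat -> R)
    (i k : nat) : R :=
  let U := u (i%:R * (L / M%:R)) (k%:R * (T / N%:R)) in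
  if (k <= 1)%N then U - v i k else U - uhat alpha v i k.

Definition maxnorm (M : nat) (w : nat -> R) : R :=
  \big[Num.max/0]_(i < M.+1) `|w i|.

End Defs.

(* Main.v *)
Require Import Defs.
From HB Require Import structures.
From mathcomp Require Import all_boot all_order all_algebra.
From mathcomp Require Import all_classical all_reals all_analysis.
From mathcomp Require Import measurable_realfun ring lra zify.
Set Implicit Arguments. Unset Strict Implicit. Unset Printing Implicit Defensive.
Import Order.TTheory GRing.Theory Num.Theory.
Import numFieldNormedType.Exports.
Local Open Scope classical_set_scope.
Local Open Scope ring_scope.

(* The error is estimated in discrete H^1 energy. With
   v^k = (e^{k+1} - e^k) / tau and W^{k+1} = (1/2+sigma) e^{k+1} + (1/2-sigma) e^k,
   the right-hand side of the error equation is delta_x^2 (W^{k+1} + W^k) / 2,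
   and testing with (W^{k+1} - W^k) / tau makes it telescope.  The left-hand
   side becomes a discrete convolution of v^j - v^{j-1} with a positive
   decreasing kernel, plus terms in delta_t^2 e^0 and delta_t^2 e^1 coming from
   the first subinterval; an Alikhanov-type inequality makes the convolution
   coercive, and the two exceptional terms are controlled by the maximum
   principle at the first two time levels.  The sup norm of W is then bounded by
   its discrete H^1 seminorm, and the extrapolation defining u-hat only adds a
   consistency error O(tau^2).  Truncation errors are O(tau^2 + h^2) because the
   scheme integrates the kernel exactly against piecewise linear interpolants
   of u_tt, the last piece being constant but centred at the kernel's centroid. *)

(** Put r = 1 - alpha, c = sigma + 1/2 = 1 + r/2, theta = 1 - c = -r/2. The value of sigma serves
    two ends: it puts the centroid of the kernel over the last cell on a grid node, and it makes
    (W^{k+1} - W^k)/tau equal to c v^k + (1 - c) v^{k-1} = v^k - theta (v^k - v^{k-1}), the only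
    test quantity for which coercivity is proved, from theta^2 p_1 <= (1 - 2 theta)(p_0 - p_1) for
    the kernel p. The obstacle is the first cell, of length tau/2 and with nodes tau/3 and tau,
    which breaks the convolution structure. The deviation only involves delta_t^2 e^0 and delta_t^2
    e^1. Times tau^(2-alpha) each of them is O(rho), rho being the truncation bound, since the
    maximum principle at levels 1 and 2 divides by a coefficient of order tau^(-alpha); so both can
    join the source. No Gronwall argument is needed: all kernel weights occurring up to time T,
    scaled by tau^r, are at least T^r. The energy therefore contains a fixed multiple of the summed
    squared velocities, which absorbs what Young's inequality produces from the source. *)

Section ImproperIntegrals.
Variable R : realType.
Implicit Types (f F G : R -> R) (a b : R).
Notation mu := (@lebesgue_measure R).

(** Monotone convergence along an increasing sequence of sets, so that only integrals over tame
    pieces have to be known. It serves both endpoint singularities and the half-line of [Gamma]. *)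
Lemma integral_itv_exhaustion f (I : nat -> set R) (D : set R) (l : R) :
  nondecreasing_seq I -> (forall n, measurable (I n)) ->
  \bigcup_n I n = D ->
  (forall x, D x -> 0 <= f x) -> measurable_fun D f ->
  forall J : nat -> R,
  (forall n, \int[mu]_(x in I n) (f x)%:E = (J n)%:E)%E ->
  J n @[n --> \oo] --> l ->
  (\int[mu]_(x in D) (f x)%:E = l%:E)%E.
Proof.
move=> ndI mI ID f0 mf J IJ Jl.
have sub n : I n `<=` D by rewrite -ID; exact: bigcup_sup.
have h : (\int[mu]_(x in I n) (f x)%:E @[n --> \oo] -->
    \int[mu]_(x in \bigcup_n I n) (f x)%:E)%E.
  apply: ge0_nondecreasing_set_cvg_integral => //.
    move=> n; apply/measurable_EFinP; apply: measurable_funS (sub n) mf.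
    by rewrite -ID; exact: bigcup_measurable.
  by move=> n x /sub /f0; rewrite lee_fin.
rewrite ID in h.
have h2 : (J n)%:E @[n --> \oo] --> l%:E by apply: cvg_EFin => //; exact: nearW.
have e : (fun n => \int[mu]_(x in I n) (f x)%:E)%E = (fun n => (J n)%:E).
  by apply/funext => n; exact: IJ.
by rewrite e in h; apply: cvg_unique h h2.
Qed.

Lemma continuous_oo_within f a b : {in `]a, b[, continuous f} ->
  forall c d, a < c -> d < b -> {within `[c, d], continuous f}.
Proof.
move=> cf c d ac db; apply: continuous_in_subspaceT => x.
rewrite inE/= in_itv/= => /andP[cx xd]; apply: cf.
by rewrite in_itv/= (lt_le_trans ac)//= (le_lt_trans xd).
Qed.

Lemma FTC2_compact f F a b c d : a < c -> c < d -> d < b ->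
  (forall x, a < x < b -> is_derive x 1 F (f x)) ->
  {in `]a, b[, continuous f} ->
  (\int[mu]_(x in `[c, d]) (f x)%:E = (F d - F c)%:E)%E.
Proof.
move=> ac cd db dF cf.
have dFx x : a < x < b -> derivable F x 1 by move=> /dF[].
have cF x : a < x < b -> {for x, continuous F}.
  by move=> /dFx/derivable1_diffP/differentiable_continuous.
rewrite (@continuous_FTC2 _ f F c d)// ?EFinB//.
- exact: continuous_oo_within cf _ _ ac db.
- split.
  + by move=> x; rewrite in_itv/= => /andP[cx xd]; apply: dFx; rewrite (lt_trans ac)//= (lt_trans xd).
  + by apply: cvg_at_right_filter; apply: cF; rewrite ac (lt_trans cd).
  + by apply: cvg_at_left_filter; apply: cF; rewrite db (lt_trans ac).
- move=> x; rewrite in_itv/= => /andP[cx xd].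
  rewrite derive1E; apply: derive_val; apply: dF.
  by rewrite (lt_trans ac)//= (lt_trans xd).
Qed.

(** The integrand may blow up at the ends, as (k - s)^r does at s = k for r < 0. The classical
    theorem is applied on [a + d n, b - d n], and continuity of [F] up to the ends gives the
    limit. *)
Lemma FTC2_oo f F a b : a < b ->
  (forall x, a < x < b -> 0 <= f x) ->
  {within `[a, b], continuous F} ->
  (forall x, a < x < b -> is_derive x 1 F (f x)) ->
  {in `]a, b[, continuous f} ->
  (\int[mu]_(x in `]a, b[) (f x)%:E = (F b - F a)%:E)%E.
Proof.
move=> ab f0 cF dF cf.
(* With denominator n + 3 the bound d n < (b - a)/2 holds already at n = 0, so every truncated
   interval is nondegenerate. *)
pose d n : R := (b - a) / n.+3%:R.
have d0 n : 0 < d n by rewrite divr_gt0// subr_gt0.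
have d2 n : d n < (b - a) / 2.
  by rewrite ltr_pM2l ?subr_gt0// ltf_pV2 ?posrE// ltr_nat.
have dcvg : d n @[n --> \oo] --> (0 : R).
  rewrite -[X in _ --> X](mulr0 (b - a)); apply: cvgMr.
  have h : n.+1%:R^-1 @[n --> \oo] --> (0 : R) by exact: cvg_harmonic.
  have -> : (fun n => n.+3%:R^-1) = (fun n => (n + 2).+1%:R^-1 : R).
    by apply/funext => n; rewrite addn2.
  by rewrite (cvg_shiftn 2 (fun n => n.+1%:R^-1 : R)).
apply: (@integral_itv_exhaustion f (fun n => `[a + d n, b - d n]%classic)
  `]a, b[%classic (F b - F a) _ _ _ _ _ (fun n => F (b - d n) - F (a + d n))).
- move=> n m nm; apply/subsetPset; apply: subset_itv; rewrite bnd_simp.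
  by rewrite lerD2l /d ler_pM2l ?subr_gt0// lef_pV2 ?posrE// ler_nat//.
  by rewrite lerD2l lerN2 /d ler_pM2l ?subr_gt0// lef_pV2 ?posrE// ler_nat//.
- by move=> n; exact: measurable_itv.
- apply/seteqP; split => x.
    move=> [n _ /=]; rewrite !in_itv/= => /andP[h1 h2]; have := d0 n; lra.
  rewrite /= in_itv/= => /andP[ax xb].
  have e0 : 0 < Num.min (x - a) (b - x) by rewrite lt_min !subr_gt0 ax.
  have /cvgrPdist_lt/(_ _ e0)[N _ hN] := dcvg.
  exists N => //=; have := hN N (leqnn _); rewrite /= sub0r normrN gtr0_norm// lt_min.
  by rewrite in_itv/= => /andP[h1 h2]; lra.
- by move=> x; rewrite /= in_itv/=; exact: f0.
- apply: open_continuous_measurable_fun; first exact: interval_open.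
  exact/in_continuous_mksetP.
- move=> n; apply: (@FTC2_compact _ _ a b) => //; have := d0 n; have := d2 n; lra.
- have /(continuous_within_itvP _ ab) [_ Fa Fb] := cF.
  apply: cvgB.
    move/cvg_at_leftP : Fb; apply; split; first by move=> n; have := d0 n; lra.
    by rewrite -[X in _ --> X](subr0 b); apply: cvgB => //; exact: cvg_cst.
  move/cvg_at_rightP : Fa; apply; split; first by move=> n; have := d0 n; lra.
  by rewrite -[X in _ --> X](addr0 a); apply: cvgD => //; exact: cvg_cst.
Qed.

End ImproperIntegrals.

(** * Integrals over a segment and the weakly singular power kernel *)

Section CompactIntegrals.
Variable R : realType.
Implicit Types (f g F : R -> R) (a b c r p : R).
Notation mu := (@lebesgue_measure R).
Notation itg a b f := (mu.-integrable `[a, b] (EFin \o f)).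

Lemma eq_integrable_itv f g a b : (forall s, a <= s <= b -> f s = g s) ->
  itg a b f -> itg a b g.
Proof.
move=> fg; apply: eq_integrable => // s.
by rewrite inE/= in_itv/= => /fg ->.
Qed.

Lemma eq_integ f g a b : (forall s, a <= s <= b -> f s = g s) ->
  integ a b f = integ a b g.
Proof.
by move=> fg; apply: eq_Rintegral => s; rewrite inE/= in_itv/=; exact: fg.
Qed.

Lemma continuous_itg f a b : {within `[a, b], continuous f} -> itg a b f.
Proof. by apply: continuous_compact_integrable; exact: segment_compact. Qed.

Lemma itgZ f a b k : itg a b f -> itg a b (fun s => k * f s).
Proof. by move=> fi; have := @integrableZl _ _ R mu `[a, b] (measurable_itv _) k _ fi. Qed.

Lemma itgD f g a b : itg a b f -> itg a b g -> itg a b (fun s => f s + g s).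
Proof. by move=> fi gi; have := @integrableD _ _ R mu `[a, b] (measurable_itv _) _ _ fi gi. Qed.

Lemma itgB f g a b : itg a b f -> itg a b g -> itg a b (fun s => f s - g s).
Proof. by move=> fi gi; have := @integrableB _ _ R mu `[a, b] (measurable_itv _) _ _ fi gi. Qed.

Lemma integZ f a b k : itg a b f -> integ a b (fun s => k * f s) = k * integ a b f.
Proof. by move=> fi; exact: RintegralZl. Qed.

Lemma integD f g a b : itg a b f -> itg a b g ->
  integ a b (fun s => f s + g s) = integ a b f + integ a b g.
Proof. by move=> fi gi; exact: RintegralD. Qed.

Lemma integB f g a b : itg a b f -> itg a b g ->
  integ a b (fun s => f s - g s) = integ a b f - integ a b g.
Proof. by move=> fi gi; exact: RintegralB. Qed.

Lemma le_integ f g a b : itg a b f -> itg a b g ->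
  (forall s, a <= s <= b -> f s <= g s) -> integ a b f <= integ a b g.
Proof. by move=> fi gi fg; apply: le_Rintegral => // s; rewrite /= in_itv/=; exact: fg. Qed.

Lemma integ_norm_le f g a b : itg a b f -> itg a b g ->
  (forall s, a <= s <= b -> `|f s| <= g s) -> `|integ a b f| <= integ a b g.
Proof.
move=> fi gi fg; rewrite ler_norml -mulN1r -(integZ _ gi); apply/andP; split.
  apply: le_integ => //; first exact: itgZ.
  by move=> s /fg; rewrite mulN1r ler_norml => /andP[].
by apply: le_integ => // s /fg; rewrite ler_norml => /andP[].
Qed.

Lemma integ_split f a b c : a <= b -> b <= c -> itg a c f ->
  integ a c f = integ a b f + integ b c f.
Proof.
move=> ab bc fi; rewrite /integ.
have := @Rintegral_itvB R f (BLeft a) (BRight c) b fi.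
rewrite !bnd_simp => /(_ ab bc)/eqP; rewrite subr_eq addrC => /eqP ->.
congr (_ + _); apply: Rintegral_itv_obnd_cbnd.
by apply: integrableS fi => //; apply: subset_itv; rewrite bnd_simp.
Qed.

Lemma integ_cst a b k : a <= b -> integ a b (fun=> k) = k * (b - a).
Proof.
move=> ab; have e : mu `[a, b] = (b - a)%:E.
  rewrite lebesgue_measure_itv/= lte_fin; case: ltrP => // ba.
  by have -> : b = a; [apply/le_anti; rewrite ab ba|rewrite subrr].
transitivity (k * fine (mu `[a, b])); last by rewrite e.
exact: Rintegral_cst.
Qed.

Lemma integ_EFin f a b : itg a b f ->
  (\int[mu]_(x in `[a, b]) (f x)%:E = (integ a b f)%:E)%E.
Proof. by move=> fi; rewrite /integ /Rintegral fineK//; exact: integrable_fin_num. Qed.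

(** Since [f] is nonnegative inside, the finite value from [FTC2_oo] already yields integrability;
    the two endpoints form a null set, so the values there are irrelevant. *)
Lemma FTC2_integ f F a b : a <= b ->
  (forall x, a < x < b -> 0 <= f x) ->
  {within `[a, b], continuous F} ->
  (forall x, a < x < b -> is_derive x 1 F (f x)) ->
  {in `]a, b[, continuous f} ->
  itg a b f /\ integ a b f = F b - F a.
Proof.
rewrite le_eqVlt => /predU1P[<- _ _ _ _|ab f0 cF dF cf].
  rewrite /integ set_itv1 Rintegral_set1 subrr; split => //.
  apply/integrableP; split; last by rewrite integral_set1.
  exact: measurable_fun_set1.
have mf : measurable_fun `]a, b[ f.
  apply: open_continuous_measurable_fun; first exact: interval_open.
  exact/in_continuous_mksetP.
have If := FTC2_oo ab f0 cF dF cf.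
split.
  apply/integrableP; split.
    apply/measurable_EFinP; exact: (@measurable_fun_itv_cc R a b false true f mf).
  rewrite integral_itv_bndoo; last first.
    by apply: measurableT_comp => //; exact/measurable_EFinP.
  rewrite (_ : integral _ _ _ = (F b - F a)%:E) ?ltry// -If.
  apply: eq_integral => x; rewrite inE/= in_itv/= => /f0 fx.
  by rewrite ger0_norm.
rewrite /integ /Rintegral integral_itv_bndoo ?If//.
exact/measurable_EFinP.
Qed.

(** The absolute value makes the power continuous across 0 on the whole line; restriction then gives
    continuity of (k - s)^p up to and including s = k. *)
Lemma continuous_norm_powR p : 0 < p -> continuous (fun y : R => `|y| `^ p).
Proof.
move=> p0 x; have [->|x0] := eqVneq x 0.
  rewrite /continuous_at normr0 powR0 ?gt_eqF//.
  have := @powR_cvg0 R p p0 => /cvgrPdist_lt h.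
  apply/cvgrPdist_lt => e e0; have [d d0 hd] := h _ e0.
  exists d => // y; rewrite /ball/= sub0r normrN => yd.
  have [->|y0] := eqVneq y 0; first by rewrite normr0 powR0 ?gt_eqF// subrr normr0.
  by apply: hd; rewrite ?normr_gt0//= sub0r normrN normr_id.
apply: (@continuous_comp _ _ _ (fun y : R => `|y|) (fun y => y `^ p)).
  exact: norm_continuous.
apply/differentiable_continuous/derivable1_diffP/derivable_powR.
by rewrite in_itv/= andbT normr_gt0.
Qed.

Lemma continuous_within_eq f g (A : set R) : (forall s, A s -> f s = g s) ->
  {within A, continuous f} -> {within A, continuous g}.
Proof.
move=> fg; apply: subspace_eq_continuous => s; rewrite inE => As.
by rewrite /from_subspace/= fg.
Qed.

Lemma within_continuousZ k f (A : set R) : {within A, continuous f} ->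
  {within A, continuous (fun s => k * f s)}.
Proof. by move=> cf x; apply: cvgMr; exact: cf. Qed.

Lemma within_powR_refl p k a b : 0 < p -> b <= k ->
  {within `[a, b], continuous (fun s => (k - s) `^ p)}.
Proof.
move=> p0 bk; apply: (@continuous_within_eq (fun s => `|k - s| `^ p)).
  by move=> s; rewrite /= in_itv/= => /andP[_ sb]; rewrite ger0_norm// subr_ge0 (le_trans sb).
apply: continuous_subspaceT => x.
apply: (@continuous_comp _ _ _ (fun y : R => k - y) (fun y => `|y| `^ p)).
  by apply: continuousB; [exact: cvg_cst|exact: cvg_id].
exact: continuous_norm_powR.
Qed.

Lemma is_derive_powR_refl p k (s : R) : s < k ->
  is_derive s 1 (fun s => (k - s) `^ p) (- (p * (k - s) `^ (p - 1))).
Proof.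
move=> sk.
have h1 : is_derive (k - s) 1 (fun y : R => y `^ p) (p * (k - s) `^ (p - 1)).
  by apply: is_derive1_powR; rewrite subr_gt0.
have h2 : is_derive s 1 (fun y : R => k - y) (- 1).
  have -> : (fun y : R => k - y) = (cst k \- id) by [].
  by apply: is_derive_eq; rewrite add0r.
have := @is_derive1_comp R (fun y : R => y `^ p) (fun y : R => k - y) s _ _ h1 h2.
by rewrite mulrN1.
Qed.

Lemma continuous_powR_refl p k (s : R) : s < k ->
  {for s, continuous (fun s => (k - s) `^ p)}.
Proof.
move=> sk; apply/differentiable_continuous/derivable1_diffP.
by have [] := is_derive_powR_refl p sk.
Qed.

Lemma integ_powR_refl r k a b : - 1 < r -> a <= b -> b <= k ->
  itg a b (fun s => (k - s) `^ r) /\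
  integ a b (fun s => (k - s) `^ r) =
    ((k - a) `^ (r + 1) - (k - b) `^ (r + 1)) / (r + 1).
Proof.
move=> r1 ab bk; have r0 : r + 1 != 0 by rewrite gt_eqF//; lra.
have [] := @FTC2_integ (fun s => (k - s) `^ r) (fun s => (- (r + 1)^-1) * (k - s) `^ (r + 1)) a b ab.
- by move=> x _; exact: powR_ge0.
- have h : {within `[a, b], continuous (fun s => (k - s) `^ (r + 1))}.
    by apply: within_powR_refl => //; lra.
  exact: within_continuousZ h.
- move=> x /andP[ax xb].
  have xk : x < k by rewrite (lt_le_trans xb).
  have := is_derive_powR_refl (r + 1) xk => d.
  by apply: is_derive_eq; rewrite /GRing.scale/= addrK mulrNN mulrA mulVf// mul1r ?scaler0 ?addr0.
- move=> x; rewrite in_itv/= => /andP[_ xb].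
  by apply: continuous_powR_refl; rewrite (lt_le_trans xb).
by move=> h1 h2; split => //; rewrite h2; field.
Qed.

Lemma integ_powR r c : - 1 < r -> 0 <= c ->
  integ 0 c (fun s => s `^ r) = c `^ (r + 1) / (r + 1).
Proof.
move=> r1 c0; have r0 : r + 1 != 0 by rewrite gt_eqF//; lra.
have [] := @FTC2_integ (fun s => s `^ r) (fun s => (r + 1)^-1 * s `^ (r + 1)) 0 c c0.
- by move=> x _; exact: powR_ge0.
- apply: within_continuousZ; apply: (@continuous_within_eq (fun s => `|s| `^ (r + 1))).
    by move=> s; rewrite /= in_itv/= => /andP[s0 _]; rewrite ger0_norm.
  by apply: continuous_subspaceT; apply: continuous_norm_powR; lra.
- move=> x /andP[x0 _].
  have := is_derive1_powR (r + 1) x0 => d.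
  by apply: is_derive_eq; rewrite /GRing.scale/= addrK mulrA mulVf// mul1r ?scaler0 ?addr0.
- move=> x; rewrite in_itv/= => /andP[x0 _].
  apply/differentiable_continuous/derivable1_diffP/derivable_powR.
  by rewrite in_itv/= x0.
move=> _ ->; rewrite powR0//; ring.
Qed.

(** Writing the affine factor in powers of k - s splits the product into two pure powers.
    Integrability of the affine weights of the scheme and their behaviour under rescaling both come
    from this closed form. *)
Lemma integ_lin_powR r k a b A B : - 1 < r -> a <= b -> b <= k ->
  itg a b (fun s => (A + B * (k - s)) * (k - s) `^ r) /\
  integ a b (fun s => (A + B * (k - s)) * (k - s) `^ r) =
    A * (((k - a) `^ (r + 1) - (k - b) `^ (r + 1)) / (r + 1)) +
    B * (((k - a) `^ (r + 2) - (k - b) `^ (r + 2)) / (r + 2)).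
Proof.
move=> r1 ab bk.
have [i1 e1] := integ_powR_refl r1 ab bk.
have r2 : - 1 < r + 1 by lra.
have [i2] := integ_powR_refl r2 ab bk.
have -> : r + 1 + 1 = r + 2 by ring.
move=> e2.
have e s : a <= s <= b -> A * (k - s) `^ r + B * (k - s) `^ (r + 1) =
    (A + B * (k - s)) * (k - s) `^ r.
  move=> /andP[_ sb].
  have := @mulr_powRB1 R (k - s) (r + 1); rewrite addrK => <-; [ring|lra|lra].
split; first by apply: (eq_integrable_itv e); apply: itgD; exact: itgZ.
by rewrite -(eq_integ e) integD ?integZ ?e1 ?e2//; exact: itgZ.
Qed.

Lemma itgM_continuous f g a b : {within `[a, b], continuous f} -> itg a b g ->
  itg a b (fun s => f s * g s).
Proof.
move=> cf gi.
apply: (@integrableMr _ _ R mu `[a, b] (measurable_itv _) f (EFin \o g)) => //.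
  by apply: subspace_continuous_measurable_fun => //; exact: measurable_itv.
have /compact_bounded[M [_ hM]] :=
  continuous_compact cf (@segment_compact R a b).
exists M; split; rewrite ?num_real// => x Mx s sab; apply: hM Mx _ _.
by exists s.
Qed.

End CompactIntegrals.

(** * Positivity and functional equation of Gamma for arguments in (0, 1) *)

Section GammaFunction.
Variable R : realType.
Variable z : R.
Hypothesis z01 : 0 < z < 1.
Notation mu := (@lebesgue_measure R).
Let f1 (x : R) := x `^ z * expR (- x).
Let f0 (x : R) := x `^ (z - 1) * expR (- x).

Let derive_powR_expR (p x : R) : 0 < x ->
  is_derive x 1 (fun x : R => x `^ p * expR (- x))
    (p * (x `^ (p - 1) * expR (- x)) - x `^ p * expR (- x)).
Proof.
move=> x0.
have h1 := is_derive1_powR p x0.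
have h2 : is_derive x 1 (fun y : R => expR (- y)) (expR (- x) * - 1).
  have i : is_derive x 1 (fun y : R => - y) (- 1) by apply: is_derive_eq.
  exact: (@is_derive1_comp R expR (fun y : R => - y) x _ _ (is_derive_expR (- x)) i).
apply: is_derive_eq; rewrite /GRing.scale/=; ring.
Qed.

Let cont_powR_expR p x : 0 < x ->
  {for x, continuous (fun x : R => x `^ p * expR (- x))}.
Proof.
move=> x0; apply/differentiable_continuous/derivable1_diffP.
by have [] := derive_powR_expR p x0.
Qed.

Let within_powR_expR p a b : 0 < a ->
  {within `[a, b], continuous (fun x : R => x `^ p * expR (- x))}.
Proof.
move=> a0; apply: continuous_in_subspaceT => x; rewrite inE/= in_itv/= => /andP[ax _].
by apply: cont_powR_expR; rewrite (lt_le_trans a0).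
Qed.

Let a_ n : R := n.+2%:R^-1.
Let b_ n : R := n.+2%:R.

Let a0 n : 0 < a_ n. Proof. by rewrite invr_gt0. Qed.

Let a1 n : a_ n < 1. Proof. by rewrite invf_lt1// ltr1n. Qed.

Let b1 n : 1 < b_ n. Proof. by rewrite ltr1n. Qed.

Let ab n : a_ n < b_ n. Proof. exact: lt_trans (a1 n) (b1 n). Qed.

Let aS n : a_ n.+1 <= a_ n. Proof. by rewrite lef_pV2 ?posrE// ler_nat. Qed.

Let bS n : b_ n <= b_ n.+1. Proof. by rewrite ler_nat. Qed.

Let gamma_itv (f : R -> R) (J : nat -> R) l : (forall x, 0 < x -> 0 <= f x) ->
  (forall x, 0 < x -> {for x, continuous f}) ->
  (forall n, J n = integ (a_ n) (b_ n) f) ->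
  J n @[n --> \oo] --> l -> \int[mu]_(x in `]0, +oo[) f x = l.
Proof.
move=> fge0 cf JE Jl; rewrite /Rintegral.
rewrite (@integral_itv_exhaustion R f (fun n => `[a_ n, b_ n]%classic)
  `]0, +oo[%classic l _ _ _ _ _ J)//.
- apply/nondecreasing_seqP => n; apply/subsetPset; apply: subset_itv; rewrite bnd_simp//.
- apply/seteqP; split => x.
    by move=> [n _ /=]; rewrite !in_itv/= andbT => /andP[h _]; apply: lt_le_trans h.
  rewrite /= in_itv/= andbT => x0.
  pose N := (Num.truncn x + Num.truncn x^-1)%N.
  exists N => //=; rewrite in_itv/= /a_ /b_; apply/andP; split.
    rewrite invf_ple ?posrE// ltW// (lt_le_trans (truncnS_gt x^-1))// ler_nat.
    by rewrite ltnS leqW// /N leq_addl.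
  by rewrite ltW// (lt_le_trans (truncnS_gt x))// ler_nat ltnS leqW// /N leq_addr.
- by move=> x; rewrite /= in_itv/= andbT; exact: fge0.
- apply: open_continuous_measurable_fun; first exact: interval_open.
  by move=> x; rewrite inE/= in_itv/= andbT; exact: cf.
- move=> n; rewrite JE -integ_EFin//; apply: continuous_itg.
  apply: continuous_in_subspaceT => x; rewrite inE/= in_itv/= => /andP[ax _].
  by apply: cf; apply: lt_le_trans ax.
Qed.

Let J n := integ (a_ n) (b_ n) f1.

Let f1_ge0 x : 0 <= f1 x. Proof. by rewrite mulr_ge0// ?powR_ge0 ?expR_ge0. Qed.

(** From x^z <= 1 + x and 1 + x/2 <= exp(x/2). The majorant has an explicit antiderivative. *)
Let f1_le x : 0 < x -> f1 x <= 2 * expR (- (x / 2)).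
Proof.
move=> x0; have /andP[z0 z1] := z01.
have h : x `^ z <= 1 + x.
  have [x1|x1] := leP x 1.
    have : x `^ z <= 1 `^ z by apply: ge0_ler_powR; rewrite ?nnegrE//; lra.
    by rewrite powR1 => h; lra.
  by have := ler1_powR (ltW x1) (ltW z1); lra.
have h2 := expR_ge1Dx (x / 2).
have -> : - (x / 2) = x / 2 - x by field.
rewrite expRD /f1 mulrA ler_wpM2r ?expR_ge0//; lra.
Qed.

Let f1i p (a b : R) : 0 < a -> mu.-integrable `[a, b] (EFin \o (fun x : R => x `^ p * expR (- x))).
Proof. by move=> a0'; apply: continuous_itg; apply: within_powR_expR. Qed.

(** The sequence is nondecreasing and bounded by 4, the integral of the majorant over the half-line;
    its limit is positive because [J 0] is. *)
Let J_cvg : exists2 l : R, 0 < l & J n @[n --> \oo] --> l.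
Proof.
have ndJ : nondecreasing_seq J.
  apply/nondecreasing_seqP => n; rewrite /J.
  rewrite (integ_split (aS n) _ (f1i z (b_ n.+1) (a0 _))); last exact: le_trans (ltW (ab n)) (bS n).
  rewrite (integ_split (ltW (ab n)) (bS n) (f1i z (b_ n.+1) (a0 _))).
  by rewrite addrCA lerDl addr_ge0//; apply: Rintegral_ge0 => x _; exact: f1_ge0.
have h1 (x : R) : is_derive x 1 (fun x : R => - 4 * expR (- (x / 2))) (2 * expR (- (x / 2))).
  have i : is_derive x 1 (fun y : R => - (y / 2)) (- 2^-1).
    have -> : (fun y : R => - (y / 2)) = (- 2^-1) \*: (id : R -> R).
      by apply/funext => y; change (- (y / 2) = - 2^-1 * y); ring.
    by apply: is_derive_eq; rewrite /GRing.scale/= mulr1.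
  have h2 := @is_derive1_comp R expR (fun y : R => - (y / 2)) x _ _ (is_derive_expR (- (x / 2))) i.
  have h3 := is_deriveZ (- 4) h2.
  apply: (is_derive_eq h3); rewrite /GRing.scale/=; set E := expR _; lra.
have c2 : forall x : R, {for x, continuous (fun y : R => 2 * expR (- (y / 2)))}.
  move=> x.
  have [+ _] := is_deriveZ (- (1 / 2)) (h1 x).
  rewrite (_ : - (1 / 2) \*: _ = (fun x : R => 2 * expR (- (x / 2)))); last first.
    by apply/funext => y; change (- (1 / 2) * (- 4 * expR (- (y / 2))) = 2 * expR (- (y / 2))); set E := expR _; lra.
  by move=> /derivable1_diffP/differentiable_continuous.
have Jub n : J n <= 4.
  have ig : mu.-integrable `[a_ n, b_ n] (EFin \o (fun x : R => 2 * expR (- (x / 2)))).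
    by apply: continuous_itg; apply: continuous_in_subspaceT => x _; exact: c2.
  have : J n <= integ (a_ n) (b_ n) (fun x : R => 2 * expR (- (x / 2))).
    apply: le_integ => //; first exact: f1i.
    by move=> x /andP[ax _]; apply: f1_le; exact: lt_le_trans ax.
  move=> /le_trans; apply.
  have bb : b_ n < b_ n + 1 by lra.
  have := @FTC2_compact R _ (fun x : R => - 4 * expR (- (x / 2))) 0 (b_ n + 1) _ _ (a0 n) (ab n) bb
    (fun x _ => h1 x) (fun x _ => c2 x).
  rewrite (integ_EFin ig) => -[->].
  have := expR_ge0 (- (b_ n / 2)); have : expR (- (a_ n / 2)) <= 1.
    by rewrite -[X in _ <= X]expR0 ler_expR; have := a0 n; lra.
  by lra.
have cJ : J n @[n --> \oo] --> sup (range J).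
  by apply: nondecreasing_cvgn => //; exists 4 => _ [n _ <-].
exists (sup (range J)) => //.
have J0 : 0 < J 0%N.
  have lb : (a_ 0) `^ z * expR (- b_ 0) * (b_ 0 - a_ 0) <= J 0%N.
    rewrite -(integ_cst _ (ltW (ab 0))); apply: le_integ.
    - by apply: continuous_itg; apply: continuous_subspaceT => x; exact: cvg_cst.
    - exact: f1i.
    - move=> x /andP[ax xb]; have x0 : 0 < x by apply: lt_le_trans ax.
      rewrite /f1 ler_pM ?powR_ge0 ?expR_ge0//.
        by apply: ge0_ler_powR => //; rewrite ?nnegrE; have /andP[] := z01; have := a0 0; lra.
      by rewrite ler_expR lerN2.
  by apply: lt_le_trans lb; rewrite mulr_gt0 ?subr_gt0// mulr_gt0 ?powR_gt0 ?expR_gt0.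
apply: (lt_le_trans J0).
by apply: ub_le_sup; [exists 4 => _ [n _ <-]|exists 0%N].
Qed.

Let F_cvg : f1 (b_ n) - f1 (a_ n) @[n --> \oo] --> (0 : R).
Proof.
have /andP[z0 z1] := z01.
have ha : n.+1%:R^-1 @[n --> \oo] --> (0 : R) by exact: cvg_harmonic.
rewrite -[X in _ --> X](subr0 0); apply: cvgB.
  have hb : 4 * n.+1%:R^-1 @[n --> \oo] --> (0 : R).
    by rewrite -[X in _ --> X](mulr0 4); apply: cvgMr.
  apply: (squeeze_cvgr _ (cvg_cst 0) hb); apply: nearW => n.
  rewrite f1_ge0/= (le_trans (f1_le _))// expRN.
  have -> : 4 * n.+1%:R^-1 = 2 * (n.+1%:R / 2)^-1 :> R by rewrite invf_div mulrA; congr (_ / _); ring.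
  rewrite ler_pM2l// lef_pV2 ?posrE ?expR_gt0 ?divr_gt0//.
  apply: le_trans (expR_ge1Dx _); rewrite /b_ -(natr1 n.+1); lra.
have h : (a_ n) `^ z @[n --> \oo] --> (0 : R).
  have := powR_cvg0 z0 => /cvg_at_rightP; apply; split => //.
  have -> : a_ = (fun n => (n + 1).+1%:R^-1 : R).
    by apply/funext => n; rewrite addn1.
  by rewrite (cvg_shiftn 1 (fun n => n.+1%:R^-1 : R)).
apply: (squeeze_cvgr _ (cvg_cst 0) h); apply: nearW => n.
rewrite f1_ge0/= /f1 ler_piMr ?powR_ge0//.
by rewrite -[X in _ <= X]expR0 ler_expR; have := a0 n; lra.
Qed.

(** Integration by parts on [a_n, b_n] with vanishing boundary terms. It is used at z = 2 - alpha:
    the first scheme equation is normalised by Gamma(3 - alpha), the later ones and the Caputo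
    derivative by Gamma(2 - alpha). *)
Lemma Gamma_gt0_rec : 0 < Gamma z /\ Gamma (z + 1) = z * Gamma z.
Proof.
have /andP[z0 z1] := z01.
have [l l0 Jl] := J_cvg.
pose K n := integ (a_ n) (b_ n) f0.
have KE n : K n = z^-1 * (J n + (f1 (b_ n) - f1 (a_ n))).
  have i0 : mu.-integrable `[a_ n, b_ n] (EFin \o f0) by exact: f1i.
  have i1 : mu.-integrable `[a_ n, b_ n] (EFin \o f1) by exact: f1i.
  have i2 : mu.-integrable `[a_ n, b_ n] (EFin \o (fun x => z * f0 x - f1 x)).
    by apply: itgB => //; exact: itgZ.
  have bb : b_ n < b_ n + 1 by lra.
  have := @FTC2_compact R (fun x => z * f0 x - f1 x) f1 0 (b_ n + 1) _ _ (a0 n) (ab n) bb.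
  rewrite (integ_EFin i2) => h.
  have d1 x : 0 < x < b_ n + 1 -> is_derive x 1 f1 (z * f0 x - f1 x).
    by move=> /andP[x0 _]; exact: derive_powR_expR.
  have c1 : {in `]0, b_ n + 1[, continuous (fun x => z * f0 x - f1 x)}.
    move=> x; rewrite in_itv/= => /andP[x0 _].
    apply: cvgB; last exact: cont_powR_expR.
    by apply: cvgMr; exact: cont_powR_expR.
  have [] := h d1 c1.
  rewrite integB ?integZ//; last exact: itgZ.
  by move=> <-; rewrite /K /J; field; lra.
have Kl : K n @[n --> \oo] --> z^-1 * l.
  rewrite (_ : K = fun n => z^-1 * (J n + (f1 (b_ n) - f1 (a_ n)))); last exact/funext.
  by apply: cvgMr; rewrite -[X in _ --> X]addr0; exact: cvgD.
have G1 : Gamma (z + 1) = l.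
  rewrite /Gamma addrK; apply: (@gamma_itv f1 J) Jl => // x x0.
  by rewrite /prop_for /continuous_at; exact: cont_powR_expR.
have G0 : Gamma z = z^-1 * l.
  apply: (@gamma_itv f0 K) Kl => // x x0.
    by rewrite mulr_ge0// ?powR_ge0 ?expR_ge0.
  by rewrite /prop_for /continuous_at; exact: cont_powR_expR.
rewrite G1 G0; split; first by rewrite mulr_gt0 ?invr_gt0.
by rewrite mulrA divff ?mul1r// gt_eqF.
Qed.

End GammaFunction.

(** * Sign, monotonicity and size of the convolution weights *)

Section PowerKernel.
Variable R : realType.
Variable r : R.
Hypothesis r01 : - 1 < r < 0.
Implicit Types (x y k s : R).

Lemma powR_neg_nincr x y : 0 < x -> x <= y -> y `^ r <= x `^ r.
Proof.
move=> x0 xy; have y0 := lt_le_trans x0 xy; have /andP[_ r0] := r01.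
rewrite -(opprK r) (powRN y (- r)) (powRN x (- r)) lef_pV2 ?posrE ?powR_gt0//.
by apply: ge0_ler_powR; rewrite ?nnegrE; lra.
Qed.

(* The difference factors as y^r (1 - (y / (y+1))^(-r)), a product of two
   nonnegative nonincreasing functions. *)
Lemma powR_diff_nincr x y : 0 < x -> x <= y ->
  y `^ r - (y + 1) `^ r <= x `^ r - (x + 1) `^ r.
Proof.
move=> x0 xy; have y0 := lt_le_trans x0 xy; have /andP[_ r0] := r01.
have e t : 0 < t -> t `^ r - (t + 1) `^ r = t `^ r * (1 - (t / (t + 1)) `^ (- r)).
  move=> t0; rewrite mulrBr mulr1; congr (_ - _).
  rewrite powRM ?invr_ge0; try lra.
  rewrite powRN mulrA divff ?mul1r ?gt_eqF ?powR_gt0//.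
  rewrite -powR_inv1; last by lra.
  by rewrite -powRrM mulrN mulN1r opprK.
have q0 (t : R) : 0 < t -> 0 <= t / (t + 1) by move=> t0; rewrite divr_ge0; lra.
have q1 (t : R) : 0 < t -> t / (t + 1) <= 1 by move=> t0; rewrite ler_pdivrMr; lra.
have qm : x / (x + 1) <= y / (y + 1).
  rewrite ler_pdivrMr; last by lra.
  by rewrite mulrAC ler_pdivlMr; lra.
have r0' : 0 <= - r by lra.
rewrite !e//; apply: ler_pM; rewrite ?powR_ge0 ?powR_neg_nincr//.
  have e1 : 1 `^ (- r) = 1 :> R by rewrite powR1.
  by rewrite subr_ge0 -[X in _ <= X]e1; apply: ge0_ler_powR; rewrite ?nnegrE ?q0 ?q1.
by rewrite lerD2l lerN2; apply: ge0_ler_powR; rewrite ?nnegrE ?q0.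
Qed.

(** The exponent 0 case of [integ_lin_powR]. It evaluates the affine minorants and majorants with
    which the kernel integrals are compared. *)
Lemma integ_lin a b A B : a <= b ->
  (@lebesgue_measure R).-integrable `[a, b] (EFin \o (fun s => A + B * s)) /\
  integ a b (fun s => A + B * s) = A * (b - a) + B * ((b ^+ 2 - a ^+ 2) / 2).
Proof.
move=> ab; have r1 : - 1 < 0 :> R by lra.
have [i e] := @integ_lin_powR R 0 b a b (A + B * b) (- B) r1 ab (lexx b).
have h s : a <= s <= b -> (A + B * b + - B * (b - s)) * (b - s) `^ 0 = A + B * s.
  by move=> _; rewrite powRr0 mulr1; ring.
split; first exact: (eq_integrable_itv h).
rewrite -(eq_integ h) e !add0r subrr !powRr1 ?subr_ge0//.
have e2 : (b - a) `^ 2 = (b - a) ^+ 2 by rewrite powR_mulrn// subr_ge0.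
rewrite e2 powR0; [by field|by rewrite gt_eqF].
Qed.

(* Here r = 1 - alpha, so tail_len = sigma + 1/2 is the length of the last
   subinterval in units of tau. *)
Definition tail_len : R := 1 + r / 2.
(** Lagrange basis functions integrated against the kernel. On a unit cell with nodes at s = 1/2 and
    s = 3/2 the basis is 3/2 - s and s - 1/2 ([kerB], [kerA]). On the initial half cell with nodes
    1/3 and 1 it is 1 - s and s - 1/3, both times 3/2, a factor kept outside [ker0] and [kerA1]. *)
Definition kerA k : R := integ 0 1 (fun s => (s - 1 / 2) * (k - s) `^ r).
Definition kerB k : R := integ 0 1 (fun s => (3 / 2 - s) * (k - s) `^ r).
Definition kerA1 k : R := integ 0 (1 / 2) (fun s => (s - 1 / 3) * (k - s) `^ r).
Definition ker0 k : R := integ 0 (1 / 2) (fun s => (1 - s) * (k - s) `^ r).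
(* ker m is c_m^{(k)} / tau^(2-alpha) for m < k - 1, which does not depend on k. *)
Definition ker (m : nat) : R :=
  if m == 0%N then kerA (tail_len + 1) + tail_len `^ (r + 1) / (r + 1)
  else kerA (tail_len + 1 + m%:R) + kerB (tail_len + m%:R).

Let cut_bnd : 1 / 2 < tail_len < 1.
Proof. by rewrite /tail_len; have := r01; lra. Qed.

Let itg_lin k a b A B f : a <= b -> b <= k ->
  (forall s, f s = (A + B * (k - s)) * (k - s) `^ r) ->
  (@lebesgue_measure R).-integrable `[a, b] (EFin \o f).
Proof.
move=> ab bk e; have r1 : - 1 < r by have := r01; lra.
have [i _] := integ_lin_powR A B r1 ab bk.
by apply: eq_integrable_itv i => s _; rewrite e.
Qed.

Lemma itg_kerA k : 1 <= k -> (@lebesgue_measure R).-integrable `[0, 1]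
  (EFin \o (fun s => (s - 1 / 2) * (k - s) `^ r)).
Proof.
by move=> k1; apply: (@itg_lin k 0 1 (k - 1 / 2) (- 1)) => // s; congr (_ * _); ring.
Qed.

Lemma itg_kerB k : 1 <= k -> (@lebesgue_measure R).-integrable `[0, 1]
  (EFin \o (fun s => (3 / 2 - s) * (k - s) `^ r)).
Proof.
by move=> k1; apply: (@itg_lin k 0 1 (3 / 2 - k) 1) => // s; congr (_ * _); ring.
Qed.

Lemma itg_kerA1 k : 1 / 2 <= k -> (@lebesgue_measure R).-integrable `[0, 1 / 2]
  (EFin \o (fun s => (s - 1 / 3) * (k - s) `^ r)).
Proof.
move=> k1; apply: (@itg_lin k 0 (1 / 2) (k - 1 / 3) (- 1)) => //.
by move=> s; congr (_ * _); ring.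
Qed.

Lemma itg_ker0 k : 1 / 2 <= k -> (@lebesgue_measure R).-integrable `[0, 1 / 2]
  (EFin \o (fun s => (1 - s) * (k - s) `^ r)).
Proof.
move=> k1; apply: (@itg_lin k 0 (1 / 2) (1 - k) 1) => //.
by move=> s; congr (_ * _); ring.
Qed.

Let le_integ_lin f a b A B : a <= b ->
  (@lebesgue_measure R).-integrable `[a, b] (EFin \o f) ->
  (forall s, a <= s <= b -> A + B * s <= f s) ->
  A * (b - a) + B * ((b ^+ 2 - a ^+ 2) / 2) <= integ a b f.
Proof.
by move=> ab fi h; have [i <-] := integ_lin A B ab; exact: le_integ.
Qed.

Let ge_integ_lin f a b A B : a <= b ->
  (@lebesgue_measure R).-integrable `[a, b] (EFin \o f) ->
  (forall s, a <= s <= b -> f s <= A + B * s) ->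
  integ a b f <= A * (b - a) + B * ((b ^+ 2 - a ^+ 2) / 2).
Proof.
by move=> ab fi h; have [i <-] := integ_lin A B ab; exact: le_integ.
Qed.

(* (s - d)(g s - g d) >= 0 when g is nondecreasing *)
Let chebyshev (d s u v : R) : (s <= d -> u <= v) -> (d <= s -> v <= u) ->
  (s - d) * v <= (s - d) * u.
Proof.
move=> h1 h2; have [sd|ds] := leP s d.
  by rewrite ler_wnM2l ?h1//; lra.
by rewrite ler_wpM2l ?h2//; lra.
Qed.

(** The factor s - 1/2 has mean 0 on [0, 1] and the kernel increases in s, so freezing the kernel at
    the midpoint can only lower the integral, and lowers it to 0. *)
Lemma kerA_ge0 k : 1 < k -> 0 <= kerA k.
Proof.
move=> k1; pose v := (k - 1 / 2) `^ r.
have := @le_integ_lin _ 0 1 (- (1 / 2) * v) v ler01 (itg_kerA (ltW k1)).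
rewrite (_ : - (1 / 2) * v * _ + _ = 0); last by field.
apply => s /andP[s0 s1].
rewrite (_ : - (1 / 2) * v + _ = (s - 1 / 2) * v); last by ring.
by apply: chebyshev => h; apply: powR_neg_nincr; lra.
Qed.

(** The midpoint argument again, now for (k - s)^r - (k + 1 - s)^r, which increases in s by
    [powR_diff_nincr]. *)
Lemma kerA_nincr k : 1 < k -> kerA (k + 1) <= kerA k.
Proof.
move=> k1; rewrite -subr_ge0.
have i1 := itg_kerA (ltW k1).
have i2 : (@lebesgue_measure R).-integrable `[0, 1]
  (EFin \o (fun s => (s - 1 / 2) * (k + 1 - s) `^ r)) by apply: itg_kerA; lra.
rewrite -integB//; pose v := (k - 1 / 2) `^ r - (k - 1 / 2 + 1) `^ r.
have := @le_integ_lin _ 0 1 (- (1 / 2) * v) v ler01 (itgB i1 i2).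
rewrite (_ : - (1 / 2) * v * _ + _ = 0); last by field.
apply => s /andP[s0 s1].
rewrite (_ : - (1 / 2) * v + _ = (s - 1 / 2) * v); last by ring.
rewrite -mulrBr (_ : k + 1 - s = k - s + 1); last by ring.
by apply: chebyshev => h; apply: powR_diff_nincr; lra.
Qed.

Lemma kerB_nincr k : 1 < k -> kerB (k + 1) <= kerB k.
Proof.
move=> k1; apply: le_integ; try by apply: itg_kerB; lra.
move=> s /andP[s0 s1]; rewrite ler_wpM2l; try lra.
by apply: powR_neg_nincr; lra.
Qed.

Lemma kerA_norm_le k d : 0 < d -> d + 1 <= k -> `|kerA k| <= d `^ r.
Proof.
move=> d0 dk; have [i e] := integ_lin (d `^ r) 0 ler01.
rewrite (_ : d `^ r = integ 0 1 (fun s => d `^ r + 0 * s)); last by rewrite e; field.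
apply: integ_norm_le => //; first by apply: itg_kerA; lra.
move=> s /andP[s0 s1]; rewrite mul0r addr0 normrM (ger0_norm (powR_ge0 _ _)).
have := @powR_neg_nincr d (k - s) d0; have := powR_ge0 (k - s) r.
have : `|s - 1 / 2| <= 1 by rewrite ler_norml; lra.
move=> h1 h2 h3; have {}h3 : (k - s) `^ r <= d `^ r by apply: h3; lra.
by apply: le_trans h3; rewrite ler_piMl.
Qed.

Lemma kerA1_norm_le k d : 0 < d -> d + 1 / 2 <= k -> `|kerA1 k| <= d `^ r.
Proof.
move=> d0 dk; have h : 0 <= 1 / 2 :> R by lra.
have [i e] := integ_lin (2 * d `^ r) 0 h.
rewrite (_ : d `^ r = integ 0 (1 / 2) (fun s => 2 * d `^ r + 0 * s)); last by rewrite e; field.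
apply: integ_norm_le => //; first by apply: itg_kerA1; lra.
move=> s /andP[s0 s1]; rewrite mul0r addr0 normrM (ger0_norm (powR_ge0 _ _)).
have h0 := powR_ge0 (k - s) r.
have h1 : `|s - 1 / 3| <= 2 by rewrite ler_norml; lra.
have h3 : (k - s) `^ r <= d `^ r by apply: powR_neg_nincr; lra.
by apply: ler_pM.
Qed.

Lemma ker0_norm_le k d : 0 < d -> d + 1 / 2 <= k -> `|ker0 k| <= d `^ r.
Proof.
move=> d0 dk; have h : 0 <= 1 / 2 :> R by lra.
have [i e] := integ_lin (2 * d `^ r) 0 h.
rewrite (_ : d `^ r = integ 0 (1 / 2) (fun s => 2 * d `^ r + 0 * s)); last by rewrite e; field.
apply: integ_norm_le => //; first by apply: itg_ker0; lra.
move=> s /andP[s0 s1]; rewrite mul0r addr0 normrM (ger0_norm (powR_ge0 _ _)).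
have h0 := powR_ge0 (k - s) r.
have h1 : `|1 - s| <= 2 by rewrite ler_norml; lra.
have h3 : (k - s) `^ r <= d `^ r by apply: powR_neg_nincr; lra.
by apply: ler_pM.
Qed.

(** Freezing the kernel at s = 1/3 lowers the integral, and s - 1/3 integrates to -1/24 over
    [0, 1/2]; times 3/2 this is -1/16. The first-cell weight may be negative, but it then costs at
    most a sixteenth of [tail_len]^r, which the last cell can pay. *)
Lemma kerA1_ge k : 1 / 2 + tail_len <= k -> - (1 / 16) * tail_len `^ r <= 3 / 2 * kerA1 k.
Proof.
move=> kc; pose v := (k - 1 / 3) `^ r.
have v0 : 0 <= v by exact: powR_ge0.
have vc : v <= tail_len `^ r by apply: powR_neg_nincr; have := cut_bnd; lra.
have h : 0 <= 1 / 2 :> R by lra.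
have i : (@lebesgue_measure R).-integrable `[0, 1 / 2]
  (EFin \o (fun s => (s - 1 / 3) * (k - s) `^ r)).
  by apply: itg_kerA1; have := cut_bnd; lra.
have := @le_integ_lin _ 0 (1 / 2) (- (1 / 3) * v) v h i.
rewrite (_ : - (1 / 3) * v * _ + _ = - (1 / 24) * v); last by field.
suff h2 : forall s, 0 <= s <= 1 / 2 ->
    - (1 / 3) * v + v * s <= (s - 1 / 3) * (k - s) `^ r.
  by move=> /(_ h2); rewrite -/(kerA1 k); lra.
move=> s /andP[s0 s1].
rewrite (_ : - (1 / 3) * v + _ = (s - 1 / 3) * v); last by ring.
by apply: chebyshev => hs; apply: powR_neg_nincr; have := cut_bnd; lra.
Qed.

(** The factor 3/2 - s is nonnegative with mean 1 on [0, 1]. *)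
Lemma kerB_le k d : 0 < d -> d + 1 <= k -> kerB k <= d `^ r.
Proof.
move=> d0 dk; pose v := d `^ r.
have := @ge_integ_lin _ 0 1 (3 / 2 * v) (- v) ler01 (@itg_kerB k _).
rewrite (_ : 3 / 2 * v * _ + _ = v); last by field.
apply; first by lra.
move=> s /andP[s0 s1]; rewrite (_ : 3 / 2 * v + _ = (3 / 2 - s) * v); last by ring.
by rewrite ler_wpM2l ?powR_neg_nincr//; lra.
Qed.

Let last_mass : tail_len `^ (r + 1) / (r + 1) = tail_len `^ r * (tail_len / (r + 1)).
Proof.
rewrite powRD; first by rewrite powRr1 ?mulrA//; have := cut_bnd; lra.
by rewrite (_ : (tail_len != 0) = true) ?implybT// gt_eqF//; have := cut_bnd; lra.
Qed.

(** The ratio of the two sides is [tail_len] / (r + 1) = (1 + r/2) / (1 + r), at least 1 because r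
    is negative. *)
Lemma last_mass_ge : tail_len `^ r <= tail_len `^ (r + 1) / (r + 1).
Proof.
rewrite last_mass ler_peMr ?powR_ge0// ler_pdivlMr /tail_len; have := r01; lra.
Qed.

Lemma kerS m : ker m.+1 = kerA (tail_len + 1 + m.+1%:R) + kerB (tail_len + m.+1%:R).
Proof. by []. Qed.

Lemma kerS_nincr m : ker m.+2 <= ker m.+1.
Proof.
have m0 := ler0n R m; have := cut_bnd => cb.
rewrite !kerS -(natr1 m.+1) !addrA -(natr1 m); apply: lerD.
  by apply: kerA_nincr; lra.
by apply: kerB_nincr; lra.
Qed.

(** The factors s - 1/2 and 3/2 - s add up to 1. For s <= 1/2 the nonpositive one may be given the
    larger kernel value, for s > 1/2 the other one the smaller value; in both cases a single kernel
    value is left, at least (k + 1)^r with k + 1 <= m + 3. *)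
Lemma kerS_ge m : (m.+3%:R) `^ r <= ker m.+1.
Proof.
have m0 := ler0n R m; have := cut_bnd => cb.
pose k := tail_len + m.+1%:R; have k1 : 1 < k by rewrite /k -natr1; lra.
have i1 : (@lebesgue_measure R).-integrable `[0, 1]
  (EFin \o (fun s => (s - 1 / 2) * (k + 1 - s) `^ r)) by apply: itg_kerA; lra.
have i2 := itg_kerB (ltW k1).
rewrite kerS addrAC -/k.
have -> : kerA (k + 1) + kerB k = integ 0 1 (fun s => (s - 1 / 2) * (k + 1 - s) `^ r + (3 / 2 - s) * (k - s) `^ r).
  by rewrite integD.
have := @le_integ_lin _ 0 1 ((k + 1) `^ r) 0 ler01 (itgD i1 i2).
rewrite (_ : (k + 1) `^ r * _ + _ = (k + 1) `^ r); last by field.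
have h0 : m.+3%:R `^ r <= (k + 1) `^ r.
  by apply: powR_neg_nincr; rewrite /k -?natr1; lra.
move=> h; apply: (le_trans h0); apply: h => s /andP[s0 s1]; rewrite mul0r addr0.
have h1 : (k + 1) `^ r <= (k + 1 - s) `^ r by apply: powR_neg_nincr; lra.
have h2 : (k + 1 - s) `^ r <= (k - s) `^ r by apply: powR_neg_nincr; lra.
have [sd|ds] := leP s (1 / 2).
  have : (s - 1 / 2) * (k - s) `^ r <= (s - 1 / 2) * (k + 1 - s) `^ r.
    by rewrite ler_wnM2l//; lra.
  by lra.
have : (3 / 2 - s) * (k + 1 - s) `^ r <= (3 / 2 - s) * (k - s) `^ r.
  by rewrite ler_wpM2l//; lra.
by lra.
Qed.

Lemma ker0_ge : tail_len `^ r <= ker 0.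
Proof.
have := cut_bnd => cb.
by rewrite /ker eqxx; have := @kerA_ge0 (tail_len + 1); have := last_mass_ge; lra.
Qed.

Lemma ker_ge m : (m.+2%:R) `^ r <= ker m.
Proof.
case: m => [|m]; last exact: kerS_ge.
apply: le_trans ker0_ge; apply: powR_neg_nincr; have := cut_bnd; lra.
Qed.

Lemma ker_ge0 m : 0 <= ker m.
Proof. by apply: le_trans (ker_ge m); exact: powR_ge0. Qed.

(** The coercivity condition of the convolution inequality for theta = -r/2. The singular last cell
    makes [ker 0] large: the gap to [ker 1] is at least [tail_len]^r ([tail_len] / (r + 1) - 1),
    that is [tail_len]^r (-r/2) / (1 + r), whereas [ker 1] is at most twice [tail_len]^r. What
    remains is r^2 <= -r. *)
Lemma ker_gap : r ^+ 2 / 4 * ker 1 <= (1 + r) * (ker 0 - ker 1).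
Proof.
have := cut_bnd => cb; have /andP[r1 r0] := r01.
have c0 : 0 < tail_len by lra.
have c1 : 1 < tail_len + 1 by lra.
have c2 : tail_len + 1 <= tail_len + 1 + 1 by lra.
have hA := kerA_nincr c1.
have hB := kerB_le c0 (lexx (tail_len + 1)).
have hA2 := le_trans (ler_norm _) (kerA_norm_le c0 c2).
have e1 : ker 1 = kerA (tail_len + 1 + 1) + kerB (tail_len + 1) by rewrite kerS.
have e0 : ker 0 = kerA (tail_len + 1) + tail_len `^ r * (tail_len / (r + 1)).
  by rewrite -last_mass.
have g0 : 0 <= tail_len `^ r by exact: powR_ge0.
rewrite e1 e0; move: (kerA (tail_len + 1)) (kerA (tail_len + 1 + 1)) (kerB (tail_len + 1)) (tail_len `^ r)
  hA hB hA2 g0 {e0 e1} => A0 A1 B1 g hA hB hA2 g0.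
have h0 : - r / 2 * g <= (1 + r) * (A0 + g * (tail_len / (r + 1)) - (A1 + B1)).
  have -> : - r / 2 * g = (1 + r) * (g * (tail_len / (r + 1)) - g).
    by rewrite /tail_len; field; rewrite gt_eqF//; lra.
  by rewrite ler_pM2l; lra.
apply: le_trans h0.
have h2 : r ^+ 2 / 4 * (A1 + B1) <= r ^+ 2 / 4 * (2 * g).
  by rewrite ler_wpM2l ?divr_ge0 ?sqr_ge0//; lra.
apply: (le_trans h2).
have : 0 <= (1 + r) * (- r) * g by rewrite !mulr_ge0//; lra.
by rewrite expr2; lra.
Qed.

Lemma ker_nincr m : ker m.+1 <= ker m.
Proof.
case: m => [|m]; last exact: kerS_nincr.
have := ker_gap; have := ker_ge0 1; have /andP[r1 r0] := r01.
move: (ker 0) (ker 1) => p0 p1 h1 h2; have r2 : 0 < 1 + r by lra.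
rewrite -subr_ge0 -(pmulr_rge0 _ r2); apply: le_trans h2.
by rewrite mulr_ge0// divr_ge0// sqr_ge0.
Qed.

Lemma ker_le0 m : ker m <= ker 0.
Proof.
by elim: m => [|m IH]; [exact: lexx|exact: le_trans (ker_nincr m) IH].
Qed.

Lemma kerAE k : kerA k = integ 0 1 (fun s => (s - 1 / 2) * (k - s) `^ r).
Proof. by []. Qed.

Lemma kerBE k : kerB k = integ 0 1 (fun s => (3 / 2 - s) * (k - s) `^ r).
Proof. by []. Qed.

Lemma kerA1E k : kerA1 k = integ 0 (1 / 2) (fun s => (s - 1 / 3) * (k - s) `^ r).
Proof. by []. Qed.

Lemma ker0E k : ker0 k = integ 0 (1 / 2) (fun s => (1 - s) * (k - s) `^ r).
Proof. by []. Qed.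

Lemma ker_0 : ker 0 = kerA (tail_len + 1) + tail_len `^ (r + 1) / (r + 1).
Proof. by []. Qed.

End PowerKernel.
(* Keeps unification from unfolding these integrals. *)
#[global] Opaque kerA kerB kerA1 ker0 ker.


(** * A coercivity inequality for discrete convolutions *)

Section DiscreteConvolution.
Variable R : realType.
Variables (p : nat -> R) (theta : R).
Hypothesis p_ge0 : forall m, 0 <= p m.
Hypothesis p_nincr : forall m, p m.+1 <= p m.
Hypothesis p_gap : theta ^+ 2 * p 1 <= (1 - 2 * theta) * (p 0 - p 1).

(** Summation by parts leaves q_0 phi_0, the terms (q_i - q_{i-1}) phi_i and the end term -q_n
    phi_{n+1}. The nonnegative coefficients of phi_0, ..., phi_n add up to q_n, and each of these
    values is at least m. *)
Lemma abel_lower_bound (q phi : nat -> R) (m : R) n :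
  (forall i, (i <= n)%N -> 0 <= q i) ->
  (forall i, (i < n)%N -> q i <= q i.+1) -> (forall i, m <= phi i) ->
  q n * (m - phi n.+1) <= \sum_(i < n.+1) q i * (phi i - phi i.+1).
Proof.
move=> q0 qS mphi; elim: n q0 qS => [|n IH] q0 qS.
  by rewrite big_ord1 ler_wpM2l ?q0// lerD2r.
rewrite big_ord_recr/=.
have h1 : q n * (m - phi n.+1) <= \sum_(i < n.+1) q i * (phi i - phi i.+1).
  by apply: IH => i hi; [apply: q0; lia|apply: qS; lia].
have h2 : q n.+1 * (m - phi n.+1) <= q n * (m - phi n.+1).
  by rewrite ler_wnM2r ?qS// subr_le0.
by rewrite !mulrBr in h1 h2 *; lra.
Qed.

(* With z_i = v_{n+1} - v_i and phi(z) = z^2/2 - theta d z, the difference of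
   the two sides is the Abel sum of p (phi(z_i) - phi(z_{i+1})). *)
Lemma convolution_quadratic_ge (v : nat -> R) n :
  2^-1 * (\sum_(i < n.+1) p (n - i) * (v i.+1 ^+ 2 - v i ^+ 2)) <=
  (\sum_(i < n.+1) p (n - i) * (v i.+1 - v i)) *
    (v n.+1 - theta * (v n.+1 - v n)).
Proof.
pose d := v n.+1 - v n; pose z i := v n.+1 - v i.
pose phi i := 2^-1 * z i ^+ 2 - theta * d * z i.
rewrite -subr_ge0 mulr_suml mulr_sumr -sumrB.
rewrite (eq_bigr (fun i : 'I_n.+1 => p (n - i) * (phi i - phi i.+1))); last first.
  by move=> i _; rewrite /phi /z /d; field.
(* The minimum of the quadratic phi(z), attained at z = theta d. *)
pose m := - (2^-1 * (theta * d) ^+ 2).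
have mphi i : m <= phi i.
  rewrite -subr_ge0 /m /phi.
  have -> : 2^-1 * z i ^+ 2 - theta * d * z i - - (2^-1 * (theta * d) ^+ 2) = 2^-1 * (z i - theta * d) ^+ 2 by field.
  by rewrite mulr_ge0// sqr_ge0.
have phin : phi n = (2^-1 - theta) * d ^+ 2 by rewrite /phi /z -/d; ring.
have phiS : phi n.+1 = 0 by rewrite /phi /z subrr; ring.
rewrite big_ord_recr/= subnn phiS subr0.
(* This is [p_gap] multiplied by d^2/2: the last term p_0 phi_n compensates the possible loss p_1 (m
   - phi_n) of the preceding Abel sum. *)
have gap : 0 <= p 0 * phi n + p 1 * (m - phi n).
  have : 0 <= 2^-1 * ((1 - 2 * theta) * (p 0 - p 1) - theta ^+ 2 * p 1) * d ^+ 2.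
    by rewrite mulr_ge0 ?sqr_ge0// mulr_ge0// subr_ge0.
  by rewrite phin /m; congr (_ <= _); field.
case: n @d @z @phi @m mphi phin phiS gap => [|n] d z phi m mphi phin phiS gap.
  rewrite big_ord0 add0r; apply: le_trans gap _.
  by rewrite gerDl mulr_ge0_le0// subr_le0.
have : p 1 * (m - phi n.+1) <= \sum_(i < n.+1) p (n.+1 - i) * (phi i - phi i.+1).
  have := @abel_lower_bound (fun i => p (n.+1 - i)%N) phi m n.
  rewrite subSnn; apply => // i hi.
  by rewrite (_ : n.+1 - i = (n.+1 - i.+1).+1)%N//; lia.
by lra.
Qed.

End DiscreteConvolution.

(** * Taylor estimates for families of successive derivatives *)

Section Taylor.
Variable R : realType.
Implicit Types (a b x y h B : R) (F : nat -> R -> R).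

(** The derivatives are carried as data [F 0], [F 1], ..., linked only in the open interval as in
    [C44_derivs]; the endpoints are reached through continuity. *)
Definition smooth_on n a b F :=
  (forall j, (j <= n)%N -> {within `[a, b], continuous (F j)}) /\
  (forall j, (j < n)%N -> forall t, a < t < b -> is_derive t 1 (F j) (F j.+1 t)).

Let taylor_rem n F x y := F 0%N y - \sum_(j < n) F j x / j`!%:R * (y - x) ^+ j.

Let is_derive_taylor_rem n F x (t : R) : is_derive t 1 (F 0%N) (F 1%N t) ->
  is_derive t 1 (taylor_rem n.+1 F x) (taylor_rem n (fun j => F j.+1) x t).
Proof.
move=> d0.
have hj (j : 'I_n.+1) : is_derive t 1 (fun y => F j x / j`!%:R * (y - x) ^+ j)
    (F j x / j`!%:R * (j%:R * (t - x) ^+ j.-1)).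
  have hx : is_derive t 1 (fun y : R => y - x) 1.
    have -> : (fun y : R => y - x) = (id \- cst x) by [].
    by apply: is_derive_eq; rewrite subr0.
  case: j => -[|j] _ /=.
    rewrite mul0r mulr0; have -> : (fun y => F 0%N x / 0`!%:R * (y - x) ^+ 0) = cst (F 0%N x / 0`!%:R).
      by apply/funext => y; rewrite expr0 mulr1.
    exact: is_derive_cst.
  have h1 := is_deriveX j.+1 hx.
  have h2 := is_deriveZ (F j.+1 x / j.+1`!%:R) h1.
  rewrite exprfctE in h2.
  by apply: (is_derive_eq h2); rewrite /GRing.scale/= mulr1.
have h1 := is_derive_sum hj.
have h2 := is_deriveB d0 h1.
have e : taylor_rem n.+1 F x = (F 0%N \- \sum_(j < n.+1) (fun y => F j x / j`!%:R * (y - x) ^+ j)).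
  by apply/funext => y; rewrite /taylor_rem /= fct_sumE.
rewrite e; apply: (is_derive_eq h2); rewrite /taylor_rem; congr (_ - _).
rewrite big_ord_recl/= mul0r mulr0 add0r; apply: eq_bigr => j _.
rewrite /bump/= add1n factS natrM mulrA; congr (_ * _).
by rewrite invfM -mulrA; congr (_ * _); rewrite mulrAC mulVf ?mul1r ?pnatr_eq0.
Qed.

Let within_taylor_rem n F x a b : {within `[a, b], continuous (F 0%N)} ->
  {within `[a, b], continuous (taylor_rem n F x)}.
Proof.
move=> cF t; apply: cvgB; first exact: cF.
have c : continuous (fun y : R => \sum_(j < n) F j x / j`!%:R * (y - x) ^+ j).
  apply: continuous_big => [|j _ y]; first exact: add_continuous.
  apply: cvgMr.
  apply: (@continuous_comp _ _ _ (fun z : R => z - x) (fun z => z ^+ j)).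
    by apply: cvgB; [exact: cvg_id|exact: cvg_cst].
  exact: exprn_continuous.
exact: (continuous_subspaceT c).
Qed.

(** Induction through the mean value theorem: the remainder of order n + 1 vanishes at x, and its
    derivative is the remainder of order n of the shifted family. The factorial in the bound is
    given up, since only the order matters. *)
Lemma taylor_bound n F a b B x y : smooth_on n a b F ->
  (forall t, a <= t <= b -> `|F n t| <= B) -> a <= x <= b -> a <= y <= b ->
  `|F 0%N y - \sum_(j < n) F j x / j`!%:R * (y - x) ^+ j| <= B * `|y - x| ^+ n.
Proof.
elim: n F y => [|n IH] F y [cF dF] FB xab yab.
  by rewrite big_ord0 subr0 expr0 mulr1; exact: FB.
rewrite -/(taylor_rem n.+1 F x y).
have rx : taylor_rem n.+1 F x x = 0.
  rewrite /taylor_rem big_ord_recl/= big1 ?addr0; last first.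
    by move=> j _; rewrite subrr expr0n/= mulr0.
  by rewrite fact0 divr1 expr0 mulr1 subrr.
have IHt t : a <= t <= b ->
    `|taylor_rem n (fun j => F j.+1) x t| <= B * `|t - x| ^+ n.
  by move=> tab; apply: IH => //; split => j jn; [exact: cF|exact: dF].
have B0 : 0 <= B by apply: le_trans (FB _ xab).
have key u v : u <= v -> a <= u -> v <= b ->
  exists2 c, u <= c <= v & taylor_rem n.+1 F x v - taylor_rem n.+1 F x u =
    taylor_rem n (fun j => F j.+1) x c * (v - u).
  move=> uv au vb; have [] := @MVT_segment R (taylor_rem n.+1 F x)
    (taylor_rem n (fun j => F j.+1) x) u v uv.
  - move=> t; rewrite in_itv/= => /andP[ut tv]; apply: is_derive_taylor_rem.
    by apply: dF => //; rewrite (le_lt_trans au)//= (lt_le_trans tv).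
  - apply: (@continuous_subspaceW _ _ _ `[a, b]).
      by apply: subset_itv; rewrite bnd_simp.
    exact/within_taylor_rem/cF.
  by move=> c; rewrite in_itv/= => cuv e; exists c.
have fin c : a <= c <= b -> `|c - x| <= `|y - x| ->
    `|taylor_rem n (fun j => F j.+1) x c * (y - x)| <= B * `|y - x| ^+ n.+1.
  move=> cab cx; rewrite normrM exprSr mulrA ler_wpM2r//.
  by apply: le_trans (IHt c cab) _; rewrite ler_wpM2l// lerXn2r// nnegrE.
have [xy|/ltW yx] := leP x y.
  have [||c cxy e] := key x y xy; [lra|lra|].
  rewrite -[taylor_rem _ _ _ _]subr0 -rx e; apply: fin; first by lra.
  by rewrite !ger0_norm; lra.
have [||c cxy e] := key y x yx; [lra|lra|].
rewrite -normrN -[- _]sub0r -rx e -normrN -mulrN opprB; apply: fin; first by lra.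
by rewrite !ler0_norm; lra.
Qed.

Lemma second_difference_bound F a b B x h : smooth_on 4 a b F ->
  (forall t, a <= t <= b -> `|F 4%N t| <= B) -> 0 <= h -> a <= x - h -> x + h <= b ->
  `|F 0%N (x + h) - 2 * F 0%N x + F 0%N (x - h) - h ^+ 2 * F 2%N x| <= 2 * B * h ^+ 4.
Proof.
move=> sF FB h0 axh xhb.
have xab : a <= x <= b by lra.
have h1 : a <= x + h <= b by lra.
have h2 : a <= x - h <= b by lra.
have := taylor_bound sF FB xab h1; have := taylor_bound sF FB xab h2.
rewrite !big_ord_recr !big_ord0 /= !(addrC x) !addrK (normrN h) (ger0_norm h0).
rewrite (_ : 3`! = 6)%N// (_ : 2`! = 2)%N// (_ : 1`! = 1)%N// fact0.
set r1 := _ - _; set r2 := _ - _ => b1 b2.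
rewrite (_ : _ - _ = r1 + r2); last by rewrite /r1 /r2; field.
by apply: le_trans (ler_normD _ _) _; lra.
Qed.

Lemma linear_taylor_bound F a b B x y : smooth_on 2 a b F ->
  (forall t, a <= t <= b -> `|F 2%N t| <= B) -> a <= x <= b -> a <= y <= b ->
  `|F 0%N y - (F 0%N x + F 1%N x * (y - x))| <= B * (y - x) ^+ 2.
Proof.
move=> sF FB xab yab; have := taylor_bound sF FB xab yab.
rewrite !big_ord_recr !big_ord0/= real_normK ?num_real//.
by rewrite (_ : 1`! = 1)%N// fact0 add0r expr0 expr1 !divr1 mulr1.
Qed.

(** Carries an estimate to boundary times, where [C44_derivs] asserts continuity but no
    derivative. *)
Lemma closed_itv_norm_le (g : R -> R) a b C : a < b ->
  {within `[a, b], continuous g} -> (forall t, a < t < b -> `|g t| <= C) ->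
  forall t, a <= t <= b -> `|g t| <= C.
Proof.
move=> ab /(continuous_within_itvP _ ab)[_ ga gb] gC t /andP[].
rewrite le_eqVlt => /predU1P[<- _|at_]; last first.
  rewrite le_eqVlt => /predU1P[->|tb]; last by apply: gC; rewrite at_.
  apply/ler_addgt0Pl => e e0; move/cvgrPdist_lt : gb => /(_ _ e0) h.
  have [s [hs sab]] : exists s, `|g b - g s| < e /\ a < s < b.
    apply: (@filter_ex _ (b^'-)); near=> s; split; first by near: s.
    by apply/andP; split; near: s; [exact: nbhs_left_gt|exact: nbhs_left_lt].
  have := gC s sab; have := ler_distD (g s) (g b) 0; rewrite !subr0; lra.
apply/ler_addgt0Pl => e e0; move/cvgrPdist_lt : ga => /(_ _ e0) h.
have [s [hs sab]] : exists s, `|g a - g s| < e /\ a < s < b.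
  apply: (@filter_ex _ (a^'+)); near=> s; split; first by near: s.
  by apply/andP; split; near: s; [exact: nbhs_right_gt|exact: nbhs_right_lt].
have := gC s sab; have := ler_distD (g s) (g a) 0; rewrite !subr0; lra.
Unshelve. all: by end_near. Qed.

End Taylor.

(** * Regularity of the exact solution along grid lines *)

Section SmoothSolution.
Variable R : realType.
Variables (L T : R) (u : R -> R -> R) (D : nat -> nat -> R -> R -> R).
Hypotheses (L0 : 0 < L) (T0 : 0 < T) (DP : C44_derivs L T u D).

Lemma C44_within_t i j x : (i <= 4)%N -> (j <= 4)%N -> 0 <= x <= L ->
  {within `[0, T], continuous (D i j x)}.
Proof.
move=> i4 j4 xL; have [_ c _ _] := DP.
have /subspace_continuousP h := c i j i4 j4.
apply/subspace_continuousP => t /= tT A /(h (x, t)) /= hA.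
have := hA (conj xL tT); rewrite /within/= => -[[P Q] /= [Px Qt] PQ].
apply: filterS Qt => s Qs sT; apply: (PQ (x, s)) => /=; last by split.
by split => //; exact: nbhs_singleton.
Qed.

Lemma C44_within_x i j t : (i <= 4)%N -> (j <= 4)%N -> 0 <= t <= T ->
  {within `[0, L], continuous (fun x => D i j x t)}.
Proof.
move=> i4 j4 tT; have [_ c _ _] := DP.
have /subspace_continuousP h := c i j i4 j4.
apply/subspace_continuousP => x /= xL A /(h (x, t)) /= hA.
have := hA (conj xL tT); rewrite /within/= => -[[P Q] /= [Px Qt] PQ].
apply: filterS Px => s Ps sL; apply: (PQ (s, t)) => /=; last by split.
by split => //; exact: nbhs_singleton.
Qed.

Lemma C44_bounded i j : (i <= 4)%N -> (j <= 4)%N -> exists2 B, 0 < B &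
  forall x t, 0 <= x <= L -> 0 <= t <= T -> `|D i j x t| <= B.
Proof.
move=> i4 j4; have [_ c _ _] := DP.
have cpt : compact (`[0, L] `*` `[0, T] : set (R * R)).
  by apply: compact_setX; exact: segment_compact.
have /compact_bounded[M [_ hM]] := continuous_compact (c i j i4 j4) cpt.
exists (`|M| + 1); first by rewrite ltr_wpDl.
move=> x t xL tT; apply: (hM (`|M| + 1)).
  by rewrite (le_lt_trans (ler_norm M))// ltrDl.
by exists (x, t).
Qed.

Lemma C44_smooth_t i n x : (i <= 4)%N -> (n <= 4)%N -> 0 < x < L ->
  smooth_on n 0 T (fun j => D i j x).
Proof.
move=> i4 n4 xL; split.
  by move=> j jn; apply: C44_within_t => //; [exact: leq_trans n4|lra].
by move=> j jn t tT; have [_ _ _ d] := DP; apply: d => //; exact: leq_trans n4.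
Qed.

Lemma C44_smooth_shift n i m x : (i <= 4)%N -> (n + m <= 4)%N -> 0 < x < L ->
  smooth_on n 0 T (fun j => D i (m + j)%N x).
Proof.
move=> i4 n4 xL; split.
  by move=> j jn; apply: C44_within_t => //; [lia|lra].
by move=> j jn t tT; have [_ _ _ d] := DP; rewrite addnS; apply: d => //; lia.
Qed.

(** For 0 < t < T this is the Taylor estimate in x. The grid times t = 0 and t = T follow by
    continuity in t of the whole expression. *)
Lemma C44_second_difference_x B x t h :
  (forall x t, 0 <= x <= L -> 0 <= t <= T -> `|D 4 0 x t| <= B) ->
  0 <= h -> 0 <= x - h -> x + h <= L -> 0 <= t <= T ->
  `|u (x + h) t - 2 * u x t + u (x - h) t - h ^+ 2 * D 2 0 x t| <= 2 * B * h ^+ 4.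
Proof.
move=> DB h0 xh0 xhL; have [<- c d _] := DP.
apply: (@closed_itv_norm_le R (fun t => D 0 0 (x + h) t - 2 * D 0 0 x t + D 0 0 (x - h) t - h ^+ 2 * D 2 0 x t)) => //.
  have c1 : {within `[0, T], continuous (D 0 0 (x + h))} by apply: C44_within_t => //; lra.
  have c2 : {within `[0, T], continuous (D 0 0 x)} by apply: C44_within_t => //; lra.
  have c3 : {within `[0, T], continuous (D 0 0 (x - h))} by apply: C44_within_t => //; lra.
  have c4 : {within `[0, T], continuous (D 2 0 x)} by apply: C44_within_t => //; lra.
  move=> s; apply: cvgB.
    apply: cvgD; last exact: c3.
    by apply: cvgB; [exact: c1|apply: cvgMr; exact: c2].
  by apply: cvgMr; exact: c4.
move=> s sT.
apply: (@second_difference_bound R (fun i y => D i 0 y s) 0 L) => //.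
  split; last by move=> i i4 y yL; exact: d.
  by move=> i i4; apply: C44_within_x => //; lra.
by move=> y yL; apply: DB => //; lra.
Qed.

End SmoothSolution.

(** * Product integration against the Caputo kernel *)

Section Quadrature.
Variable R : realType.
Variable r : R.
Hypothesis r01 : - 1 < r < 0.
Implicit Types (a b k tau : R).
Notation cut := (tail_len r).
Notation itg a b f := ((@lebesgue_measure R).-integrable `[a, b] (EFin \o f)).

Let r1 : - 1 < r. Proof. by have /andP[] := r01. Qed.

Let rn1 : r + 1 != 0.
Proof. by rewrite gt_eqF//; have := r1; lra. Qed.

Let rn2 : r + 2 != 0.
Proof. by rewrite gt_eqF//; have := r1; lra. Qed.

Let dist_addD (x y x' y' e e' : R) : `|x - x'| <= e -> `|y - y'| <= e' ->
  `|x + y - (x' + y')| <= e + e'.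
Proof.
move=> h h'; rewrite (_ : x + y - (x' + y') = (x - x') + (y - y')); last by ring.
by apply: le_trans (ler_normD _ _) _; exact: lerD.
Qed.

(** Comparing closed forms replaces a change of variables. The two equations between the endpoints
    say that both cells lie in the same position relative to the singularities k and k'. *)
Lemma integ_scale a b k a' b' k' P Q tau : 0 < tau -> a <= b -> b <= k ->
  k' - a' = k - a -> k' - b' = k - b ->
  itg (tau * a) (tau * b) (fun s => (P + Q * (s / tau - a + a')) * (tau * k - s) `^ r) /\
  integ (tau * a) (tau * b) (fun s => (P + Q * (s / tau - a + a')) * (tau * k - s) `^ r)
  = tau `^ (r + 1) * integ a' b' (fun s => (P + Q * s) * (k' - s) `^ r).
Proof.
move=> tau0 ab bk ea eb; have tn : tau != 0 by rewrite gt_eqF.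
have tab : tau * a <= tau * b by rewrite ler_pM2l.
have tbk : tau * b <= tau * k by rewrite ler_pM2l.
have ab' : a' <= b' by lra.
have bk' : b' <= k' by lra.
have ka : 0 <= k - a by lra.
have kb : 0 <= k - b by lra.
have h s : tau * a <= s <= tau * b ->
    (P + Q * k' + - Q / tau * (tau * k - s)) * (tau * k - s) `^ r =
    (P + Q * (s / tau - a + a')) * (tau * k - s) `^ r.
  move=> _; congr (_ * _); rewrite (_ : k' = k - a + a'); last by lra.
  by field.
have h' s : a' <= s <= b' ->
    (P + Q * k' + - Q * (k' - s)) * (k' - s) `^ r = (P + Q * s) * (k' - s) `^ r.
  by move=> _; congr (_ * _); ring.
have [i e] := integ_lin_powR (P + Q * k') (- Q / tau) r1 tab tbk.
have [_ e'] := integ_lin_powR (P + Q * k') (- Q) r1 ab' bk'.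
split; first exact: (eq_integrable_itv h).
rewrite -(eq_integ h) e -(eq_integ h') e' ea eb -!mulrBr {i e e' h h'}.
rewrite !powRM ?(ltW tau0)//.
have -> : tau `^ (r + 2) = tau `^ (r + 1) * tau.
  rewrite (_ : r + 2 = (r + 1) + 1); last by ring.
  by rewrite powRD ?tn ?implybT// powRr1// ltW.
by field; rewrite ?tn ?rn1 ?rn2.
Qed.

Lemma quadrature_piece (w : R -> R) a b k a' b' k' P Q E tau :
  0 < tau -> a <= b -> b <= k -> k' - a' = k - a -> k' - b' = k - b ->
  {within `[tau * a, tau * b], continuous w} ->
  (forall s, tau * a <= s <= tau * b -> `|w s - (P + Q * (s / tau - a + a'))| <= E) ->
  `|integ (tau * a) (tau * b) (fun s => w s * (tau * k - s) `^ r) -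
    tau `^ (r + 1) * integ a' b' (fun s => (P + Q * s) * (k' - s) `^ r)|
  <= E * integ (tau * a) (tau * b) (fun s => (tau * k - s) `^ r).
Proof.
move=> tau0 ab bk ea eb cw wE.
have tab : tau * a <= tau * b by rewrite ler_pM2l.
have tbk : tau * b <= tau * k by rewrite ler_pM2l.
have [i <-] := integ_scale P Q tau0 ab bk ea eb.
have [ik _] := integ_powR_refl r1 tab tbk.
have iw := itgM_continuous cw ik.
rewrite -integB// -integZ//; apply: integ_norm_le.
- exact: itgB.
- exact: itgZ.
move=> s sab; rewrite -mulrBl normrM (ger0_norm (powR_ge0 _ _)).
by rewrite ler_wpM2r ?powR_ge0// wE.
Qed.

(** The point x is the centroid of [a, k] for the weight (k - s)^r, so the slope W' integrates to 0
    and a single value W is second-order accurate. *)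
Lemma quadrature_centroid (w : R -> R) a k x W W' E :
  a <= k -> k - x = (k - a) * (r + 1) / (r + 2) ->
  {within `[a, k], continuous w} ->
  (forall s, a <= s <= k -> `|w s - (W + W' * (s - x))| <= E) ->
  `|integ a k (fun s => w s * (k - s) `^ r) - W * ((k - a) `^ (r + 1) / (r + 1))|
  <= E * integ a k (fun s => (k - s) `^ r).
Proof.
move=> ak ex cw wE.
have [i e] := integ_lin_powR (W + W' * (k - x)) (- W') r1 ak (lexx k).
have [ik _] := integ_powR_refl r1 ak (lexx k).
have h s : a <= s <= k ->
    (W + W' * (k - x) + - W' * (k - s)) * (k - s) `^ r =
    (W + W' * (s - x)) * (k - s) `^ r.
  by move=> _; congr (_ * _); ring.
have i2 := eq_integrable_itv h i.
have -> : W * ((k - a) `^ (r + 1) / (r + 1)) =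
    integ a k (fun s => (W + W' * (s - x)) * (k - s) `^ r).
  rewrite -(eq_integ h) e subrr !powR0 ?subr0 ?ex//.
  have -> : (k - a) `^ (r + 2) = (k - a) `^ (r + 1) * (k - a).
    rewrite (_ : r + 2 = (r + 1) + 1); last by ring.
    have [->|n0] := eqVneq (k - a) 0; last by rewrite powRD ?n0 ?implybT// powRr1//; lra.
    by rewrite mulr0 powR0// gt_eqF//; have := r1; lra.
  by field; rewrite ?rn1 ?rn2.
have iw := itgM_continuous cw ik.
rewrite -integB// -integZ//; apply: integ_norm_le.
- exact: itgB.
- exact: itgZ.
move=> s sab; rewrite -mulrBl normrM (ger0_norm (powR_ge0 _ _)).
by rewrite ler_wpM2r ?powR_ge0// wE.
Qed.

(** The parameter l may be negative: on part of each cell the line through the nodes is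
    extrapolated. The constant 2 B collects the Taylor remainders at s and x1 seen from x0, and 3 C
    comes from |1 - l| + |l| <= 3 applied to the nodal errors. *)
Lemma interpolation_error (F : nat -> R -> R) T B C x0 x1 s l W0 W1 tau :
  smooth_on 2 0 T F -> (forall t, 0 <= t <= T -> `|F 2 t| <= B) ->
  0 <= x0 <= T -> 0 <= x1 <= T -> 0 <= s <= T -> 0 < tau ->
  s - x0 = l * (x1 - x0) -> `|l| <= 1 -> `|x1 - x0| <= tau ->
  `|W0 - F 0 x0| <= C * tau ^+ 2 -> `|W1 - F 0 x1| <= C * tau ^+ 2 ->
  `|F 0 s - ((1 - l) * W0 + l * W1)| <= (2 * B + 3 * C) * tau ^+ 2.
Proof.
move=> sF FB x0T x1T sT tau0 es l1 x10 W0e W1e.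
have B0 : 0 <= B by apply: le_trans (FB _ x0T).
have h1 := linear_taylor_bound sF FB x0T sT.
have h2 := linear_taylor_bound sF FB x0T x1T.
have q1 : B * (x1 - x0) ^+ 2 <= B * tau ^+ 2.
  by rewrite ler_wpM2l// -real_normK ?num_real// lerXn2r// nnegrE ltW.
have q0 : B * (s - x0) ^+ 2 <= B * tau ^+ 2.
  rewrite ler_wpM2l// -real_normK ?num_real// lerXn2r ?nnegrE ?(ltW tau0)//.
  by rewrite es normrM; apply: le_trans x10; rewrite ler_piMl.
set e1 := F 0%N s - _ in h1; set e2 := F 0%N x1 - _ in h2.
have -> : F 0 s - ((1 - l) * W0 + l * W1) =
    e1 - l * e2 - (1 - l) * (W0 - F 0 x0) - l * (W1 - F 0 x1).
  by rewrite /e1 /e2 es; ring.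
have n1 : `|1 - l| <= 2 by apply: le_trans (ler_normB _ _) _; rewrite normr1; lra.
have c0 : 0 <= C * tau ^+ 2 by apply: le_trans W0e.
have m1 : `|l * e2| <= B * tau ^+ 2.
  by rewrite normrM; apply: le_trans (le_trans h2 q1); rewrite ler_piMl.
have m2 : `|(1 - l) * (W0 - F 0 x0)| <= 2 * (C * tau ^+ 2).
  by rewrite normrM ler_pM.
have m3 : `|l * (W1 - F 0 x1)| <= C * tau ^+ 2.
  by rewrite normrM; apply: le_trans W1e; rewrite ler_piMl.
have t1 := ler_normB (e1 - l * e2 - (1 - l) * (W0 - F 0 x0)) (l * (W1 - F 0 x1)).
have t2 := ler_normB (e1 - l * e2) ((1 - l) * (W0 - F 0 x0)).
have t3 := ler_normB e1 (l * e2).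
by lra.
Qed.

Definition last_mass : R := cut `^ (r + 1) / (r + 1).

(** [W 0] belongs to time tau/3 and [W j] to tau j for j > 0. In units of tau, the initial half cell
    and the m cells [i + 1/2, i + 3/2] cover [0, m + 1/2]. *)
Definition quadrature_head n (W : nat -> R) m : R :=
  3 / 2 * (ker0 r (cut + n%:R + 1 / 2) * W 0%N + kerA1 r (cut + n%:R + 1 / 2) * W 1%N) +
  \sum_(i < m) (kerB r (cut + (n - i)%:R) * W i.+1 + kerA r (cut + (n - i)%:R) * W i.+2).

Definition quadrature n (W : nat -> R) : R :=
  quadrature_head n W n + last_mass * W n.+1.

Section QuadratureError.
Variables (F : nat -> R -> R) (T B C tau : R) (n : nat) (W : nat -> R).
Hypotheses (sF : smooth_on 2 0 T F) (FB : forall t, 0 <= t <= T -> `|F 2 t| <= B).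
Hypotheses (tau0 : 0 < tau) (nT : tau * n.+2%:R <= T).
Hypothesis W0 : `|W 0%N - F 0 (tau / 3)| <= C * tau ^+ 2.
Hypothesis WS : forall j, (0 < j <= n.+1)%N -> `|W j - F 0 (tau * j%:R)| <= C * tau ^+ 2.

Let K := cut + n%:R + 1 / 2.
Let E := (2 * B + 3 * C) * tau ^+ 2.

Let cutb : 1 / 2 < cut < 1.
Proof. by rewrite /tail_len; have := r01; lra. Qed.

Let leT x : x <= n.+2%:R -> tau * x <= T.
Proof. by move=> xn; apply: le_trans nT; rewrite ler_pM2l. Qed.

Let tn : tau != 0. Proof. by rewrite gt_eqF. Qed.

Let ker_itg a : 0 <= a -> a <= K -> itg 0 (tau * a) (fun s => (tau * K - s) `^ r).
Proof.
move=> a0 aK; have h1 : 0 <= tau * a by rewrite mulr_ge0// ltW.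
have h2 : tau * a <= tau * K by rewrite ler_pM2l.
by have [] := integ_powR_refl r1 h1 h2.
Qed.

Let cw a b : 0 <= a -> b <= T -> {within `[a, b], continuous (F 0)}.
Proof.
move=> a0 bT; apply: (@continuous_subspaceW _ _ _ `[0, T]).
  by apply: subset_itv; rewrite bnd_simp.
by have [c _] := sF; exact: c.
Qed.

Let w_itg a : 0 <= a -> a <= K -> tau * a <= T -> itg 0 (tau * a) (fun s => F 0 s * (tau * K - s) `^ r).
Proof. by move=> a0 aK aT; apply: itgM_continuous (ker_itg a0 aK); exact: cw. Qed.

Let K_le : K <= n.+2%:R. Proof. by have := cutb; rewrite /K -(natr1 n.+1) -(natr1 n); lra. Qed.

Let head_error m : (m <= n)%N ->
  `|integ 0 (tau * (m%:R + 1 / 2)) (fun s => F 0 s * (tau * K - s) `^ r) -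
    tau `^ (r + 1) * quadrature_head n W m|
  <= E * integ 0 (tau * (m%:R + 1 / 2)) (fun s => (tau * K - s) `^ r).
Proof.
have cb := cutb; have KL := K_le.
elim: m => [_|m IH mn].
  have n0 := ler0n R n.
  rewrite /quadrature_head big_ord0 addr0 add0r -/K.
  have half : 0 <= 1 / 2 :> R by lra.
  have hK : 1 / 2 <= K by rewrite /K; lra.
  have c : {within `[tau * 0, tau * (1 / 2)], continuous (F 0)}.
    by apply: cw; [rewrite mulr0|apply: leT; rewrite -(natr1 n.+1) -(natr1 n); lra].
  have P_bound s : tau * 0 <= s <= tau * (1 / 2) ->
    `|F 0 s - (3 / 2 * (W 0 - W 1 / 3) + 3 / 2 * (W 1 - W 0) * (s / tau - 0 + 0))| <= E.
    rewrite mulr0 => /andP[s0 s1].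
    pose l := 3 / 2 * (s / tau - 1 / 3).
    have -> : 3 / 2 * (W 0 - W 1 / 3) + 3 / 2 * (W 1 - W 0) * (s / tau - 0 + 0) =
      (1 - l) * W 0 + l * W 1 by rewrite /l; field; rewrite tn.
    have st : 0 <= s / tau <= 1 / 2.
      by rewrite divr_ge0 ?(ltW tau0)//= ler_pdivrMr// mulrC.
    have t2 : tau * 2 <= T by apply: leT; rewrite -(natr1 n.+1) -(natr1 n); lra.
    apply: (@interpolation_error F T B C (tau / 3) tau) => //; try lra.
    - by rewrite /l; field; rewrite tn.
    - by rewrite /l ler_norml; lra.
    - by rewrite ler_norml; lra.
    - by have := @WS 1; rewrite mulr1; apply.
  have := quadrature_piece tau0 half hK (erefl (K - 0)) (erefl (K - 1 / 2)) c P_bound.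
  rewrite mulr0; congr (`|_ - _ * _| <= _).
  have h s : 0 <= s <= 1 / 2 ->
     3 / 2 * W 0 * ((1 - s) * (K - s) `^ r) + 3 / 2 * W 1 * ((s - 1 / 3) * (K - s) `^ r)
     = (3 / 2 * (W 0 - W 1 / 3) + 3 / 2 * (W 1 - W 0) * s) * (K - s) `^ r.
    by move=> _; field.
  have i0 := itg_ker0 r01 hK; have i1 := itg_kerA1 r01 hK.
  rewrite -(eq_integ h) integD; try exact: itgZ.
  by rewrite !integZ// -ker0E -kerA1E; field.
have mn' := ltnW mn; have {}IH := IH mn'.
have nm : (n - m)%:R = n%:R - m%:R :> R by rewrite natrB.
have nm1 : 1 <= (n - m)%:R :> R by rewrite ler1n subn_gt0.
have m0 := ler0n R m.
pose a : R := m%:R + 1 / 2; pose k := cut + (n - m)%:R.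
have eb : m.+1%:R + 1 / 2 = a + 1 by rewrite /a -(natr1 m); ring.
have aa : a <= a + 1 by lra.
have aK : a + 1 <= K by rewrite /a /K; lra.
have ek : k - 0 = K - a by rewrite /k /K /a nm; field.
have ek' : k - 1 = K - (a + 1) by rewrite /k /K /a nm; field.
have k1 : 1 <= k by rewrite /k; lra.
have aT : tau * (a + 1) <= T by apply: leT; move: K_le; lra.
have a0 : 0 <= a by rewrite /a; lra.
have ta0 : 0 <= tau * a by rewrite mulr_ge0// ltW.
have taa : tau * a <= tau * (a + 1) by rewrite ler_pM2l.
have c : {within `[tau * a, tau * (a + 1)], continuous (F 0)} by exact: cw.
have P_bound s : tau * a <= s <= tau * (a + 1) ->
  `|F 0 s - ((3 / 2 * W m.+1 - W m.+2 / 2) + (W m.+2 - W m.+1) * (s / tau - a + 0))| <= E.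
  move=> /andP[s0 s1].
  pose l := s / tau - m.+1%:R.
  have -> : (3 / 2 * W m.+1 - W m.+2 / 2) + (W m.+2 - W m.+1) * (s / tau - a + 0) =
    (1 - l) * W m.+1 + l * W m.+2.
    by rewrite /l /a -(natr1 m); field; rewrite tn.
  have st : a <= s / tau <= a + 1.
    by rewrite ler_pdivlMr// ler_pdivrMr// mulrC s0 mulrC.
  have l2 : -1 / 2 <= l <= 1 / 2 by rewrite /l -(natr1 m); move: st; rewrite /a; lra.
  have mT : tau * m.+2%:R <= T by apply: leT; rewrite ler_nat.
  have m1T : tau * m.+1%:R <= T by apply: leT; rewrite ler_nat; exact: leqW mn'.
  have p1 : 0 <= tau * m.+1%:R by rewrite mulr_ge0// ltW.
  have p2 : 0 <= tau * m.+2%:R by rewrite mulr_ge0// ltW.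
  have d : tau * m.+2%:R - tau * m.+1%:R = tau by rewrite -(natr1 m.+1); ring.
  apply: (@interpolation_error F T B C (tau * m.+1%:R) (tau * m.+2%:R)) => //; rewrite ?d ?p1 ?p2//.
  - by lra.
  - by rewrite /l; field; rewrite tn.
  - by rewrite ler_norml; lra.
  - by rewrite ger0_norm// ltW.
  - by apply: WS; exact: mn'.
  - by apply: WS; exact: mn.
have := quadrature_piece tau0 aa aK ek ek' c P_bound.
have h s : 0 <= s <= 1 ->
   W m.+1 * ((3 / 2 - s) * (k - s) `^ r) + W m.+2 * ((s - 1 / 2) * (k - s) `^ r)
   = ((3 / 2 * W m.+1 - W m.+2 / 2) + (W m.+2 - W m.+1) * s) * (k - s) `^ r.
  by move=> _; field.
have i0 := itg_kerA r01 k1; have i1 := itg_kerB r01 k1.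
rewrite -(eq_integ h) integD; try exact: itgZ.
rewrite !integZ// -kerAE -kerBE => hp.
have a1 : 0 <= a + 1 by lra.
have wi := w_itg a1 aK aT; have ki := ker_itg a1 aK.
rewrite eb (integ_split ta0 taa wi) (integ_split ta0 taa ki).
have -> : quadrature_head n W m.+1 = quadrature_head n W m + (W m.+1 * kerB r k + W m.+2 * kerA r k).
  rewrite /quadrature_head big_ord_recr/= -/k.
  move: (ker0 _ _) (kerA1 _ _) (kerA _ _) (kerB _ _) (\sum_(i < m) _) => x1 x2 x3 x4 x5.
  by ring.
by rewrite [tau `^ _ * _]mulrDr [E * _]mulrDr; exact: dist_addD IH hp.
Qed.

(** In units of tau, [K] = n + 1 + sigma is the collocation time. The pointwise error [E] multiplies
    the kernel mass of the whole interval, so the bound does not grow with the number of cells. *)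
Lemma quadrature_error :
  `|integ 0 (tau * K) (fun s => F 0 s * (tau * K - s) `^ r) -
    tau `^ (r + 1) * quadrature n W| <= E * ((tau * K) `^ (r + 1) / (r + 1)).
Proof.
have cb := cutb; have KL := K_le; have n0 := ler0n R n.
pose a : R := n%:R + 1 / 2; have a0 : 0 <= a by rewrite /a; lra.
have aK : a <= K by rewrite /K /a; lra.
have K0 : 0 <= K := le_trans a0 aK.
have ta0 : 0 <= tau * a by rewrite mulr_ge0// ltW.
have taK : tau * a <= tau * K by rewrite ler_pM2l.
have tK0 := le_trans ta0 taK; have KT := leT KL.
have [_ <-] : itg 0 (tau * K) (fun s => (tau * K - s) `^ r) /\
    integ 0 (tau * K) (fun s => (tau * K - s) `^ r) = (tau * K) `^ (r + 1) / (r + 1).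
  have [i ->] := integ_powR_refl r1 tK0 (lexx _).
  by rewrite subr0 subrr powR0// subr0.
have wi := w_itg K0 (lexx K) KT; have ki := ker_itg K0 (lexx K).
rewrite (integ_split ta0 taK wi) (integ_split ta0 taK ki).
pose x := tau * n.+1%:R.
have xT : 0 <= x <= T.
  by rewrite mulr_ge0 ?(ltW tau0)//=; apply: leT; rewrite ler_nat.
(* Here sigma = 1 - alpha/2 matters. In units of tau the last cell has length (r + 2)/2 and its
   centroid lies (r + 1)/2 before the end, hence 1/2 after the start, which is the node n + 1. *)
have ex : tau * K - x = (tau * K - tau * a) * (r + 1) / (r + 2).
  by rewrite /x /K /a /tail_len -(natr1 n); field; rewrite rn2.
have c : {within `[tau * a, tau * K], continuous (F 0)} by exact: cw.
have W_bound s : tau * a <= s <= tau * K -> `|F 0 s - (W n.+1 + F 1 x * (s - x))| <= E.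
  move=> /andP[s0 s1].
  have sT : 0 <= s <= T by rewrite (le_trans ta0 s0) (le_trans s1 KT).
  have h1 := linear_taylor_bound sF FB xT sT.
  have h2 : `|W n.+1 - F 0 x| <= C * tau ^+ 2 by apply: WS; rewrite ltnSn.
  have B0 : 0 <= B := le_trans (normr_ge0 _) (FB xT).
  have C0 : 0 <= C * tau ^+ 2 := le_trans (normr_ge0 _) h2.
  have sx : `|s - x| <= tau.
    have e1 : tau * a = x - tau / 2 by rewrite /a /x -(natr1 n); field.
    have e2 : tau * K = x + tau * (tail_len r - 1 / 2) by rewrite /K /x -(natr1 n); field.
    have : tau * (tail_len r - 1 / 2) <= tau * 1 by rewrite ler_pM2l//; lra.
    by rewrite ler_norml; lra.
  have q : B * (s - x) ^+ 2 <= B * tau ^+ 2.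
    by rewrite ler_wpM2l// -real_normK ?num_real// lerXn2r// nnegrE ltW.
  have Bt : 0 <= B * tau ^+ 2 by rewrite mulr_ge0// sqr_ge0.
  have -> : F 0 s - (W n.+1 + F 1 x * (s - x)) =
    (F 0 s - (F 0 x + F 1 x * (s - x))) - (W n.+1 - F 0 x) by ring.
  apply: le_trans (ler_normB _ _) _.
  by rewrite /E mulrDl; lra.
have h1 := quadrature_centroid taK ex c W_bound.
have h2 := head_error (leqnn n).
have lm : tau `^ (r + 1) * (last_mass * W n.+1) =
    W n.+1 * ((tau * K - tau * a) `^ (r + 1) / (r + 1)).
  rewrite -mulrBr (_ : K - a = cut); last by rewrite /K /a; ring.
  rewrite powRM ?(ltW tau0)//; last by lra.
  by rewrite /last_mass; ring.
rewrite /quadrature [tau `^ _ * _]mulrDr lm.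
by rewrite [E * _]mulrDr; exact: dist_addD h2 h1.
Qed.

End QuadratureError.
(** A node receives [kerB] from the cell centred at it (the last node: the mass of the last cell)
    and [kerA] from the preceding cell, together a convolution weight. Only nodes 0 and 1 feel the
    initial half cell, whence the two correction terms. *)
Lemma quadrature_ker n (X : nat -> R) :
  quadrature n X = \sum_(i < n.+1) ker r (n - i) * X i.+1 +
    (3 / 2 * kerA1 r (cut + n%:R + 1 / 2) - kerA r (cut + 1 + n%:R)) * X 1%N +
    3 / 2 * ker0 r (cut + n%:R + 1 / 2) * X 0%N.
Proof.
have e1 : \sum_(i < n.+1) ker r (n - i) * X i.+1 =
    \sum_(i < n.+1) kerA r (cut + 1 + (n - i)%:R) * X i.+1 +
    \sum_(i < n) kerB r (cut + (n - i)%:R) * X i.+1 + last_mass * X n.+1.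
  rewrite big_ord_recr [in RHS]big_ord_recr/= subnn ker_0.
  have -> : \sum_(i < n) ker r (n - i) * X i.+1 =
      \sum_(i < n) (kerA r (cut + 1 + (n - i)%:R) * X i.+1 +
                    kerB r (cut + (n - i)%:R) * X i.+1).
    apply: eq_bigr => i _; have := ltn_ord i; rewrite -subn_gt0.
    by case: (n - i)%N => // m _; rewrite kerS mulrDl.
  rewrite big_split/= mulr0n addr0 -/last_mass.
  move: (\sum_(i < n) _) (\sum_(i < n) _) (kerA _ _) last_mass => s1 s2 x m.
  by ring.
have e2 : \sum_(i < n.+1) kerA r (cut + 1 + (n - i)%:R) * X i.+1 =
    kerA r (cut + 1 + n%:R) * X 1%N + \sum_(i < n) kerA r (cut + (n - i)%:R) * X i.+2.
  rewrite big_ord_recl/= subn0; congr (_ + _); apply: eq_bigr => i _.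
  have -> : cut + 1 + (n - bump 0 i)%:R = cut + (n - i)%:R; last by [].
  have -> : (n - i)%N = (n - bump 0 i).+1 by have := ltn_ord i; rewrite /bump; lia.
  by rewrite -natr1; ring.
rewrite /quadrature /quadrature_head big_split/= e1 e2.
by move: (\sum_(i < n) _) (\sum_(i < n) _) => s1 s2; ring.
Qed.

End Quadrature.

(** The scheme indexes its weights backwards in time, so that l = n + 1 belongs to node 0; reversing
    l exhibits the sum as the quadrature rule, with a common factor tau^(2-alpha). *)
Lemma coef_c_sum (R : realType) (alpha tau : R) n (X : nat -> R) : 1 < alpha < 2 ->
  \sum_(0 <= l < n.+2) coef_c alpha tau n.+1 l * X (n.+1 - l)%N =
  tau `^ (2 - alpha) * quadrature (1 - alpha) n X.
Proof.
move=> alpha12.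
pose r := 1 - alpha; pose c := tail_len r.
have sgE : sigma alpha = c - 1 / 2 by rewrite /sigma /c /tail_len /r; field.
have r1E : 2 - alpha = r + 1 by rewrite /r; ring.
have cE l : (l <= n.+1)%N -> coef_c alpha tau n.+1 (n.+1 - l) =
  tau `^ (2 - alpha) *
  (if l == 0%N then 3 / 2 * ker0 r (c + n%:R + 1 / 2) else
   (if l == 1%N then 3 / 2 * kerA1 r (c + n%:R + 1 / 2)
    else kerA r (c + (n.+2 - l)%:R)) +
   (if l == n.+1 then last_mass r else kerB r (c + (n.+1 - l)%:R))).
  move=> ln; rewrite /coef_c; case: l ln => [_|l ln].
    rewrite subn0 !eqxx ker0E mulrCA -!mulrA; congr (_ * (_ * _)).
    by rewrite (_ : c + n%:R + 1 / 2 = n.+1%:R + sigma alpha)// sgE -(natr1 n); field.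
  rewrite ifF; last by apply/negbTE; lia.
  rewrite subKn// /= mulrDr; congr (_ + _).
    rewrite /coef_a eqSS; case: ifP => _.
      rewrite kerA1E mulrCA -!mulrA; congr (_ * (_ * _)).
      by rewrite (_ : c + n%:R + 1 / 2 = n.+1%:R + sigma alpha)// sgE -(natr1 n); field.
    congr (_ * _); rewrite kerAE subSS (_ : c + (n.+1 - l)%:R = n.+1%:R + sigma alpha - l.+1%:R + 3 / 2)//.
    by rewrite natrB ?sgE -?(natr1 l); [field|lia].
  rewrite /coef_b; case: ifP => _.
    congr (_ * _); rewrite /last_mass -/r -/c.
    have [c0 r0] : 0 <= c /\ - 1 < r by rewrite /c /tail_len /r; lra.
    by rewrite -integ_powR// sgE subrK.
  congr (_ * _); rewrite kerBE.
  rewrite (_ : c + (n.+1 - l.+1)%:R = n.+1%:R + sigma alpha - l.+1%:R + 1 / 2)//.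
  by rewrite natrB// sgE; field.
rewrite big_mkord (reindex_inj rev_ord_inj)/=.
rewrite (eq_bigr (fun j : 'I_n.+2 => coef_c alpha tau n.+1 (n.+1 - j) * X j)); last first.
  by move=> j _; rewrite subSS subKn// -ltnS.
rewrite big_ord_recl cE//=.
rewrite (eq_bigr (fun i : 'I_n.+1 => tau `^ (2 - alpha) *
  ((if i == 0%N :> nat then 3 / 2 * kerA1 r (c + n%:R + 1 / 2)
    else kerA r (c + (n.+1 - i)%:R)) +
   (if i == n :> nat then last_mass r else kerB r (c + (n - i)%:R))) * X i.+1)); last first.
  by move=> i _; rewrite cE /bump/= ?add1n ?subSS// ltnS -ltnS.
rewrite /quadrature /quadrature_head -/r -/c.
have hk : \sum_(i < n.+1) tau `^ (2 - alpha) *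
  ((if i == 0%N :> nat then 3 / 2 * kerA1 r (c + n%:R + 1 / 2)
    else kerA r (c + (n.+1 - i)%:R)) +
   (if i == n :> nat then last_mass r else kerB r (c + (n - i)%:R))) * X i.+1 =
  tau `^ (2 - alpha) * (3 / 2 * kerA1 r (c + n%:R + 1 / 2) * X 1%N +
   \sum_(i < n) (kerB r (c + (n - i)%:R) * X i.+1 + kerA r (c + (n - i)%:R) * X i.+2) +
   last_mass r * X n.+1).
  under eq_bigr do rewrite -mulrA mulrDl.
  rewrite -mulr_sumr big_split/= big_ord_recl big_ord_recr/= eqxx; congr (_ * _).
  rewrite big_split/= (eq_bigr (fun i : 'I_n => kerA r (c + (n - i)%:R) * X i.+2)); last first.
    by move=> i _; rewrite /bump/= add1n subSS.
  have hB : \sum_(i < n) (if i == n :> nat then last_mass r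
      else kerB r (c + (n - i)%:R)) * X i.+1 =
      \sum_(i < n) kerB r (c + (n - i)%:R) * X i.+1.
    by apply: eq_bigr => i _; rewrite ltn_eqF.
  rewrite hB.
  move: (\sum_(i < n) _) (\sum_(i < n) _) => s1 s2; ring.
rewrite hk.
move: (ker0 _ _) (kerA1 _ _) (\sum_(i < n) _) (last_mass _) => x1 x2 x3 x4.
by ring.
Qed.

(** * Truncation errors of the two kinds of scheme equations *)

Section Truncation.
Variable R : realType.
Variables (alpha L T : R) (u : R -> R -> R) (D : nat -> nat -> R -> R -> R).
Variables (f : R -> R -> R) (psi : R -> R).
Hypotheses (alpha12 : 1 < alpha < 2) (L0 : 0 < L) (T0 : 0 < T).
Hypothesis DP : C44_derivs L T u D.
Hypothesis pde : forall x t, 0 < x < L -> 0 < t <= T ->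
  caputo alpha D x t = D 2 0 x t + f x t.
Hypothesis u_t0 : forall x, 0 <= x <= L -> D 0 1 x 0 = psi x.
Variable B : R.
Hypothesis D04 : forall x t, 0 <= x <= L -> 0 <= t <= T -> `|D 0 4 x t| <= B.
Hypothesis D40 : forall x t, 0 <= x <= L -> 0 <= t <= T -> `|D 4 0 x t| <= B.
Hypothesis D22 : forall x t, 0 <= x <= L -> 0 <= t <= T -> `|D 2 2 x t| <= B.

Lemma dx2_lin (h a b : R) (w1 w2 : nat -> R) i :
  dx2 h (fun j => a * w1 j + b * w2 j) i = a * dx2 h w1 i + b * dx2 h w2 i.
Proof. by rewrite /dx2; ring. Qed.

Lemma dx2_half (h : R) (w1 w2 : nat -> R) i :
  dx2 h (fun j => (w1 j + w2 j) / 2) i = 2^-1 * dx2 h w1 i + 2^-1 * dx2 h w2 i.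
Proof. by rewrite /dx2; ring. Qed.

(** Taylor expansion at 0 turns this quotient into u_tt + (tau/3) u_ttt + O(tau^2), both taken at
    time 0; hence the unusual node tau/3. *)
Lemma time_node0 x tau : 0 < x < L -> 0 < tau <= T ->
  `|2 / tau * ((u x tau - u x 0) / tau - psi x) - D 0 2 x (tau / 3)| <= 3 * B * tau ^+ 2.
Proof.
move=> xL /andP[tau0 tauT]; have xL' : 0 <= x <= L by lra.
have tn : tau != 0 by rewrite gt_eqF.
have [uE _ _ _] := DP; rewrite -(u_t0 xL') -uE.
have h0 : 0 <= (0 : R) <= T by rewrite lexx ltW.
have h1 : 0 <= tau <= T by lra.
have h3 : 0 <= tau / 3 <= T by lra.
have b1 := taylor_bound (C44_smooth_t DP (isT : (0 <= 4)%N) (isT : (4 <= 4)%N) xL)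
  (fun t tT => D04 xL' tT) h0 h1.
have b2 := linear_taylor_bound (C44_smooth_shift L0 T0 DP (isT : (0 <= 4)%N) (isT : (2 + 2 <= 4)%N) xL)
  (fun t tT => D04 xL' tT) h0 h3.
rewrite !big_ord_recr !big_ord0 /= subr0 (_ : 3`! = 6)%N// (_ : 2`! = 2)%N// (_ : 1`! = 1)%N// fact0 in b1.
rewrite (gtr0_norm tau0) in b1; rewrite subr0 /= in b2.
set r1 := _ - _ in b1; set r2 := _ - _ in b2.
have -> : 2 / tau * ((D 0 0 x tau - D 0 0 x 0) / tau - D 0 1 x 0) - D 0 2 x (tau / 3)
   = 2 / tau ^+ 2 * r1 - r2.
  by rewrite /r1 /r2; field.
have B0 : 0 <= B := le_trans (normr_ge0 _) (D04 xL' h0).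
have c1 : `|2 / tau ^+ 2 * r1| <= 2 * B * tau ^+ 2.
  have q0 : 0 <= 2 / tau ^+ 2 by rewrite divr_ge0 ?sqr_ge0.
  rewrite normrM (ger0_norm q0).
  have -> : 2 * B * tau ^+ 2 = 2 / tau ^+ 2 * (B * tau ^+ 4) by field.
  by apply: ler_wpM2l.
have c2 : B * (tau / 3) ^+ 2 <= B * tau ^+ 2.
  by rewrite ler_wpM2l// lerXn2r ?nnegrE; lra.
by apply: le_trans (ler_normB _ _) _; lra.
Qed.

Lemma time_nodeS x tau t : 0 < x < L -> 0 < tau -> 0 <= t - tau -> t + tau <= T ->
  `|(u x (t + tau) - 2 * u x t + u x (t - tau)) / tau ^+ 2 - D 0 2 x t| <= 2 * B * tau ^+ 2.
Proof.
move=> xL tau0 h1 h2; have xL' : 0 <= x <= L by lra.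
have [uE _ _ _] := DP; rewrite -uE.
have b := second_difference_bound (C44_smooth_t DP (isT : (0 <= 4)%N) (isT : (4 <= 4)%N) xL)
  (fun t tT => D04 xL' tT) (ltW tau0) h1 h2.
have t2 : 0 < tau ^+ 2 by rewrite exprn_gt0.
rewrite -(ler_pM2l t2) -[X in X * `|_|](gtr0_norm t2) -normrM.
have -> : tau ^+ 2 * (2 * B * tau ^+ 2) = 2 * B * tau ^+ 4 by ring.
congr (`|_| <= _): b; rewrite /=; field.
by rewrite gt_eqF.
Qed.

Lemma space_node x h t : 0 < h -> 0 <= x - h -> x + h <= L -> 0 <= t <= T ->
  `|(u (x + h) t - 2 * u x t + u (x - h) t) / h ^+ 2 - D 2 0 x t| <= 2 * B * h ^+ 2.
Proof.
move=> h0 h1 h2 tT.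
have b := C44_second_difference_x T0 DP D40 (ltW h0) h1 h2 tT.
have t2 : 0 < h ^+ 2 by rewrite exprn_gt0.
rewrite -(ler_pM2l t2) -[X in X * `|_|](gtr0_norm t2) -normrM.
have -> : h ^+ 2 * (2 * B * h ^+ 2) = 2 * B * h ^+ 4 by ring.
congr (`|_| <= _): b; rewrite /=; field.
by rewrite gt_eqF.
Qed.

Lemma uxx_taylor x t s d : 0 < x < L -> 0 <= t <= T -> 0 <= s <= T -> `|s - t| <= d ->
  `|D 2 0 x s - (D 2 0 x t + D 2 1 x t * (s - t))| <= B * d ^+ 2.
Proof.
move=> xL tT sT sd; have xL' : 0 <= x <= L by lra.
have b := linear_taylor_bound (C44_smooth_t DP (isT : (2 <= 4)%N) (isT : (2 <= 4)%N) xL)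
  (fun t tT => D22 xL' tT) tT sT.
have B0 : 0 <= B := le_trans (normr_ge0 _) (D22 xL' tT).
have d0 : 0 <= d := le_trans (normr_ge0 _) sd.
apply: (le_trans b); rewrite ler_wpM2l// -real_normK ?num_real//.
by rewrite lerXn2r// nnegrE.
Qed.

Variables (N M : nat).
Hypotheses (N0 : (0 < N)%N) (M0 : (0 < M)%N).
Notation tau := (T / N%:R).
Notation h := (L / M%:R).
Notation U := (fun i k : nat => u (i%:R * h) (k%:R * tau)).

Let Nr : 0 < N%:R :> R. Proof. by rewrite ltr0n. Qed.
Let Mr : 0 < M%:R :> R. Proof. by rewrite ltr0n. Qed.

Lemma tau_gt0 : 0 < tau. Proof. exact: divr_gt0. Qed.
Lemma h_gt0 : 0 < h. Proof. exact: divr_gt0. Qed.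

Lemma grid_t k : (k <= N)%N -> 0 <= k%:R * tau <= T.
Proof.
move=> kN; rewrite mulr_ge0 ?(ltW tau_gt0)//= mulrA ler_pdivrMr// mulrC.
by rewrite ler_pM2l// ler_nat.
Qed.

Lemma grid_x k : (k <= M)%N -> 0 <= k%:R * h <= L.
Proof.
move=> kN; rewrite mulr_ge0 ?(ltW h_gt0)//= mulrA ler_pdivrMr// mulrC.
by rewrite ler_pM2l// ler_nat.
Qed.

Lemma grid_xoo i : (1 <= i <= M.-1)%N -> 0 < i%:R * h < L.
Proof.
move=> /andP[i1 iM]; rewrite mulr_gt0 ?h_gt0 ?ltr0n//= mulrA ltr_pdivrMr// mulrC.
by rewrite ltr_pM2l// ltr_nat -ltnS in iM *; apply: leq_trans iM _; rewrite prednK.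
Qed.

Lemma dx2_U i k : (1 <= i <= M.-1)%N -> (k <= N)%N ->
  `|dx2 h (fun j => U j k) i - D 2 0 (i%:R * h) (k%:R * tau)| <= 2 * B * h ^+ 2.
Proof.
move=> iM kN; case: i iM => // i iM.
have e1 : i.+2%:R * h = i.+1%:R * h + h by rewrite -(natr1 i.+1) mulrDl mul1r.
have e2 : i%:R * h = i.+1%:R * h - h by rewrite -(natr1 i) mulrDl mul1r addrK.
rewrite /dx2 e1 /= e2; apply: space_node.
- exact: h_gt0.
- by rewrite -e2 mulr_ge0// ltW// h_gt0.
- by rewrite -e1; have /andP[] := @grid_x i.+2 ltac:(lia).
- exact: grid_t.
Qed.

Lemma dt2_U_node i j : (1 <= i <= M.-1)%N -> (0 < j < N)%N ->
  `|dt2 tau psi h U i j - D 0 2 (i%:R * h) (tau * j%:R)| <= 3 * B * tau ^+ 2.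
Proof.
move=> iM /andP[j0 jN]; case: j j0 jN => // j _ jN.
have e1 : j.+2%:R * tau = j.+1%:R * tau + tau by rewrite -(natr1 j.+1) mulrDl mul1r.
have e2 : j%:R * tau = j.+1%:R * tau - tau by rewrite -(natr1 j) mulrDl mul1r addrK.
have xL := grid_xoo iM; have tau0 := tau_gt0.
rewrite /dt2 /= e1 e2 (mulrC tau).
have h1 : 0 <= j.+1%:R * tau - tau by rewrite -e2 mulr_ge0// ltW.
have h2 : j.+1%:R * tau + tau <= T by rewrite -e1; have /andP[] := grid_t jN.
apply: le_trans (time_nodeS xL tau0 h1 h2) _.
have B0 : 0 <= B.
  by apply: le_trans (normr_ge0 _) (@D04 0 0 _ _); lra.
by rewrite ler_wpM2r ?sqr_ge0//; lra.
Qed.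

Lemma dt2_U_node0 i : (1 <= i <= M.-1)%N ->
  `|dt2 tau psi h U i 0 - D 0 2 (i%:R * h) (tau / 3)| <= 3 * B * tau ^+ 2.
Proof.
move=> iM; rewrite /dt2 /= mul1r mul0r; apply: time_node0; first exact: grid_xoo.
by rewrite tau_gt0/=; have := grid_t N0; rewrite mul1r => /andP[].
Qed.

(** The 11 is 2 + 3 times 3: [interpolation_error] gives 2 B + 3 C with nodal error C = 3 B. The
    summand 2 B collects the error of the space difference and the time expansions of u_xx. *)
Definition truncation_const : R :=
  2 * B + 11 * B * (T `^ (2 - alpha) / (2 - alpha)) / Gamma (2 - alpha).

Let p01 : 0 < 2 - alpha < 1. Proof. by have := alpha12; lra. Qed.

Let B0 : 0 <= B.
Proof. by apply: le_trans (normr_ge0 _) (@D04 0 0 _ _); have := L0; have := T0; lra. Qed.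

Let G0 : 0 < Gamma (2 - alpha). Proof. by have [] := Gamma_gt0_rec p01. Qed.

Let caputo_bound (I Q E t : R) : 0 <= t <= T -> 0 <= E <= 11 * B * tau ^+ 2 ->
  `|I - Q| <= E * (t `^ (2 - alpha) / (2 - alpha)) ->
  `|(Gamma (2 - alpha))^-1 * Q - (Gamma (2 - alpha))^-1 * I| <=
  11 * B * (T `^ (2 - alpha) / (2 - alpha)) / Gamma (2 - alpha) * tau ^+ 2.
Proof.
move=> /andP[t0 tT] /andP[E0 E1] IQ; have /andP[p0 p1] := p01.
rewrite -mulrBr normrM gtr0_norm ?invr_gt0// distrC.
rewrite [leRHS](_ : _ = (Gamma (2 - alpha))^-1 * (11 * B * tau ^+ 2 * (T `^ (2 - alpha) / (2 - alpha)))); last by ring.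
rewrite ler_wpM2l ?invr_ge0 ?(ltW G0)//; apply: (le_trans IQ).
have h : t `^ (2 - alpha) / (2 - alpha) <= T `^ (2 - alpha) / (2 - alpha).
  rewrite ler_wpM2r ?invr_ge0 ?(ltW p0)//.
  by apply: ge0_ler_powR; rewrite ?nnegrE ?(ltW p0)// (le_trans t0 tT).
by apply: ler_pM => //; rewrite divr_ge0 ?powR_ge0// ltW.
Qed.

Lemma truncationS i n : (1 <= i <= M.-1)%N -> (n.+1 <= N.-1)%N ->
  `|(Gamma (2 - alpha))^-1 *
      (\sum_(0 <= l < n.+2) coef_c alpha tau n.+1 l * dt2 tau psi h U i (n.+1 - l))
    - ((1 / 2 + sigma alpha) * dx2 h (fun j => (U j n.+1 + U j n.+2) / 2) i
       + (1 / 2 - sigma alpha) * dx2 h (fun j => (U j n + U j n.+1) / 2) i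
       + f (i%:R * h) (n.+1%:R * tau + sigma alpha * tau))|
  <= truncation_const * (tau ^+ 2 + h ^+ 2).
Proof.
move=> iM nN.
have n3 : (n.+2 <= N)%N by rewrite -ltnS prednK in nN.
have n2 : (n.+1 <= N)%N := ltnW n3.
have n1 : (n <= N)%N := ltnW n2.
pose r := 1 - alpha; have r01 : - 1 < r < 0 by rewrite /r; have := alpha12; lra.
have p1E : 2 - alpha = r + 1 by rewrite /r; ring.
pose x := i%:R * h; have xL : 0 < x < L := grid_xoo iM.
pose t := n.+1%:R * tau; pose s := t + sigma alpha * tau.
have sg : 0 < sigma alpha < 1 / 2 by rewrite /sigma; have := alpha12; lra.
have tau0 := tau_gt0.
have st : 0 < sigma alpha * tau < tau / 2.
  have /andP[sg0 sg1] := sg.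
  rewrite mulr_gt0//= mulrC (_ : tau / 2 = tau * (1 / 2)); last by rewrite mul1r.
  by rewrite ltr_pM2l.
have tT1 := grid_t n1.
have tT2 : 0 <= t <= T := grid_t n2.
have tT3 := grid_t n3.
have e1 : n.+2%:R * tau = t + tau by rewrite -(natr1 n.+1) mulrDl mul1r.
have e0 : n%:R * tau = t - tau by rewrite /t -(natr1 n) mulrDl mul1r addrK.
have sT : 0 <= s <= T by move: tT1 tT3; rewrite e0 e1 /s; lra.
have s0 : 0 < s by move: tT1; rewrite e0 /s; lra.
have sE : tau * (tail_len r + n%:R + 1 / 2) = s.
  by rewrite /s /t /tail_len /r /sigma -(natr1 n); field; rewrite pnatr_eq0 -lt0n.
pose W j := dt2 tau psi h U i j.
have nT : tau * n.+2%:R <= T by rewrite mulrC; have /andP[] := tT3.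
have WS j : (0 < j <= n.+1)%N -> `|W j - D 0 2 x (tau * j%:R)| <= 3 * B * tau ^+ 2.
  by move=> /andP[j0 jn]; apply: dt2_U_node => //; rewrite j0 (leq_ltn_trans jn).
have QE := quadrature_error r01
  (C44_smooth_shift L0 T0 DP (isT : (0 <= 4)%N) (isT : (2 + 2 <= 4)%N) xL)
  (fun t tT => D04 (ltac:(lra) : 0 <= x <= L) tT) tau0 nT (dt2_U_node0 iM) WS.
rewrite sE -p1E -/r in QE.
have capE : (Gamma (2 - alpha))^-1 * integ 0 s (fun y => D 0 2 x y * (s - y) `^ r) =
    D 2 0 x s + f x s by rewrite -(pde xL) ?s0//; have /andP[] := sT.
rewrite (coef_c_sum tau n W alpha12) -/r.
have E1 : 0 <= (2 * B + 3 * (3 * B)) * tau ^+ 2 <= 11 * B * tau ^+ 2.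
  have := B0; have := sqr_ge0 tau; move: (tau ^+ 2) => y y0 b0.
  have := mulr_ge0 b0 y0; lra.
have C1 := caputo_bound sT E1 QE; rewrite capE in C1.
have X0 := dx2_U iM n1.
have X1 := dx2_U iM n2.
have X2 := dx2_U iM n3.
have dist1 : `|t - tau - t| <= tau by rewrite ler_norml; lra.
have dist2 : `|t + tau - t| <= tau by rewrite ler_norml; lra.
have dist3 : `|s - t| <= tau by rewrite /s ler_norml; lra.
rewrite e0 e1 in X0 X2 tT1 tT3 *.
have Y0 := uxx_taylor xL tT2 tT1 dist1.
have Y2 := uxx_taylor xL tT2 tT3 dist2.
have Ys := uxx_taylor xL tT2 sT dist3.
rewrite !dx2_half -/x -/s {QE capE}.
have B0' := B0; rewrite /truncation_const.
have e : s - t = sigma alpha * tau by rewrite /s; ring.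
rewrite e in Ys; rewrite addrAC subrr add0r in Y0; rewrite addrAC subrr add0r in Y2.
move: C1 X0 X1 X2 Y0 Y2 Ys B0' tau0 sg; rewrite -/t -/x.
move: (dx2 _ _ _) (dx2 _ _ _) (dx2 _ _ _) (_ / Gamma _) (_^-1 * _) (f _ _).
move: (D 2 0 x s) (D 2 0 x (t - T / N%:R)) (D 2 0 x (t + T / N%:R)) (D 2 0 x t) (D 2 1 x t) (sigma alpha).
move: (T / N%:R) (L / M%:R).
clear; move=> tau h Ds Dm Dp a b sg d2 d1 d0 K Q F C1 X0 X1 X2 Y0 Y2 Ys B0 tau0 /andP[sg0 sg1].
have t2 : 0 <= tau ^+ 2 by exact: sqr_ge0.
have h2 : 0 <= h ^+ 2 by exact: sqr_ge0.
have Bt : 0 <= B * tau ^+ 2 by exact: mulr_ge0.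
have Bh : 0 <= B * h ^+ 2 by exact: mulr_ge0.
pose c := 2 * B * h ^+ 2 + B * tau ^+ 2.
have Z0 : `|d0 - (a + b * - tau)| <= c.
  rewrite (_ : _ - _ = (d0 - Dm) + (Dm - (a + b * - tau))); last by ring.
  by apply: le_trans (ler_normD _ _) _; rewrite /c; lra.
have Z1 : `|d1 - a| <= c by rewrite /c; lra.
have Z2 : `|d2 - (a + b * tau)| <= c.
  rewrite (_ : _ - _ = (d2 - Dp) + (Dp - (a + b * tau))); last by ring.
  by apply: le_trans (ler_normD _ _) _; rewrite /c; lra.
(* The weights at t - tau, t and t + tau sum to 1 and have first moment sigma tau, so the averaged
   u_xx reproduces the linear part of its time expansion exactly at t + sigma tau. *)
have w0 : 0 <= (1 / 2 - sg) / 2 by lra.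
have w2 : 0 <= (1 / 2 + sg) / 2 by lra.
have w1 : 0 <= 2^-1 :> R by lra.
have := ler_wpM2l w0 Z0; rewrite -[X in X * `|_|](ger0_norm w0) -normrM => z0.
have := ler_wpM2l w1 Z1; rewrite -[X in X * `|_|](ger0_norm w1) -normrM => z1.
have := ler_wpM2l w2 Z2; rewrite -[X in X * `|_|](ger0_norm w2) -normrM => z2.
set y0 := _ * _ in z0; set y1 := _ * _ in z1; set y2 := _ * _ in z2.
have -> : Q - ((1 / 2 + sg) * (2^-1 * d1 + 2^-1 * d2) + (1 / 2 - sg) * (2^-1 * d0 + 2^-1 * d1) + F)
  = (Q - (Ds + F)) + (Ds - (a + b * (sg * tau))) - (y0 + y1 + y2).
  by rewrite /y0 /y1 /y2; field.
have n1 := ler_normB ((Q - (Ds + F)) + (Ds - (a + b * (sg * tau)))) (y0 + y1 + y2).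
have n2 := ler_normD (Q - (Ds + F)) (Ds - (a + b * (sg * tau))).
have n3 := ler_normD (y0 + y1) y2; have n4 := ler_normD y0 y1.
have K0 : 0 <= K * tau ^+ 2 := le_trans (normr_ge0 _) C1.
have tp : 0 < tau ^+ 2 by exact: exprn_gt0.
have Kp : 0 <= K by rewrite -(pmulr_lge0 K tp).
have Kh : 0 <= K * h ^+ 2 by exact: mulr_ge0.
have cs : (1 / 2 - sg) / 2 * c + 2^-1 * c + (1 / 2 + sg) / 2 * c = c by field.
move: n1 n2 n3 n4 z0 z1 z2 C1 Ys cs Bt Bh K0 Kh; rewrite /c mulrDl !mulrDr.
by lra.
Qed.

Lemma truncation0 i : (1 <= i <= M.-1)%N ->
  `|(Gamma (3 - alpha))^-1 * ((1 - alpha / 3) * tau) `^ (2 - alpha) * dt2 tau psi h U i 0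
    - (dx2 h (fun j => (1 - alpha / 3) * U j 1%N + alpha / 3 * U j 0%N) i
       + f (i%:R * h) ((1 - alpha / 3) * tau))|
  <= truncation_const * (tau ^+ 2 + h ^+ 2).
Proof.
move=> iM.
pose r := 1 - alpha; have r01 : - 1 < r < 0 by rewrite /r; have := alpha12; lra.
have p1E : 2 - alpha = r + 1 by rewrite /r; ring.
pose x := i%:R * h; have xL : 0 < x < L := grid_xoo iM.
pose th := 1 - alpha / 3; have th01 : 1 / 3 < th < 1 by rewrite /th; have := alpha12; lra.
have tau0 := tau_gt0.
have tauT : 0 <= tau <= T by have := grid_t N0; rewrite mul1r.
pose s := th * tau.
have s0 : 0 < s by rewrite mulr_gt0//; have := th01; lra.
have sE : s <= tau by rewrite /s ler_piMl ?ltW//; have /andP[] := th01.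
have sT : 0 <= s <= T by lra.
have t3 : 0 <= tau / 3 <= T by lra.
have B0' := B0.
have zT : 0 <= (0 : R) <= T by rewrite lexx ltW.
pose W := dt2 tau psi h U i 0.
have xL' : 0 <= x <= L by lra.
have sm := C44_smooth_shift L0 T0 DP (isT : (0 <= 4)%N) (isT : (2 + 2 <= 4)%N) xL.
have WE y : 0 <= y <= s -> `|D 0 2 x y - (W + D 0 3 x (tau / 3) * (y - tau / 3))| <= 4 * B * tau ^+ 2.
  move=> /andP[y0 ys]; have yT : 0 <= y <= T by lra.
  have b := linear_taylor_bound sm (fun t tT => D04 xL' tT) t3 yT.
  have bn := dt2_U_node0 iM.
  rewrite (_ : _ - _ = (D 0 2 x y - (D 0 2 x (tau / 3) + D 0 3 x (tau / 3) * (y - tau / 3))) - (W - D 0 2 x (tau / 3))); last by ring.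
  apply: le_trans (ler_normB _ _) _.
  have : B * (y - tau / 3) ^+ 2 <= B * tau ^+ 2.
    have : `|y - tau / 3| <= tau by rewrite ler_norml; lra.
    by move=> h; rewrite ler_wpM2l// -real_normK ?num_real// lerXn2r// nnegrE ltW.
  move: b bn; rewrite -/W -/x /=; lra.
have cw : {within `[0, s], continuous (D 0 2 x)}.
  apply: (@continuous_subspaceW _ _ _ `[0, T]).
    by apply: subset_itv; rewrite bnd_simp//; have /andP[] := sT.
  exact: (C44_within_t DP).
(* Since 1 - alpha/3 = (r + 2)/3, the centroid of [0, s] is tau/3, the node represented by delta_t^2
   u^0. *)
have ex : s - tau / 3 = (s - 0) * (r + 1) / (r + 2).
  rewrite /s /th /r; field.
  by apply/andP; split; rewrite ?pnatr_eq0 -?lt0n// gt_eqF//; have := alpha12; lra.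
have QE := quadrature_centroid r01 (ltW s0) ex cw WE.
have [_ e2] := integ_powR_refl (andP r01).1 (ltW s0) (lexx s).
rewrite e2 !subr0 subrr powR0 ?subr0 -?p1E -/r in QE; last first.
  by rewrite gt_eqF//; have := p01; lra.
have capE : (Gamma (2 - alpha))^-1 * integ 0 s (fun y => D 0 2 x y * (s - y) `^ r) =
    D 2 0 x s + f x s by rewrite -(pde xL) ?s0//; have /andP[] := sT.
have E1 : 0 <= 4 * B * tau ^+ 2 <= 11 * B * tau ^+ 2.
  have := sqr_ge0 tau; move: (tau ^+ 2) => y y0.
  by have := mulr_ge0 B0' y0; lra.
have C1 := caputo_bound sT E1 QE; rewrite capE in C1.
have [G1 GE] := Gamma_gt0_rec p01.
(* By the functional equation of Gamma, the left-hand side of the first scheme equation is the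
   centroid rule on the single cell [0, s]. *)
have q : (Gamma (3 - alpha))^-1 * s `^ (2 - alpha) * W =
    (Gamma (2 - alpha))^-1 * (W * (s `^ (2 - alpha) / (2 - alpha))).
  rewrite (_ : 3 - alpha = 2 - alpha + 1); last by ring.
  by rewrite GE invfM; ring.
rewrite -/th -/s -/W q dx2_lin -/x.
have X0 := @dx2_U i 0 iM (leq0n N).
have X1 := @dx2_U i 1 iM N0.
rewrite mul0r in X0 *; rewrite mul1r in X1 *.
have dist1 : `|tau - 0| <= tau by rewrite subr0 gtr0_norm.
have dist3 : `|s - 0| <= tau by rewrite subr0 gtr0_norm.
have Y1 := uxx_taylor xL zT tauT dist1.
have Ys := uxx_taylor xL zT sT dist3.
rewrite !subr0 in Y1 Ys.
have a3 : alpha / 3 = 1 - th by rewrite /th; ring.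
rewrite a3 /truncation_const {QE capE q e2 GE WE cw}.
move: C1 X0 X1 Y1 Ys B0' tau0 th01; rewrite -/x.
have -> : s = th * tau by [].
move: (dx2 _ _ _) (dx2 _ _ _) (_ / Gamma _) (_^-1 * _) (f _ _).
move: (D 2 0 x (th * _)) (D 2 0 x (T / _)) (D 2 0 x 0) (D 2 1 x 0).
move: (T / N%:R) (L / M%:R).
clear; move=> tau h Ds Dp a b d1 d0 K Q F C1 X0 X1 Y1 Ys B0 tau0 /andP[th0 th1].
have t2 : 0 <= tau ^+ 2 by exact: sqr_ge0.
have h2 : 0 <= h ^+ 2 by exact: sqr_ge0.
have Bt : 0 <= B * tau ^+ 2 by exact: mulr_ge0.
have Bh : 0 <= B * h ^+ 2 by exact: mulr_ge0.
pose c := 2 * B * h ^+ 2 + B * tau ^+ 2.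
have Z0 : `|d0 - a| <= c by rewrite /c; lra.
have Z1 : `|d1 - (a + b * tau)| <= c.
  rewrite (_ : _ - _ = (d1 - Dp) + (Dp - (a + b * tau))); last by ring.
  by apply: le_trans (ler_normD _ _) _; rewrite /c; lra.
have w0 : 0 <= 1 - th by lra.
have w1 : 0 <= th by lra.
have := ler_wpM2l w0 Z0; rewrite -[X in X * `|_|](ger0_norm w0) -normrM => z0.
have := ler_wpM2l w1 Z1; rewrite -[X in X * `|_|](ger0_norm w1) -normrM => z1.
set y0 := _ * _ in z0; set y1 := _ * _ in z1.
have -> : Q - (th * d1 + (1 - th) * d0 + F)
  = (Q - (Ds + F)) + (Ds - (a + b * (th * tau))) - (y0 + y1).
  by rewrite /y0 /y1; ring.
have n1 := ler_normB ((Q - (Ds + F)) + (Ds - (a + b * (th * tau)))) (y0 + y1).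
have n2 := ler_normD (Q - (Ds + F)) (Ds - (a + b * (th * tau))).
have n4 := ler_normD y0 y1.
have K0 : 0 <= K * tau ^+ 2 := le_trans (normr_ge0 _) C1.
have tp : 0 < tau ^+ 2 by exact: exprn_gt0.
have Kp : 0 <= K by rewrite -(pmulr_lge0 K tp).
have Kh : 0 <= K * h ^+ 2 by exact: mulr_ge0.
have cs : (1 - th) * c + th * c = c by ring.
move: n1 n2 n4 z0 z1 C1 Ys cs Bt Bh K0 Kh; rewrite /c mulrDl !mulrDr.
by lra.
Qed.

End Truncation.

(** * Summation by parts, a discrete sup bound and a maximum principle *)

Section DiscreteTools.
Variable R : realType.
Implicit Types (P Q w : nat -> R).

Lemma summation_by_parts P Q m : Q 0 = 0 -> Q m.+1 = 0 ->
  \sum_(i < m) (P i.+2 - 2 * P i.+1 + P i) * Q i.+1 =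
  - \sum_(i < m.+1) (P i.+1 - P i) * (Q i.+1 - Q i).
Proof.
move=> Q0 Qm.
have h n : \sum_(i < n) (P i.+2 - 2 * P i.+1 + P i) * Q i.+1 =
    (P n.+1 - P n) * Q n.+1 - (P 1 - P 0) * Q 0
    - \sum_(i < n.+1) (P i.+1 - P i) * (Q i.+1 - Q i).
  elim: n => [|n IH]; first by rewrite big_ord0 big_ord1; ring.
  by rewrite big_ord_recr/= IH [in RHS]big_ord_recr/=; ring.
by rewrite h Q0 Qm; ring.
Qed.

(** Cauchy-Schwarz for a telescoping sum, by induction; [aux] bounds the cross term and is (a - k
    x)^2 >= 0 divided by k. *)
Lemma sqr_le_sum_sqr_diff w n : w 0 = 0 ->
  w n ^+ 2 <= n%:R * \sum_(i < n) (w i.+1 - w i) ^+ 2.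
Proof.
have aux (k : nat) (a s x : R) : 0 <= s -> a ^+ 2 <= k%:R * s ->
    2 * a * x <= s + k%:R * x ^+ 2.
  case: k => [|k] s0.
    rewrite mul0r => ha; have /eqP : a ^+ 2 = 0 by apply/le_anti; rewrite ha sqr_ge0.
    by rewrite sqrf_eq0 => /eqP ->; rewrite mulr0 !mul0r addr0.
  have k0 : 0 < k.+1%:R :> R by rewrite ltr0n.
  move: (k.+1%:R) k0 => b b0 ha; rewrite -(ler_pM2l b0).
  by have := sqr_ge0 (a - b * x); rewrite !expr2 in ha *; lra.
move=> w0; elim: n => [|n IH]; first by rewrite w0 expr0n mul0r.
rewrite big_ord_recr/= -natr1; set s := \sum_(_ < _) _ in IH *.
set x := w n.+1 - w n; rewrite (_ : w n.+1 = w n + x); last by rewrite /x; ring.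
have s0 : 0 <= s by apply: sumr_ge0 => i _; exact: sqr_ge0.
have := aux n (w n) s x s0 IH; rewrite !expr2 in IH *; lra.
Qed.

Lemma discrete_sup_bound w m i : w 0 = 0 -> (i <= m)%N ->
  w i ^+ 2 <= m%:R * \sum_(j < m) (w j.+1 - w j) ^+ 2.
Proof.
move=> w0 im; apply: le_trans (sqr_le_sum_sqr_diff i w0) _.
apply: ler_pM => //; first by apply: sumr_ge0 => j _; exact: sqr_ge0.
  by rewrite ler_nat.
rewrite -(subnKC im) big_split_ord/= lerDl.
by apply: sumr_ge0 => j _; exact: sqr_ge0.
Qed.

Lemma exists_argmax w n : exists2 k, (k <= n)%N & forall j, (j <= n)%N -> w j <= w k.
Proof.
elim: n => [|n [k kn kmax]].
  by exists 0%N => // j; rewrite leqn0 => /eqP ->.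
have [h|h] := leP (w k) (w n.+1).
  exists n.+1 => // j; rewrite leq_eqVlt => /orP[/eqP ->//|jn].
  by apply: le_trans h; exact: kmax.
exists k; first exact: leqW.
by move=> j; rewrite leq_eqVlt => /orP[/eqP ->|jn]; [exact: ltW|exact: kmax].
Qed.

(** Where |w| is largest, w and its second difference have opposite signs, so A |w| is at most |A w
    - C dx2 w| there. *)
Lemma max_principle w m h A C G : 0 < A -> 0 <= C -> 0 <= G ->
  w 0 = 0 -> w m.+1 = 0 ->
  (forall i, (i < m)%N -> `|A * w i.+1 - C * dx2 h w i.+1| <= G) ->
  forall i, (i <= m.+1)%N -> `|w i| <= G / A.
Proof.
move=> A0 C0 G0 w0 wm wG.
have [k km kmax] := exists_argmax (fun i => `|w i|) m.+1.
move=> i im; apply: le_trans (kmax i im) _.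
have GA : 0 <= G / A by rewrite divr_ge0// ltW.
case: k km kmax => [|k] km kmax; first by rewrite w0 normr0.
move: km; rewrite leq_eqVlt => /orP[/eqP -> |km]; first by rewrite wm normr0.
rewrite ler_pdivlMr// mulrC.
have k1 := kmax k ltac:(lia); have k2 := kmax k.+2 ltac:(lia).
apply: le_trans (wG k km); rewrite /dx2 /=.
have hi : 0 <= C / h ^+ 2 by rewrite divr_ge0// sqr_ge0.
have -> : C * ((w k.+2 - 2 * w k.+1 + w k) / h ^+ 2) =
  C / h ^+ 2 * (w k.+2 - 2 * w k.+1 + w k) by ring.
move: hi k1 k2; move: (C / _) (w k) (w k.+1) (w k.+2) => c x y z c0.
rewrite !ler_norml => /andP[x1 x2] /andP[z1 z2].
have [y0|y0] := leP 0 y.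
  rewrite ger0_norm// in x1 x2 z1 z2 *.
  have : c * (z - 2 * y + x) <= 0 by rewrite mulr_ge0_le0//; lra.
  by have := ler_norm (A * y - c * (z - 2 * y + x)); lra.
rewrite ltr0_norm// in x1 x2 z1 z2 *.
have : 0 <= c * (z - 2 * y + x) by rewrite mulr_ge0//; lra.
by have := ler_normr (A * y - c * (z - 2 * y + x)) (A * y - c * (z - 2 * y + x)); 
   have := ler_norm (- (A * y - c * (z - 2 * y + x))); rewrite normrN; lra.
Qed.

Lemma young_le (a b eps : R) : 0 < eps -> a * b <= eps / 2 * b ^+ 2 + a ^+ 2 / (2 * eps).
Proof.
move=> e0; rewrite -subr_ge0.
have -> : eps / 2 * b ^+ 2 + a ^+ 2 / (2 * eps) - a * b =
  (eps * b - a) ^+ 2 / (2 * eps) by field; rewrite gt_eqF.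
by rewrite divr_ge0 ?sqr_ge0// mulr_ge0// ltW.
Qed.

(** K <= (1 + K)^2 keeps square roots out of the constants. *)
Lemma norm_le_of_sqr (x K rho : R) : 0 <= K -> 0 <= rho -> x ^+ 2 <= K * rho ^+ 2 ->
  `|x| <= (1 + K) * rho.
Proof.
move=> K0 r0 h; have h1 : 0 <= (1 + K) * rho by rewrite mulr_ge0//; lra.
rewrite -(@ler_pXn2r _ 2%N)// ?nnegrE// real_normK ?num_real//.
apply: (le_trans h); rewrite exprMn ler_wpM2r ?sqr_ge0//.
by have := mulr_ge0 K0 K0; rewrite expr2; lra.
Qed.

End DiscreteTools.

(** * Stability: the error is bounded by the size rho of the residuals *)

Section Stability.
Variable R : realType.
Variables (r g a1 T L : R).
Hypotheses (r01 : - 1 < r < 0) (g0 : 0 < g) (a0 : 0 < a1) (T0 : 0 < T) (L0 : 0 < L).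
Notation c := (tail_len r).
Notation gc := (c `^ r).

(* Up to powers of tau: stab2 and stab3 bound W^2, stab4 bounds delta_t^2 e^1,
   stab5 the source left in the convolution form, stab6 the energy, stab1 e^1;
   stab_eps is the Young parameter that lets the kernel absorb the velocities. *)
Definition stab2 : R := 4 + g * (3 * gc + 3 * (3 / 2 * gc + last_mass r)) / (2 * a1).
Definition stab3 : R := stab2 * (16 / 15) / (g * gc).
Definition stab4 : R := 2 * stab3 + 2 / a1.
Definition stab5 : R := 1 + g * (5 / 2 * gc * stab4 + 3 / 2 * gc / a1).
Definition stab_eps : R := 2^-1 * g * T `^ r.
Definition stab6 : R := 3 * T / (a1 * T `^ r)
  + T * (g * ker r 0 / (4 * a1 ^+ 2 * T `^ r) + stab5 ^+ 2 / stab_eps)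
  + T * stab_eps / (4 * a1 ^+ 2 * (T `^ r) ^+ 2).
Definition stab1 : R := T / (2 * a1 * T `^ r).

Lemma tail_len_bnd : 1 / 2 < c < 1. Proof. by rewrite /tail_len; have := r01; lra. Qed.

Lemma gc_gt0 : 0 < gc.
Proof. by apply: powR_gt0; have := tail_len_bnd; lra. Qed.

Lemma last_mass_gt0 : 0 < last_mass r.
Proof. exact: lt_le_trans gc_gt0 (last_mass_ge r01). Qed.

Lemma stab2_gt0 : 0 < stab2.
Proof.
have := gc_gt0; have := last_mass_gt0; rewrite /stab2.
move: gc (last_mass r) => x y y0 x0; apply: addr_gt0 => //.
apply: divr_gt0; last exact: mulr_gt0.
by apply: mulr_gt0 => //; lra.
Qed.

Lemma stab3_gt0 : 0 < stab3.
Proof.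
have h2 := stab2_gt0; have hg := gc_gt0.
by rewrite /stab3; apply: divr_gt0; [lra|exact: mulr_gt0].
Qed.

Lemma stab4_gt0 : 0 < stab4.
Proof.
have h3 := stab3_gt0; have ha : 0 < 2 / a1 by exact: divr_gt0.
by rewrite /stab4; lra.
Qed.

Lemma stab6_ge0 : 0 <= stab6.
Proof.
have t0p : 0 < T `^ r by exact: powR_gt0.
have eps0 : 0 < stab_eps by rewrite /stab_eps !mulr_gt0.
rewrite /stab6; apply: addr_ge0; first apply: addr_ge0.
- by rewrite divr_ge0 ?mulr_ge0// ltW.
- rewrite mulr_ge0 ?(ltW T0)// addr_ge0// divr_ge0 ?sqr_ge0 ?mulr_ge0 ?ker_ge0 ?sqr_ge0//; exact: ltW.
- by rewrite divr_ge0 ?mulr_ge0 ?sqr_ge0//; exact: ltW.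
Qed.

Variables (N m : nat) (e : nat -> nat -> R) (rho : R) (S0 : nat -> R) (S : nat -> nat -> R).
Variable th : R.
Hypotheses (N0 : (0 < N)%N) (th1 : 1 / 3 < th) (rho0 : 0 <= rho).
Notation tau := (T / N%:R).
Notation h := (L / m.+1%:R).
Notation p := (tau `^ (r + 1)).
Notation W := (fun i k => c * e i k + (1 - c) * e i k.-1).
(* delta_t^2 e_i^j for a grid function with e^0 = 0 and psi = 0 *)
Definition acc (i j : nat) : R :=
  if j is k.+1 then (e i k.+2 - 2 * e i k.+1 + e i k) / tau ^+ 2 else 2 * e i 1 / tau ^+ 2.
Hypothesis e_init : forall i, (i <= m.+1)%N -> e i 0 = 0.
Hypothesis e_left : forall k, (k <= N)%N -> e 0 k = 0.
Hypothesis e_right : forall k, (k <= N)%N -> e m.+1 k = 0.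
Hypothesis S0_le : forall i, (i < m)%N -> `|S0 i| <= rho.
Hypothesis S_le : forall i n, (i < m)%N -> (n.+1 < N)%N -> `|S i n| <= rho.
Hypothesis scheme0 : forall i, (i < m)%N ->
  a1 * p * acc i.+1 0 = th * dx2 h (fun j => e j 1) i.+1 + S0 i.
Hypothesis schemeS : forall i n, (i < m)%N -> (n.+1 < N)%N ->
  g * p * quadrature r n (acc i.+1) =
  dx2 h (fun j => 2^-1 * W j n.+2 + 2^-1 * W j n.+1) i.+1 + S i n.

Let tau0 : 0 < tau. Proof. by rewrite divr_gt0// ltr0n. Qed.
Let h0 : 0 < h. Proof. by rewrite divr_gt0// ltr0n. Qed.
Let p0 : 0 < p. Proof. exact: powR_gt0. Qed.
Let q : R := p / tau ^+ 2.
Let q0 : 0 < q. Proof. by rewrite divr_gt0// exprn_gt0. Qed.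
Let t1 : R := p / tau.
Let t1_gt0 : 0 < t1. Proof. by rewrite divr_gt0. Qed.
Let t0 : R := T `^ r.
Let t0_gt0 : 0 < t0. Proof. exact: powR_gt0. Qed.

Let Nn : N%:R != 0 :> R. Proof. by rewrite pnatr_eq0 -lt0n. Qed.
Let Tn : T != 0. Proof. by rewrite gt_eqF. Qed.
Let an : a1 != 0. Proof. by rewrite gt_eqF. Qed.
Let pn : p != 0. Proof. by rewrite gt_eqF. Qed.
Let cn : c != 0. Proof. by rewrite gt_eqF//; have := tail_len_bnd; lra. Qed.

Let t1E : t1 = tau `^ r.
Proof.
rewrite /t1 powRD ?(gt_eqF tau0) ?implybT// powRr1 ?ltW//.
by rewrite mulfK// gt_eqF.
Qed.

Let tau_le : tau <= T.
Proof. by rewrite ler_pdivrMr ?ltr0n// ler_peMr ?(ltW T0)// ler1n. Qed.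

Let t0_le : t0 <= t1.
Proof. by rewrite t1E; apply: powR_neg_nincr => //; exact: tau0. Qed.

(** From [ker_ge] and k + 2 <= N: since r < 0, tau^r (k + 2)^r >= (tau N)^r = T^r, a bound free of
    tau. *)
Let ker_lower k : (k.+1 < N)%N -> t0 <= t1 * ker r k.
Proof.
move=> kN; have Nr : 0 < N%:R :> R by rewrite ltr0n.
have -> : t0 = t1 * N%:R `^ r.
  by rewrite t1E -powRM ?(ltW tau0) ?(ltW Nr)// divfK// gt_eqF.
rewrite ler_pM2l//; apply: le_trans (ker_ge r01 k).
by apply: powR_neg_nincr; rewrite ?ltr0n// ler_nat.
Qed.

Let aq_gt0 : 0 < 2 * a1 * q.
Proof. by apply: mulr_gt0 q0; exact: mulr_gt0. Qed.

(** As e^0 = 0, the first equation reads 2 a1 q e^1 - th dx2 e^1 = S0 with q = tau^(r-1), and the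
    maximum principle applies. *)
Let E1 i : (i <= m.+1)%N -> `|e i 1| <= rho / (2 * a1 * q).
Proof.
move=> im; apply: (@max_principle R (fun i => e i 1) m h (2 * a1 * q) th rho) => //.
- by have := th1; lra.
- exact: e_left.
- exact: e_right.
move=> j jm; apply: le_trans (S0_le jm); rewrite le_eqVlt; apply/orP; left; apply/eqP.
congr `|_|; have := scheme0 jm; rewrite /acc /q => H.
by rewrite -[RHS](addKr (th * dx2 h (fun j => e j 1) j.+1)) -H; ring.
Qed.

Let D1 i : (i < m)%N -> `|dx2 h (fun j => e j 1) i.+1| <= 6 * rho.
Proof.
move=> im; have H := scheme0 im.
have hE := E1 (ltnW im : (i.+1 <= m.+1)%N).
have hq : `|a1 * p * acc i.+1 0| <= rho.
  have -> : a1 * p * acc i.+1 0 = 2 * a1 * q * e i.+1 1 by rewrite /acc /q; ring.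
  rewrite normrM (gtr0_norm aq_gt0); rewrite (ler_pdivlMr _ _ aq_gt0) in hE.
  by rewrite mulrC.
have h2 : `|th * dx2 h (fun j => e j 1) i.+1| <= 2 * rho.
  rewrite (_ : th * _ = a1 * p * acc i.+1 0 - S0 i); last by rewrite H addrK.
  by apply: le_trans (ler_normB _ _) _; have := S0_le im; lra.
move: h2; move: (dx2 _ _ _) => d; have := th1 => tt.
rewrite normrM gtr0_norm; last by lra.
have : 1 / 3 * `|d| <= th * `|d| by rewrite ler_wpM2r// ltW.
by lra.
Qed.

(** The equation for n = 0 is solved for W^2 rather than e^2, because its implicit part is half of
    dx2 W^2. Substituting e^2 = (W^2 - (1 - c) e^1)/c leaves W^2 the coefficient [A], positive
    because [last_mass_ge] outweighs the -1/16 of [kerA1_ge]; this is the origin of 15/16. *)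
Let E2 i : (1 < N)%N -> (i <= m.+1)%N -> `|W i 2| <= stab3 * rho / q.
Proof.
move=> N1 im; have gp := gc_gt0; have cb := tail_len_bnd; have lp := last_mass_gt0.
pose k0 := 3 / 2 * ker0 r (c + 0%:R + 1 / 2).
pose m1 := 3 / 2 * kerA1 r (c + 0%:R + 1 / 2) + last_mass r.
have c0 : 0 < c by lra.
have cK : c + 1 / 2 <= c + 0%:R + 1 / 2 by rewrite addr0.
have k0b : `|k0| <= 3 / 2 * gc.
  by have := ker0_norm_le r01 c0 cK; rewrite /k0 normrM (@gtr0_norm _ (3 / 2))//; lra.
have cK' : 1 / 2 + c <= c + 0%:R + 1 / 2 by rewrite addr0 addrC.
have m1b := kerA1_ge r01 cK'.
have lm := last_mass_ge r01; rewrite -/(last_mass r) in lm.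
have m1l : 15 / 16 * gc <= m1 by rewrite /m1; lra.
have m10 : 0 < m1 by lra.
have m1u : `|m1| <= 3 / 2 * gc + last_mass r.
  rewrite (gtr0_norm m10); have := kerA1_norm_le r01 c0 cK; rewrite /m1.
  by have := ler_norm (kerA1 r (c + 0%:R + 1 / 2)); lra.
pose A := g * q * m1 / c; have gq0 : 0 < g * q := mulr_gt0 g0 q0.
have A0 : 0 < A := divr_gt0 (mulr_gt0 gq0 m10) c0.
have A1 : g * q * (15 / 16 * gc) <= A.
  rewrite /A (ler_pdivlMr _ _ c0) -(mulrA (g * q)) (ler_pM2l gq0).
  have g1 : 0 <= 15 / 16 * gc by lra.
  by apply: le_trans m1l; rewrite (ler_piMr g1)//; lra.
suff h2 : `|W i 2| <= stab2 * rho / A.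
  apply: (le_trans h2); rewrite (ler_pdivrMr _ _ A0).
  have -> : stab2 * rho = stab3 * rho / q * (g * q * (15 / 16 * gc)).
    rewrite /stab3; field.
    by rewrite (gt_eqF q0) (gt_eqF gp) (gt_eqF g0).
  apply: ler_wpM2l => //; apply: divr_ge0; last exact: ltW q0.
  by apply: mulr_ge0 => //; exact: ltW stab3_gt0.
apply: (@max_principle R (fun i => W i 2) m h A 2^-1 (stab2 * rho)) => //.
- by rewrite mulr_ge0// ltW// stab2_gt0.
- by rewrite !e_left ?mulr0 ?addr0//; lia.
- by rewrite !e_right ?mulr0 ?addr0//; lia.
move=> j jm.
have H := schemeS jm N1.
have hE := E1 (ltnW jm : (j.+1 <= m.+1)%N).
have hD := D1 jm; have hS := S_le jm N1.
have lin : dx2 h (fun j => 2^-1 * W j 2 + 2^-1 * W j 1) j.+1 =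
    2^-1 * dx2 h (fun j => W j 2) j.+1 + 2^-1 * c * dx2 h (fun j => e j 1) j.+1.
  rewrite /dx2 /= (e_init (jm : (j.+2 <= m.+1)%N)) (e_init (ltnW jm : (j.+1 <= m.+1)%N)) (e_init (leqW (ltnW jm) : (j <= m.+1)%N)).
  by ring.
rewrite lin in H.
have -> : A * W j.+1 2 - 2^-1 * dx2 h (fun j => W j 2) j.+1 =
  (2^-1 * c * dx2 h (fun j => e j 1) j.+1 + S j 0)
  - g * (2 * k0 - m1 * ((1 - c) / c + 2)) * (q * e j.+1 1).
  have H2 : 2^-1 * dx2 h (fun j => W j 2) j.+1 =
    g * p * quadrature r 0 (acc j.+1) - 2^-1 * c * dx2 h (fun j => e j 1) j.+1 - S j 0.
    by rewrite H; ring.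
  rewrite H2 /quadrature /quadrature_head big_ord0 /acc -/k0.
  rewrite /A /m1 /k0 /q (e_init (ltnW jm : (j.+1 <= m.+1)%N)) /=.
  by field; rewrite ?Nn ?Tn ?cn.
have qe : `|q * e j.+1 1| <= rho / (2 * a1).
  rewrite normrM gtr0_norm// mulrC -ler_pdivlMr//.
  by rewrite -mulrA -invfM.
have cc : 0 <= (1 - c) / c + 2 <= 3.
  have y0 : 0 <= (1 - c) / c by rewrite divr_ge0; lra.
  have y1 : (1 - c) / c <= 1 by rewrite ler_pdivrMr; lra.
  by move: ((1 - c) / c) y0 y1 => y y0 y1; lra.
have big : `|2 * k0 - m1 * ((1 - c) / c + 2)| <= 3 * gc + 3 * (3 / 2 * gc + last_mass r).
  apply: le_trans (ler_normB _ _) _; have /andP[cc0 cc1] := cc; rewrite (normrM 2 k0) (normrM m1) (ger0_norm cc0) (@ger0_norm _ 2)//.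
  have m3 : `|m1| * ((1 - c) / c + 2) <= (3 / 2 * gc + last_mass r) * 3 by exact: ler_pM.
  move: m3 k0b; move: (_ * ((1 - c) / c + 2)) `|k0| => y1 y2; lra.
apply: le_trans (ler_normB _ _) _.
have n1 : `|2^-1 * c * dx2 h (fun j => e j 1) j.+1 + S j 0| <= 4 * rho.
  apply: le_trans (ler_normD _ _) _; rewrite (normrM (2^-1 * c)) (normrM 2^-1) (@gtr0_norm _ 2^-1)// (gtr0_norm c0).
  have : 2^-1 * c * `|dx2 h (fun j => e j 1) j.+1| <= 2^-1 * 1 * (6 * rho).
    by apply: ler_pM => //; lra.
  by move: hS; move: `|dx2 _ _ _| `|S j 0| => y1 y2; lra.
have n2 : `|g * (2 * k0 - m1 * ((1 - c) / c + 2)) * (q * e j.+1 1)| <=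
    g * (3 * gc + 3 * (3 / 2 * gc + last_mass r)) / (2 * a1) * rho.
  rewrite normrM [leRHS](_ : _ = (g * (3 * gc + 3 * (3 / 2 * gc + last_mass r))) * (rho / (2 * a1))); last by ring.
  by apply: ler_pM => //; rewrite (normrM g) (gtr0_norm g0) ler_pM2l.
rewrite /stab2 [leRHS]mulrDl; exact: lerD n1 n2.
Qed.

Let accel0 i : (i < m)%N -> `|acc i.+1 0| <= rho / (a1 * p).
Proof.
move=> im; have hE := E1 (ltnW im : (i.+1 <= m.+1)%N).
have tp : 0 < 2 / tau ^+ 2 by rewrite divr_gt0// exprn_gt0.
have -> : acc i.+1 0 = 2 / tau ^+ 2 * e i.+1 1 by rewrite /acc; ring.
have -> : rho / (a1 * p) = 2 / tau ^+ 2 * (rho / (2 * a1 * q)).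
  by rewrite /q; field; rewrite ?Nn ?Tn ?an ?pn.
by rewrite normrM (gtr0_norm tp) (ler_pM2l tp).
Qed.

Let accel1 i : (1 < N)%N -> (i < m)%N -> `|acc i.+1 1| <= stab4 * rho / p.
Proof.
move=> N1 im; have i1 : (i.+1 <= m.+1)%N := ltnW im.
have hE := E1 i1; have hW := E2 N1 i1; have cb := tail_len_bnd.
have tp : 0 < tau ^+ 2 by rewrite exprn_gt0.
rewrite /acc (e_init i1) addr0 (normrM _ (tau ^+ 2)^-1) (@gtr0_norm _ (tau ^+ 2)^-1) ?invr_gt0//.
rewrite (ler_pdivrMr _ _ tp).
have -> : stab4 * rho / p * tau ^+ 2 = 2 * (stab3 * rho / q) + 4 * (rho / (2 * a1 * q)).
  by rewrite /stab4 /q; field; rewrite ?Nn ?Tn ?an ?pn.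
rewrite /= in hW.
set w := c * e i.+1 2 + _ in hW.
have e2E : e i.+1 2 - 2 * e i.+1 1 = c^-1 * (w - (1 + c) * e i.+1 1).
  by rewrite /w; field; rewrite ?cn.
have ci : c^-1 <= 2.
  by rewrite -[leRHS]invrK lef_pV2 ?posrE ?invr_gt0//; lra.
rewrite e2E normrM gtr0_norm ?invr_gt0; last by lra.
have h1 : `|w - (1 + c) * e i.+1 1| <= stab3 * rho / q + 2 * (rho / (2 * a1 * q)).
  apply: le_trans (ler_normB _ _) _; rewrite normrM (@gtr0_norm _ (1 + c)); last by lra.
  have : (1 + c) * `|e i.+1 1| <= 2 * (rho / (2 * a1 * q)) by rewrite ler_pM//; lra.
  by lra.
have : c^-1 * `|w - (1 + c) * e i.+1 1| <= 2 * (stab3 * rho / q + 2 * (rho / (2 * a1 * q))).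
  by rewrite ler_pM// invr_ge0; lra.
by lra.
Qed.

(** The residual once all weights are replaced by the pure convolution. It differs from [S] by the
    corrections of [quadrature_ker], which are O(rho) uniformly in tau because p times [acc] at
    levels 0 and 1 is. *)
Let src i n := g * p * (\sum_(j < n.+1) ker r (n - j) * acc i.+1 j.+1)
  - dx2 h (fun j => 2^-1 * W j n.+2 + 2^-1 * W j n.+1) i.+1.

Let src_le i n : (i < m)%N -> (n.+1 < N)%N -> `|src i n| <= stab5 * rho.
Proof.
move=> im nN; have N1 : (1 < N)%N := leq_ltn_trans (ltn0Sn n) nN.
have H := schemeS im nN; rewrite quadrature_ker // in H.
set k1 := 3 / 2 * kerA1 r _ - _ in H; set k2 := 3 / 2 * ker0 r _ in H.
have cb := tail_len_bnd; have gp := gc_gt0; have n0 := ler0n R n.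
have c0 : 0 < c by lra.
have k2b : `|k2| <= 3 / 2 * gc.
  have cK : c + 1 / 2 <= c + n%:R + 1 / 2 by lra.
  by have := ker0_norm_le r01 c0 cK; rewrite /k2 normrM (@gtr0_norm _ (3 / 2))//; lra.
have k1b : `|k1| <= 5 / 2 * gc.
  have cK : c + 1 / 2 <= c + n%:R + 1 / 2 by lra.
  have cK' : c + 1 <= c + 1 + n%:R by lra.
  have := kerA1_norm_le r01 c0 cK; have := kerA_norm_le r01 c0 cK'.
  rewrite /k1; move: (kerA _ _) (kerA1 _ _) => x y hx hy.
  by apply: le_trans (ler_normB _ _) _; rewrite normrM (@gtr0_norm _ (3 / 2))//; lra.
have -> : src i n = S i n - g * (k1 * (p * acc i.+1 1) + k2 * (p * acc i.+1 0)).
  have -> : S i n = g * p * (\sum_(j < n.+1) ker r (n - j) * acc i.+1 j.+1 + k1 * acc i.+1 1 + k2 * acc i.+1 0)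
     - dx2 h (fun j => 2^-1 * W j n.+2 + 2^-1 * W j n.+1) i.+1 by rewrite H; ring.
  by rewrite /src; move: (\sum_(j < n.+1) _) (dx2 _ _ _) => x y; ring.
have hp1 : `|p * acc i.+1 1| <= stab4 * rho.
  by rewrite normrM gtr0_norm// mulrC -ler_pdivlMr//; exact: accel1.
have hp0 : `|p * acc i.+1 0| <= rho / a1.
  rewrite normrM gtr0_norm// mulrC -ler_pdivlMr//.
  by rewrite -mulrA -invfM; exact: accel0.
apply: le_trans (ler_normB _ _) _; rewrite normrM (gtr0_norm g0).
have h1 : `|k1 * (p * acc i.+1 1)| <= 5 / 2 * gc * (stab4 * rho) by rewrite normrM ler_pM.
have h2 : `|k2 * (p * acc i.+1 0)| <= 3 / 2 * gc * (rho / a1) by rewrite normrM ler_pM.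
have h3 := ler_normD (k1 * (p * acc i.+1 1)) (k2 * (p * acc i.+1 0)).
have h4 : g * `|k1 * (p * acc i.+1 1) + k2 * (p * acc i.+1 0)| <=
  g * (5 / 2 * gc * (stab4 * rho) + 3 / 2 * gc * (rho / a1)) by rewrite ler_pM2l//; lra.
have := S_le im nN.
have -> : stab5 * rho = rho + g * (5 / 2 * gc * (stab4 * rho) + 3 / 2 * gc * (rho / a1)).
  by rewrite /stab5; field; rewrite ?an.
by lra.
Qed.

Let v i j : R := (e i j.+1 - e i j) / tau.
(** The sums over space carry no factor h, so the bounds on [V 0] and [En] carry a factor m. *)
Let V k : R := \sum_(i < m) v i.+1 k ^+ 2.
Let Phi n : R := \sum_(i < m) \sum_(j < n) ker r (n - j.+1) * v i.+1 j.+1 ^+ 2.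
Let En k : R := \sum_(i < m.+1) (W i.+1 k - W i k) ^+ 2 / h ^+ 2.

Let V_ge0 k : 0 <= V k.
Proof. by apply: sumr_ge0 => i _; exact: sqr_ge0. Qed.

(** The convolution inequality at one space node with theta = -r/2 = 1 - c, for which its test
    quantity is exactly (W^{n+2} - W^{n+1})/tau; Young's inequality then detaches the source. *)
Let energy_point i n : (i < m)%N -> (n.+1 < N)%N ->
  2^-1 * g * t1 * (\sum_(j < n.+1) ker r (n.+1 - j.+1) * v i.+1 j.+1 ^+ 2
    - \sum_(j < n) ker r (n - j.+1) * v i.+1 j.+1 ^+ 2 - ker r 0 * v i.+1 0 ^+ 2) <=
  dx2 h (fun j => 2^-1 * W j n.+2 + 2^-1 * W j n.+1) i.+1 * ((W i.+1 n.+2 - W i.+1 n.+1) / tau)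
  + (stab_eps / 2 * (v i.+1 n.+1 ^+ 2 + v i.+1 n ^+ 2) + (stab5 * rho) ^+ 2 / (2 * stab_eps)).
Proof.
move=> im nN.
have eps0 : 0 < stab_eps by rewrite /stab_eps !mulr_gt0// powR_gt0.
have gap : (- r / 2) ^+ 2 * ker r 1 <= (1 - 2 * (- r / 2)) * (ker r 0 - ker r 1).
  rewrite (_ : (- r / 2) ^+ 2 = r ^+ 2 / 4); last by field.
  rewrite (_ : 1 - 2 * (- r / 2) = 1 + r); last by field.
  exact: ker_gap.
have Q := convolution_quadratic_ge (ker_ge0 r01) (ker_nincr r01) gap (v i.+1) n.
set y := v i.+1 n.+1 - _ in Q.
have yE : (W i.+1 n.+2 - W i.+1 n.+1) / tau = y.
  by rewrite /y /v /tail_len /=; field; rewrite ?Nn ?Tn.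
(* Convexity of the square: y is a convex combination of the two velocities. *)
have y2 : y ^+ 2 <= v i.+1 n.+1 ^+ 2 + v i.+1 n ^+ 2.
  have cb := tail_len_bnd.
  have -> : y = c * v i.+1 n.+1 + (1 - c) * v i.+1 n by rewrite /y /tail_len; field.
  move: (v _ _) (v _ _) c cb => b a x /andP[x0 x1].
  have h1 : 0 <= (1 - x) * x * (a - b) ^+ 2.
    by rewrite mulr_ge0 ?sqr_ge0// mulr_ge0//; lra.
  have h2 : 0 <= (1 - x) * a ^+ 2 by rewrite mulr_ge0 ?sqr_ge0//; lra.
  have h3 : 0 <= x * b ^+ 2 by rewrite mulr_ge0 ?sqr_ge0//; lra.
  by rewrite !expr2 in h1 h2 h3 *; lra.
have sumE : \sum_(j < n.+1) ker r (n - j) * (v i.+1 j.+1 ^+ 2 - v i.+1 j ^+ 2) =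
    \sum_(j < n.+1) ker r (n.+1 - j.+1) * v i.+1 j.+1 ^+ 2
    - \sum_(j < n) ker r (n - j.+1) * v i.+1 j.+1 ^+ 2 - ker r n * v i.+1 0 ^+ 2.
  under eq_bigr do rewrite mulrBr.
  rewrite sumrB [X in _ - X = _]big_ord_recl subn0 opprD addrA addrAC.
  by congr (_ - _ - _); apply: eq_bigr => j _; rewrite ?subSS.
rewrite sumE in Q.
have kn : ker r n * v i.+1 0 ^+ 2 <= ker r 0 * v i.+1 0 ^+ 2.
  by rewrite ler_wpM2r ?sqr_ge0// ker_le0.
have srcE : g * t1 * (\sum_(j < n.+1) ker r (n - j) * (v i.+1 j.+1 - v i.+1 j)) =
    dx2 h (fun j => 2^-1 * W j n.+2 + 2^-1 * W j n.+1) i.+1 + src i n.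
  rewrite /src addrC subrK /t1 -!mulrA; congr (_ * (_ * _)).
  rewrite mulr_sumr; apply: eq_bigr => j _.
  by rewrite /acc /v; field; rewrite ?Nn ?Tn.
rewrite yE; have Sy := young_le (src i n) y eps0.
have S2 : (src i n) ^+ 2 <= (stab5 * rho) ^+ 2.
  have hs := src_le im nN.
  by rewrite -real_normK ?num_real// lerXn2r// nnegrE// (le_trans _ hs).
have S3 : (src i n) ^+ 2 / (2 * stab_eps) <= (stab5 * rho) ^+ 2 / (2 * stab_eps).
  by rewrite ler_wpM2r// invr_ge0 mulr_ge0// ltW.
have Y3 : stab_eps / 2 * y ^+ 2 <= stab_eps / 2 * (v i.+1 n.+1 ^+ 2 + v i.+1 n ^+ 2).
  by rewrite ler_wpM2l// divr_ge0// ltW.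
have gt0 : 0 <= g * t1 := mulr_ge0 (ltW g0) (ltW t1_gt0).
have Q2 := ler_wpM2l gt0 Q; rewrite [leRHS]mulrA srcE in Q2.
set A1 := \sum_(j < n.+1) _ in Q2 *; set A2 := \sum_(j < n) _ in Q2 *.
have kn2 := ler_wpM2l gt0 kn; rewrite -(mulrA 2^-1 g t1).
move: Q2 kn2 Sy S3 Y3; rewrite -/y.
move: (dx2 _ _ _) (src _ _) (stab_eps / 2 * y ^+ 2) (stab_eps / 2 * _)  => d s z1 z2.
move: (s ^+ 2 / _) ((stab5 * rho) ^+ 2 / _) (ker r n * _) (ker r 0 * _) => z3 z4 z5 z6.
move: (g * t1) => gg H1 H2 H3 H4 H5; clearbody A1 A2 y; lra.
Qed.

Let Phi0 : Phi 0 = 0.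
Proof. by rewrite /Phi big1// => i _; rewrite big_ord0. Qed.

Let W_edge k : (k <= N)%N -> W 0 k = 0 /\ W m.+1 k = 0.
Proof.
move=> kN; have kN' := leq_trans (leq_pred k) kN.
by rewrite !e_left// !e_right// !mulr0 addr0.
Qed.

Let spatial_energy n : (n.+1 < N)%N ->
  \sum_(i < m) dx2 h (fun j => 2^-1 * W j n.+2 + 2^-1 * W j n.+1) i.+1 *
    ((W i.+1 n.+2 - W i.+1 n.+1) / tau) = - ((En n.+2 - En n.+1) / (2 * tau)).
Proof.
move=> nN; have [a1' b1'] := W_edge nN; have [a2' b2'] := W_edge (ltnW nN).
pose P j := 2^-1 * W j n.+2 + 2^-1 * W j n.+1.
pose Q j := (W j n.+2 - W j n.+1) / tau.
have Q0 : Q 0 = 0 by rewrite /Q a1' a2' subrr mul0r.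
have Qm : Q m.+1 = 0 by rewrite /Q b1' b2' subrr mul0r.
have SP := summation_by_parts P Q0 Qm.
transitivity ((h ^+ 2)^-1 * \sum_(i < m) (P i.+2 - 2 * P i.+1 + P i) * Q i.+1).
  by rewrite mulr_sumr; apply: eq_bigr => i _; rewrite /dx2 -/(P _) /=; rewrite /P /Q; ring.
rewrite SP mulrN; congr (- _); rewrite mulr_sumr -sumrB mulr_suml.
apply: eq_bigr => i _; rewrite /P /Q.
have hn : h ^+ 2 != 0 by rewrite gt_eqF// exprn_gt0.
have tn : tau != 0 by rewrite gt_eqF.
move: hn tn; move: (h ^+ 2) tau (W i.+1 _) (W i.+1 _) (W i _) (W i _) => x y z1 z2 z3 z4 hn tn.
by field; rewrite hn tn.
Qed.

Let energy_step n : (n.+1 < N)%N ->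
  2^-1 * g * t1 * (Phi n.+1 - Phi n - ker r 0 * V 0) + (En n.+2 - En n.+1) / (2 * tau) <=
  stab_eps / 2 * (V n.+1 + V n) + m%:R * ((stab5 * rho) ^+ 2 / (2 * stab_eps)).
Proof.
move=> nN.
have H : \sum_(i < m) (2^-1 * g * t1 * (\sum_(j < n.+1) ker r (n.+1 - j.+1) * v i.+1 j.+1 ^+ 2
    - \sum_(j < n) ker r (n - j.+1) * v i.+1 j.+1 ^+ 2 - ker r 0 * v i.+1 0 ^+ 2)) <=
  \sum_(i < m) (dx2 h (fun j => 2^-1 * W j n.+2 + 2^-1 * W j n.+1) i.+1 * ((W i.+1 n.+2 - W i.+1 n.+1) / tau)
  + (stab_eps / 2 * (v i.+1 n.+1 ^+ 2 + v i.+1 n ^+ 2) + (stab5 * rho) ^+ 2 / (2 * stab_eps))).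
  by apply: ler_sum => i _; apply: energy_point.
rewrite [leLHS](_ : _ = 2^-1 * g * t1 * (Phi n.+1 - Phi n - ker r 0 * V 0)) in H; last first.
  by rewrite -mulr_sumr !sumrB -mulr_sumr.
rewrite [leRHS](_ : _ = - ((En n.+2 - En n.+1) / (2 * tau)) + (stab_eps / 2 * (V n.+1 + V n)
    + m%:R * ((stab5 * rho) ^+ 2 / (2 * stab_eps)))) in H; last first.
  rewrite big_split/= spatial_energy//; congr (_ + _).
  by rewrite big_split/= -mulr_sumr big_split/= sumr_const card_ord -[_ *+ m]mulr_natl.
move: H; move: ((En n.+2 - _) / _) (2^-1 * g * t1 * _) (stab_eps / 2 * _) (m%:R * _) => x y z w H.
by lra.
Qed.

Let energy_sum n : (n < N)%N ->
  2^-1 * g * t1 * Phi n + (En n.+1 - En 1) / (2 * tau) <=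
  n%:R * (2^-1 * g * t1 * (ker r 0 * V 0) + m%:R * ((stab5 * rho) ^+ 2 / (2 * stab_eps)))
  + stab_eps / 2 * \sum_(k < n) (V k.+1 + V k).
Proof.
elim: n => [|n IH] nN.
  by rewrite Phi0 subrr big_ord0 !mulr0 mul0r mul0r.
have {}IH := IH (ltnW nN); have st := energy_step nN.
rewrite big_ord_recr/= -(natr1 n).
move: IH st; rewrite !mulrBl.
move: (Phi n.+1) (Phi n) (En n.+2 / _) (En n.+1 / _) (En 1 / _) => x1 x2 x3 x4 x5.
move: (\sum_(k < n) _) (V n.+1) (V n) (ker r 0 * _) (m%:R * _) (n%:R) => y1 y2 y3 y4 y5 y6.
move: (2^-1 * g * t1) (stab_eps / 2) => z1 z2 H1 H2; lra.
Qed.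

Let Phi_lower n : (n < N)%N -> t0 * \sum_(k < n) V k.+1 <= t1 * Phi n.
Proof.
move=> nN; rewrite /V /Phi exchange_big/= !mulr_sumr; apply: ler_sum => i _.
rewrite !mulr_sumr; apply: ler_sum => j _.
rewrite mulrA ler_wpM2r ?sqr_ge0//; apply: ker_lower.
by apply: leq_ltn_trans nN; rewrite -subSn// subSS leq_subr.
Qed.

Let q_inv : q^-1 <= T / t0.
Proof.
have -> : q^-1 = tau * t1^-1 by rewrite /q /t1; field; rewrite ?Nn ?Tn ?pn.
apply: ler_pM => //; try exact: ltW; first by rewrite invr_ge0 ltW.
by rewrite lef_pV2 ?posrE.
Qed.

Lemma first_step_bound i : (i <= m.+1)%N -> `|e i 1| <= stab1 * rho.
Proof.
move=> im; apply: le_trans (E1 im) _.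
have -> : rho / (2 * a1 * q) = rho / (2 * a1) * q^-1 by rewrite invfM mulrA.
have -> : stab1 * rho = rho / (2 * a1) * (T / t0).
  by rewrite /stab1 -/t0; field; rewrite an (gt_eqF t0_gt0).
apply: ler_wpM2l q_inv; apply: divr_ge0 => //.
by apply: mulr_ge0 => //; exact: ltW.
Qed.

Let V0_le : V 0 <= m%:R * (rho / (2 * a1 * t1)) ^+ 2.
Proof.
have -> : m%:R * (rho / (2 * a1 * t1)) ^+ 2 = \sum_(i < m) (rho / (2 * a1 * t1)) ^+ 2.
  by rewrite sumr_const card_ord mulr_natl.
apply: ler_sum => i _; have im := ltn_ord i.
have i1 : (i.+1 <= m.+1)%N := ltnW im; have hE := E1 i1.
have hv : `|v i.+1 0| <= rho / (2 * a1 * t1).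
  rewrite /v (e_init i1) subr0 normrM (@gtr0_norm _ tau^-1) ?invr_gt0//.
  rewrite (ler_pdivrMr _ _ tau0); apply: le_trans hE _.
  by rewrite le_eqVlt; apply/orP; left; apply/eqP; rewrite /q /t1; field; rewrite ?Nn ?Tn ?an ?pn.
by rewrite -real_normK ?num_real// lerXn2r// nnegrE// (le_trans _ hv).
Qed.

(** W^1 = c e^1, so summation by parts rewrites this energy as -c^2 times the sum of (dx2 e^1) e^1.
    Both factors are already bounded by [D1] and [E1], so no power of h is lost. *)
Let En1_le : En 1 <= m%:R * (3 / a1 * q^-1) * rho ^+ 2.
Proof.
have cb := tail_len_bnd.
have z j : (j <= m.+1)%N -> W j 1 = c * e j 1 by move=> jm; rewrite /= (e_init jm) mulr0 addr0.
have Q0 : e 0 1 = 0 by exact: e_left.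
have Qm : e m.+1 1 = 0 by exact: e_right.
have SP := @summation_by_parts R (fun j => e j 1) (fun j => e j 1) m Q0 Qm.
have -> : En 1 = - (c ^+ 2 * \sum_(i < m) dx2 h (fun j => e j 1) i.+1 * e i.+1 1).
  have -> : \sum_(i < m) dx2 h (fun j => e j 1) i.+1 * e i.+1 1 =
     (h ^+ 2)^-1 * \sum_(i < m) (e i.+2 1 - 2 * e i.+1 1 + e i 1) * e i.+1 1.
    by rewrite mulr_sumr; apply: eq_bigr => i _; rewrite /dx2 /=; ring.
  rewrite SP mulrN mulrN opprK mulr_sumr mulr_sumr; apply: eq_bigr => i _.
  by rewrite !z; [ring|exact: ltnW|exact: ltn_ord].
rewrite -mulrN -sumrN.
have -> : m%:R * (3 / a1 * q^-1) * rho ^+ 2 = 1 * \sum_(i < m) (6 * rho * (rho / (2 * a1 * q))).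
  rewrite sumr_const card_ord -[_ *+ m]mulr_natl mul1r.
  by move: q q0 => x x0; field; rewrite an (gt_eqF x0).
have c2 : 0 <= c ^+ 2 <= 1 by rewrite sqr_ge0 expr_le1//; lra.
have /andP[c20 c21] := c2.
have S6 : \sum_(i < m) - (dx2 h (fun j => e j 1) i.+1 * e i.+1 1) <=
    \sum_(i < m) (6 * rho * (rho / (2 * a1 * q))).
  apply: ler_sum => i _; have im := ltn_ord i.
  apply: le_trans (ler_norm _) _; rewrite normrN normrM ler_pM//; first exact: D1.
  exact: E1 (ltnW im : (i.+1 <= m.+1)%N).
have S60 : 0 <= \sum_(i < m) (6 * rho * (rho / (2 * a1 * q))).
  apply: sumr_ge0 => i _; apply: mulr_ge0; first by rewrite mulr_ge0.
  by apply: divr_ge0 => //; exact: ltW aq_gt0.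
apply: le_trans (ler_wpM2l c20 S6) _; exact: ler_wpM2r.
Qed.

Let En_le n : (n < N)%N -> En n.+1 <= m%:R * stab6 * rho ^+ 2.
Proof.
move=> nN; have ES := energy_sum nN; have PL := Phi_lower nN.
have t0p := t0_gt0; have t1p := t1_gt0; have eps0 : 0 < stab_eps by rewrite /stab_eps !mulr_gt0// powR_gt0.
have SV : \sum_(k < n) (V k.+1 + V k) <= 2 * \sum_(k < n) V k.+1 + V 0.
  rewrite big_split/=; have : \sum_(k < n) V k <= \sum_(k < n.+1) V k.
    by rewrite big_ord_recr/= lerDl.
  by rewrite [X in _ <= X -> _]big_ord_recl/=; move: (\sum_(k < n) V k) (\sum_(k < n) V k.+1) (V 0) => x1 x2 x3 H; lra.
have eps2 : 0 <= stab_eps / 2 by rewrite divr_ge0// ltW.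
have SV2 := ler_wpM2l eps2 SV.
have g2 : 0 <= 2^-1 * g by rewrite mulr_ge0// ltW.
have PL2 := ler_wpM2l g2 PL.
(* The reason for this value of [stab_eps]: the velocity sum produced by Young's inequality, twice
   [stab_eps]/2, is cancelled exactly by the lower bound of [Phi] in [Phi_lower]. *)
have epsE : stab_eps = 2^-1 * g * t0 by [].
have ab : (En n.+1 - En 1) / (2 * tau) <=
  n%:R * (2^-1 * g * t1 * (ker r 0 * V 0) + m%:R * ((stab5 * rho) ^+ 2 / (2 * stab_eps)))
  + stab_eps / 2 * V 0.
  move: ES SV2 PL2; rewrite [stab_eps / 2 * (2 * _ + _)]mulrDr !mulrA.
  rewrite [stab_eps / 2 * 2](_ : _ = 2^-1 * g * t0); last by rewrite -epsE; field.
  move: (2^-1 * g * t0 * _) (2^-1 * g * t1 * Phi n) ((_ - En 1) / _) (_ * \sum_(k < n) (V k.+1 + V k)) => x1 x2 x3 x4 H1 H2 H3.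
  lra.
have nt : n%:R * tau <= T.
  by rewrite mulrA ler_pdivrMr ?ltr0n// mulrC ler_pM2l// ler_nat ltnW.
have V0l := V0_le; have E1l := En1_le; have V00 := V_ge0 0.
set b := rho / (2 * a1 * t1) in V0l.
have t11 : t1^-1 <= t0^-1 by rewrite lef_pV2 ?posrE// t0_le.
have ti0 : 0 <= t1^-1 by rewrite invr_ge0 ltW.
have mr : 0 <= m%:R * rho ^+ 2 by rewrite mulr_ge0// sqr_ge0.
have a2 : 0 < 4 * a1 ^+ 2 by rewrite mulr_gt0// exprn_gt0.
have tV : t1 * V 0 <= m%:R * rho ^+ 2 / (4 * a1 ^+ 2) * t0^-1.
  apply: le_trans (ler_wpM2l (ltW t1p) V0l) _.
  have -> : t1 * (m%:R * b ^+ 2) = m%:R * rho ^+ 2 / (4 * a1 ^+ 2) * t1^-1.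
    by rewrite /b; move: t1 t1p => x xp; field; rewrite an (gt_eqF xp).
  by apply: ler_wpM2l t11; exact: divr_ge0 mr (ltW a2).
have V0b : V 0 <= m%:R * rho ^+ 2 / (4 * a1 ^+ 2) * (t0^-1) ^+ 2.
  apply: (le_trans V0l).
  have -> : m%:R * b ^+ 2 = m%:R * rho ^+ 2 / (4 * a1 ^+ 2) * (t1^-1) ^+ 2.
    by rewrite /b; move: t1 t1p => x xp; field; rewrite an (gt_eqF xp).
  apply: ler_wpM2l; first exact: divr_ge0 mr (ltW a2).
  by rewrite lerXn2r// nnegrE// invr_ge0 ltW.
have tau2 : 0 < 2 * tau by rewrite mulr_gt0.
rewrite (ler_pdivrMr _ _ tau2) in ab.
pose K := g * ker r 0 * (t1 * V 0) + m%:R * rho ^+ 2 * (stab5 ^+ 2 / stab_eps).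
have abE : (n%:R * (2^-1 * g * t1 * (ker r 0 * V 0) + m%:R * ((stab5 * rho) ^+ 2 / (2 * stab_eps)))
  + stab_eps / 2 * V 0) * (2 * tau) = n%:R * tau * K + tau * (stab_eps * V 0).
  rewrite /K; move: tau t1 stab_eps eps0 => x y ee ee0.
  by field; rewrite (gt_eqF ee0).
rewrite abE in ab.
have gk : 0 <= g * ker r 0 by rewrite mulr_ge0 ?ker_ge0// ltW.
have K0 : 0 <= K.
  apply: addr_ge0; first by rewrite mulr_ge0// mulr_ge0// ltW.
  by apply: mulr_ge0 => //; rewrite divr_ge0 ?sqr_ge0// ltW.
have KT : n%:R * tau * K <= T * K by apply: ler_wpM2r.
have KU : T * K <= T * (g * ker r 0 * (m%:R * rho ^+ 2 / (4 * a1 ^+ 2) * t0^-1) + m%:R * rho ^+ 2 * (stab5 ^+ 2 / stab_eps)).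
  by rewrite ler_pM2l// lerD2r; apply: ler_wpM2l.
have VT : tau * (stab_eps * V 0) <= T * (stab_eps * (m%:R * rho ^+ 2 / (4 * a1 ^+ 2) * (t0^-1) ^+ 2)).
  apply: ler_pM; [exact: ltW tau0|by apply: mulr_ge0 => //; exact: ltW|exact: tau_le|].
  by apply: ler_wpM2l V0b; exact: ltW.
have E1u : En 1 <= m%:R * (3 / a1 * (T / t0)) * rho ^+ 2.
  apply: (le_trans E1l); rewrite ler_wpM2r ?sqr_ge0//; apply: ler_wpM2l => //.
  by apply: ler_wpM2l q_inv; rewrite divr_ge0// ltW.
have fin : m%:R * stab6 * rho ^+ 2 = m%:R * (3 / a1 * (T / t0)) * rho ^+ 2 +
  T * (g * ker r 0 * (m%:R * rho ^+ 2 / (4 * a1 ^+ 2) * t0^-1) + m%:R * rho ^+ 2 * (stab5 ^+ 2 / stab_eps))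
  + T * (stab_eps * (m%:R * rho ^+ 2 / (4 * a1 ^+ 2) * (t0^-1) ^+ 2)).
  rewrite /stab6 -/t0; move: stab_eps eps0 (ker r 0) stab5 t0 t0p => ee ee0 k s5 x xp.
  by field; rewrite an (gt_eqF ee0) (gt_eqF xp).
have lin (x1 x2 x3 x4 x5 x6 x7 x8 : R) : x1 - x2 <= x3 + x5 -> x3 <= x4 ->
    x4 <= x6 -> x5 <= x7 -> x2 <= x8 -> x1 <= x8 + x6 + x7 by move=> *; lra.
by rewrite fin; exact: lin ab KT KU VT E1u.
Qed.

Lemma weighted_error_bound i k : (i <= m.+1)%N -> (0 < k <= N)%N ->
  `|W i k| <= (1 + L ^+ 2 * stab6) * rho.
Proof.
move=> im; case: k => // n /= nN.
have s6 := stab6_ge0.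
apply: norm_le_of_sqr => //; first by rewrite mulr_ge0 ?sqr_ge0.
have [w0 _] := W_edge nN.
have := @discrete_sup_bound R (fun i => W i n.+1) m.+1 i w0 im; move=> /le_trans; apply.
have -> : \sum_(j < m.+1) (W j.+1 n.+1 - W j n.+1) ^+ 2 = h ^+ 2 * En n.+1.
  rewrite /En mulr_sumr; apply: eq_bigr => j _.
  by rewrite mulrCA divff ?mulr1// gt_eqF// exprn_gt0.
have M0 : 0 < m.+1%:R :> R by rewrite ltr0n.
have E := En_le nN.
(* Raising m to m + 1 lets the factors combine to ((m + 1) h)^2 = L^2. *)
have mE : m%:R * stab6 * rho ^+ 2 <= m.+1%:R * stab6 * rho ^+ 2.
  by rewrite ler_wpM2r ?sqr_ge0// ler_wpM2r// ler_nat.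
have Mh : 0 <= m.+1%:R * h ^+ 2 by rewrite mulr_ge0 ?sqr_ge0.
rewrite mulrA; apply: le_trans (ler_wpM2l Mh (le_trans E mE)) _.
rewrite le_eqVlt; apply/orP; left; apply/eqP.
by move: (m.+1%:R) M0 => x x0; field; rewrite (gt_eqF x0).
Qed.

End Stability.

(** * Assembly of the final error estimate *)

Lemma maxnorm_le (R : realType) M (w : nat -> R) C : 0 <= C ->
  (forall i, (i <= M)%N -> `|w i| <= C) -> maxnorm M w <= C.
Proof.
move=> C0 wC; rewrite /maxnorm; elim/big_ind: _ => // [x y xC yC|i _].
  by rewrite ge_max xC.
by apply: wC; rewrite -ltnS.
Qed.

(** The extrapolation undoes the averaging c F(t + tau) + (1 - c) F(t) up to (1 - c)^2 times the
    second difference F(t + tau) - 2 F(t) + F(t - tau). *)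
Lemma uhat_consistency (R : realType) (F : nat -> R -> R) T B c t tau :
  smooth_on 2 0 T F -> (forall s, 0 <= s <= T -> `|F 2 s| <= B) -> 1 / 2 < c < 1 ->
  0 < tau -> 0 <= t - tau -> t + tau <= T ->
  `|F 0 (t + tau) - ((2 - c) * (c * F 0 (t + tau) + (1 - c) * F 0 t)
     - (1 - c) * (c * F 0 t + (1 - c) * F 0 (t - tau)))| <= 2 * B * tau ^+ 2.
Proof.
move=> sF FB /andP[c0 c1] tau0 h1 h2.
have tT : 0 <= t <= T by lra.
have t1T : 0 <= t + tau <= T by lra.
have t2T : 0 <= t - tau <= T by lra.
have b1 := linear_taylor_bound sF FB tT t1T.
have b2 := linear_taylor_bound sF FB tT t2T.
have e1 : t + tau - t = tau by ring.
have e2 : t - tau - t = - tau by ring.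
rewrite e1 in b1; rewrite e2 sqrrN in b2.
pose r1 := F 0 (t + tau) - (F 0 t + F 1 t * tau).
pose r2 := F 0 (t - tau) - (F 0 t + F 1 t * - tau).
rewrite -/r1 in b1; rewrite -/r2 in b2.
have -> : F 0 (t + tau) - ((2 - c) * (c * F 0 (t + tau) + (1 - c) * F 0 t)
     - (1 - c) * (c * F 0 t + (1 - c) * F 0 (t - tau))) = (1 - c) ^+ 2 * (r1 + r2).
  by rewrite /r1 /r2; ring.
have q1 : 0 <= (1 - c) ^+ 2 by exact: sqr_ge0.
have q2 : (1 - c) ^+ 2 <= 1 by rewrite expr_le1//; lra.
rewrite normrM (ger0_norm q1).
have n : `|r1 + r2| <= 2 * B * tau ^+ 2 by apply: le_trans (ler_normD _ _) _; lra.
by apply: le_trans n; rewrite ler_piMl.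
Qed.

Lemma truncation_const_ge0 (R : realType) (alpha T B : R) : 1 < alpha < 2 -> 0 <= B ->
  0 <= truncation_const alpha T B.
Proof.
move=> a12 B0; have p01 : 0 < 2 - alpha < 1 by lra.
have [G0 _] := Gamma_gt0_rec p01; have /andP[p0 _] := p01.
rewrite /truncation_const; apply: addr_ge0; first by rewrite mulr_ge0.
apply: divr_ge0; last exact: ltW.
by apply: mulr_ge0; [rewrite mulr_ge0|rewrite divr_ge0 ?powR_ge0// ltW].
Qed.

Theorem theorem3 (R : realType) (alpha L T : R) (f : R -> R -> R) (phi psi : R -> R)
    (u : R -> R -> R) :
  1 < alpha < 2 -> 0 < L -> 0 < T ->
  is_C44_solution alpha L T f phi psi u ->
  (forall w, is_C44_solution alpha L T f phi psi w ->
     forall x t, 0 <= x <= L -> 0 <= t <= T -> w x t = u x t) ->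
  exists c5 : R, 0 < c5 /\
    forall (N M : nat) (v : nat -> nat -> R), (0 < N)%N -> (0 < M)%N ->
      solves_scheme alpha L T f phi psi N M v ->
      forall k, (k <= N)%N ->
        maxnorm M (fun i => ehat alpha L T N M u v i k)
        <= c5 * ((T / N%:R) ^+ 2 + (L / M%:R) ^+ 2).
Proof.
move=> alpha12 L0 T0 [D [DP pde u0 ut0 ubd]] _.
have [B1 B10 D04'] := C44_bounded DP (isT : (0 <= 4)%N) (isT : (4 <= 4)%N).
have [B2 B20 D40'] := C44_bounded DP (isT : (4 <= 4)%N) (isT : (0 <= 4)%N).
have [B3 B30 D22'] := C44_bounded DP (isT : (2 <= 4)%N) (isT : (2 <= 4)%N).
have [B4 B40 D02] := C44_bounded DP (isT : (0 <= 4)%N) (isT : (2 <= 4)%N).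
pose B := B1 + B2 + B3.
have D04 x t : 0 <= x <= L -> 0 <= t <= T -> `|D 0 4 x t| <= B.
  by move=> hx ht; have := D04' x t hx ht; rewrite /B; lra.
have D40 x t : 0 <= x <= L -> 0 <= t <= T -> `|D 4 0 x t| <= B.
  by move=> hx ht; have := D40' x t hx ht; rewrite /B; lra.
have D22 x t : 0 <= x <= L -> 0 <= t <= T -> `|D 2 2 x t| <= B.
  by move=> hx ht; have := D22' x t hx ht; rewrite /B; lra.
have B0 : 0 <= B by rewrite /B; lra.
pose r := 1 - alpha; have r01 : - 1 < r < 0 by rewrite /r; lra.
have p1E : 2 - alpha = r + 1 by rewrite /r; ring.
have p01 : 0 < 2 - alpha < 1 by lra.
have [G0 GE] := Gamma_gt0_rec p01.
have G3 : 0 < Gamma (3 - alpha).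
  rewrite (_ : 3 - alpha = 2 - alpha + 1); last by ring.
  by rewrite GE mulr_gt0//; lra.
pose g := (Gamma (2 - alpha))^-1; have g0 : 0 < g by rewrite invr_gt0.
pose th := 1 - alpha / 3; have th1 : 1 / 3 < th by rewrite /th; lra.
have th0 : 0 <= th by apply/ltW/(lt_trans _ th1); lra.
pose a1 := (Gamma (3 - alpha))^-1 * th `^ (2 - alpha).
have a0 : 0 < a1 by rewrite mulr_gt0 ?invr_gt0// powR_gt0//; lra.
pose K := truncation_const alpha T B.
have K0 : 0 <= K by exact: truncation_const_ge0.
pose c := tail_len r; have cb : 1 / 2 < c < 1 := tail_len_bnd r01.
have cE : 1 / 2 + sigma alpha = c by rewrite /c /tail_len /r /sigma; field.
have cE' : 1 / 2 - sigma alpha = 1 - c by rewrite /c /tail_len /r /sigma; field.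
pose Cw := 1 + L ^+ 2 * stab6 r g a1 T.
have Cw0 : 0 <= Cw by rewrite addr_ge0// mulr_ge0 ?sqr_ge0// stab6_ge0.
pose C1 := stab1 r a1 T.
have C10 : 0 <= C1.
  by rewrite /C1 /stab1 divr_ge0 ?(ltW T0)// mulr_ge0 ?powR_ge0// mulr_ge0// ltW.
(* [K] is the truncation constant, [C1] covers the levels k <= 1, 3 [Cw] the two averaged errors in
   the extrapolation, 2 [B4] its consistency error, and 1 secures positivity. *)
exists (1 + K * (C1 + 3 * Cw) + 2 * B4); split.
  have : 0 <= K * (C1 + 3 * Cw) by rewrite mulr_ge0// addr_ge0// mulr_ge0.
  by move: (K * _) => y; lra.
move=> N [//|m] v N0 M0 [sch0 schS vphi vbd].
set tau := T / N%:R in sch0 schS *; set h := L / m.+1%:R in sch0 schS vphi *.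
have tau0 : 0 < tau := tau_gt0 T0 N0.
have h0 : 0 < h := h_gt0 L0 M0.
pose U i k := u (i%:R * h) (k%:R * tau).
pose e i k := U i k - v i k.
pose rho := K * (tau ^+ 2 + h ^+ 2).
have d0 : 0 <= tau ^+ 2 + h ^+ 2 by rewrite addr_ge0 ?sqr_ge0.
have rho0 : 0 <= rho by exact: mulr_ge0.
have MhL : m.+1%:R * h = L by rewrite /h mulrCA divff ?mulr1// pnatr_eq0.
have Ubd k : (k <= N)%N -> U 0 k = 0 /\ U m.+1 k = 0.
  move=> kN; rewrite /U MhL mul0r; apply: ubd.
  exact: (grid_t T0 N0 kN).
have e_left k : (k <= N)%N -> e 0 k = 0.
  by move=> kN; rewrite /e (Ubd k kN).1 (vbd k kN).1 subrr.
have e_right k : (k <= N)%N -> e m.+1 k = 0.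
  by move=> kN; rewrite /e (Ubd k kN).2 (vbd k kN).2 subrr.
(* At the corners the value comes from the boundary data, since the scheme prescribes phi at
   interior nodes only. *)
have e_init i : (i <= m.+1)%N -> e i 0 = 0.
  case: i => [_|i]; first exact: e_left.
  rewrite leq_eqVlt => /predU1P[->|im]; first exact: e_right.
  rewrite /e vphi//= /U mul0r u0 ?subrr//.
  exact: (grid_x L0 M0 (ltnW im)).
have intr i : (i < m)%N -> (1 <= i.+1 <= m.+1.-1)%N by [].
have accE i k : (i <= m.+1)%N ->
    dt2 tau psi h U i k - dt2 tau psi h v i k = acc T N e i k.
  move=> im; case: k => [|k]; rewrite /dt2 /acc -/tau /=; last by rewrite /e; ring.
  have -> : 2 * e i 1 = 2 * (e i 1 - e i 0) by rewrite (e_init i im) subr0.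
  by rewrite /e; field; rewrite gt_eqF.
(* Residuals defined by the error equation itself; since v solves the scheme, they coincide with the
   truncation errors of [U]. *)
pose S0 i := a1 * tau `^ (r + 1) * acc T N e i.+1 0 - th * dx2 h (fun j => e j 1) i.+1.
have S0_le i : (i < m)%N -> `|S0 i| <= rho.
  move=> im; have TR := truncation0 alpha12 L0 T0 DP pde ut0 D04 D40 D22 N0 M0 (intr i im).
  apply: le_trans TR; rewrite le_eqVlt; apply/orP; left; apply/eqP; congr `|_|.
  have im1 : (i.+1 <= m.+1)%N := ltnW im.
  have im2 : (i <= m.+1)%N := leqW (ltnW im).
  have := sch0 i.+1 (intr i im); rewrite -/tau -/h => H.
  rewrite /S0 -(accE i.+1 0 im1) -p1E.
  have -> : a1 * tau `^ (2 - alpha) = (Gamma (3 - alpha))^-1 * (th * tau) `^ (2 - alpha).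
    by rewrite /a1 (powRM _ th0 (ltW tau0)) mulrA.
  have dE : dx2 h (fun j => e j 1) i.+1 = dx2 h (fun j => U j 1) i.+1 - dx2 h (fun j => v j 1) i.+1.
    by rewrite /dx2 /e; ring.
  have d00 : dx2 h (fun j => U j 0) i.+1 - dx2 h (fun j => v j 0) i.+1 = 0.
    have -> : dx2 h (fun j => U j 0) i.+1 - dx2 h (fun j => v j 0) i.+1 = dx2 h (fun j => e j 0) i.+1.
      by rewrite /dx2 /e; ring.
    by rewrite /dx2 /= (e_init i.+2 im) (e_init i.+1 im1) (e_init i im2); ring.
  rewrite dE mulrBr H !dx2_lin; move/eqP: d00; rewrite subr_eq0 => /eqP d00.
  by rewrite -/th d00; ring.
pose S i n := g * tau `^ (r + 1) * quadrature r n (acc T N e i.+1) -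
  dx2 h (fun j => 2^-1 * (c * e j n.+2 + (1 - c) * e j n.+1) + 2^-1 * (c * e j n.+1 + (1 - c) * e j n)) i.+1.
have S_le i n : (i < m)%N -> (n.+1 < N)%N -> `|S i n| <= rho.
  move=> im nN; have nN1 : (n.+1 <= N.-1)%N by rewrite -ltnS prednK.
  have TR := truncationS alpha12 L0 T0 DP pde ut0 D04 D40 D22 N0 M0 (intr i im) nN1.
  apply: le_trans TR; rewrite le_eqVlt; apply/orP; left; apply/eqP; congr `|_|.
  have im1 : (i.+1 <= m.+1)%N := ltnW im.
  have := schS i.+1 n.+1 (intr i im) nN1; rewrite -/tau -/h /= => H.
  rewrite /S -mulrA -p1E /r -(coef_c_sum tau n (acc T N e i.+1) alpha12).
  have -> : \sum_(0 <= l < n.+2) coef_c alpha tau n.+1 l * acc T N e i.+1 (n.+1 - l) =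
     \sum_(0 <= l < n.+2) coef_c alpha tau n.+1 l * dt2 tau psi h U i.+1 (n.+1 - l)
     - \sum_(0 <= l < n.+2) coef_c alpha tau n.+1 l * dt2 tau psi h v i.+1 (n.+1 - l).
    by rewrite -sumrB; apply: eq_bigr => l _; rewrite -(accE i.+1 _ im1) mulrBr.
  rewrite mulrBr H cE cE' !dx2_half -/(U _ _).
  by rewrite /g /dx2 /e /U /=; ring.
have sc0 i : (i < m)%N -> a1 * tau `^ (r + 1) * acc T N e i.+1 0 =
    th * dx2 h (fun j => e j 1) i.+1 + S0 i.
  by move=> _; rewrite /S0; ring.
have scS i n : (i < m)%N -> (n.+1 < N)%N ->
  g * tau `^ (r + 1) * quadrature r n (acc T N e i.+1) =
  dx2 h (fun j => 2^-1 * (c * e j n.+2 + (1 - c) * e j n.+1) + 2^-1 * (c * e j n.+1 + (1 - c) * e j n)) i.+1 + S i n.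
  by move=> _ _; rewrite /S; ring.
have e1b i : (i <= m.+1)%N -> `|e i 1| <= C1 * rho.
  exact: (first_step_bound r01 a0 T0 N0 th1 rho0 e_left e_right S0_le sc0).
have Wb i k : (i <= m.+1)%N -> (0 < k <= N)%N ->
    `|c * e i k + (1 - c) * e i k.-1| <= Cw * rho.
  exact: (weighted_error_bound r01 g0 a0 T0 L0 N0 th1 rho0 e_init e_left e_right S0_le S_le sc0 scS).
have Kd : (1 + K * (C1 + 3 * Cw) + 2 * B4) * (tau ^+ 2 + h ^+ 2) =
    (tau ^+ 2 + h ^+ 2) + C1 * rho + 3 * (Cw * rho) + 2 * B4 * (tau ^+ 2 + h ^+ 2).
  by rewrite /rho; ring.
have p1 : 0 <= C1 * rho by exact: mulr_ge0.
have p3 : 0 <= Cw * rho by exact: mulr_ge0.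
have p4 : 0 <= 2 * B4 * h ^+ 2 by rewrite mulr_ge0 ?sqr_ge0// mulr_ge0// ltW.
have p5 : 0 <= 2 * B4 * tau ^+ 2 by rewrite mulr_ge0 ?sqr_ge0// mulr_ge0// ltW.
have total : 0 <= (1 + K * (C1 + 3 * Cw) + 2 * B4) * (tau ^+ 2 + h ^+ 2).
  by rewrite Kd mulrDr; move: (C1 * _) (Cw * _) p1 p3 => y z y0 z0; lra.
move=> k kN; apply: maxnorm_le => // i im.
rewrite /ehat -/tau -/h; case: ifP => [k1|].
  have : `|e i k| <= C1 * rho.
    case: k kN k1 => [|[|//]] kN _; first by rewrite (e_init i im) normr0.
    exact: e1b.
  rewrite -/(U i k) -/(e i k) Kd mulrDr; move: (C1 * _) (Cw * _) p3 => y z z0 H; lra.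
move/negbT; rewrite -ltnNge; case: k kN => [//|[//|k]] kN _.
rewrite /uhat.
(* Consistency error of the exact solution plus the extrapolation of averaged errors; |2 - c| <= 2
   and |1 - c| <= 1 will give the factor 3. *)
have uE : U i k.+2 - ((3 / 2 - sigma alpha) * ((1 / 2 + sigma alpha) * v i k.+2 + (1 / 2 - sigma alpha) * v i k.+1)
     - (1 / 2 - sigma alpha) * ((1 / 2 + sigma alpha) * v i k.+1 + (1 / 2 - sigma alpha) * v i k)) =
  (U i k.+2 - ((2 - c) * (c * U i k.+2 + (1 - c) * U i k.+1) - (1 - c) * (c * U i k.+1 + (1 - c) * U i k)))
  + ((2 - c) * (c * e i k.+2 + (1 - c) * e i k.+1) - (1 - c) * (c * e i k.+1 + (1 - c) * e i k)).
  have -> : 3 / 2 - sigma alpha = 2 - c by rewrite -cE; field.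
  by rewrite cE cE' /e; ring.
rewrite /= -/(U i k.+2) uE.
have Wa := Wb i k.+2 im kN; have Wc := Wb i k.+1 im (ltnW kN).
have consist : `|U i k.+2 - ((2 - c) * (c * U i k.+2 + (1 - c) * U i k.+1) - (1 - c) * (c * U i k.+1 + (1 - c) * U i k))| <= 2 * B4 * tau ^+ 2.
  have k2 : (k.+1 <= N)%N := ltnW kN; have k3 : (k <= N)%N := ltnW k2.
  have zero : U i k.+2 = 0 -> U i k.+1 = 0 -> U i k = 0 ->
    `|U i k.+2 - ((2 - c) * (c * U i k.+2 + (1 - c) * U i k.+1) - (1 - c) * (c * U i k.+1 + (1 - c) * U i k))| <= 2 * B4 * tau ^+ 2.
    by move=> -> -> ->; rewrite !(mulr0, addr0, subr0) normr0.
  (* Time derivatives are available for 0 < x < L only; on the two lateral sides all values of u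
     vanish instead. *)
  case: i im zero {uE Wa Wc} => [_|i].
    by apply; [exact: (Ubd _ kN).1|exact: (Ubd _ k2).1|exact: (Ubd _ k3).1].
  rewrite leq_eqVlt => /predU1P[->|im] zero.
    by apply: zero; [exact: (Ubd _ kN).2|exact: (Ubd _ k2).2|exact: (Ubd _ k3).2].
  have xL := grid_xoo L0 M0 (intr i im).
  have xL' : 0 <= i.+1%:R * h <= L by have /andP[y1 y2] := xL; rewrite !ltW.
  have tk2 := grid_t T0 N0 kN; have tk := grid_t T0 N0 k3.
  have e2 : k.+2%:R * tau = k.+1%:R * tau + tau by rewrite -(natr1 k.+1) mulrDl mul1r.
  have ek : k%:R * tau = k.+1%:R * tau - tau by rewrite -(natr1 k) mulrDl mul1r addrK.
  have UC := @uhat_consistency R (fun j => D 0 j (i.+1%:R * h)) T B4 c (k.+1%:R * tau) tau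
     (C44_smooth_t DP (isT : (0 <= 4)%N) (isT : (2 <= 4)%N) xL) (fun s sT => D02 _ _ xL' sT) cb tau0.
  rewrite /U e2 ek; have [<- _ _ _] := DP; apply: UC.
    by rewrite -ek; have /andP[] := tk.
  by rewrite -e2; have /andP[] := tk2.
apply: le_trans (ler_normD _ _) _.
have eb : `|(2 - c) * (c * e i k.+2 + (1 - c) * e i k.+1) - (1 - c) * (c * e i k.+1 + (1 - c) * e i k)|
    <= 3 * (Cw * rho).
  have /andP[c0 c1] := cb.
  apply: le_trans (ler_normB _ _) _; rewrite (normrM (2 - c)) (normrM (1 - c)).
  have h1 : `|2 - c| * `|c * e i k.+2 + (1 - c) * e i k.+1| <= 2 * (Cw * rho).
    by apply: ler_pM => //; rewrite ler_norml; lra.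
  have h2 : `|1 - c| * `|c * e i k.+1 + (1 - c) * e i k| <= 1 * (Cw * rho).
    by apply: ler_pM => //; rewrite ler_norml; lra.
  apply: le_trans (lerD h1 h2) _.
  by rewrite le_eqVlt; apply/orP; left; apply/eqP; ring.
apply: le_trans (lerD consist eb) _; rewrite Kd mulrDr.
by move: (C1 * rho) p1 (Cw * rho) => y3 y30 y4; lra.
Qed.
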